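(* Let $\mathcal{G}\in\mathcal{FH}_\infty$ be of size $L_1\times K_1\times\cdots\times L_N\times K_N$. Then the closed-loop feedback system formed by $\mathcal{G}$ and $\Delta$ is internally stable for all $\Delta\in\mathcal{FH}_\infty$ (of size $K_1\times L_1\times\cdots\times K_N\times L_N$) with $\|\Delta\|_\infty\le1$ if and only if $\|\mathcal{G}\|_\infty<1$.
   Context: Fix $\mathcal{F}\in\{\mathbb{R},\mathbb{C}\}$. $\mathcal{FH}_\infty$ denotes the set of proper, rational, stable transfer tensors: even-order paired tensors $\mathcal{G}(s)$ with entries $\mathcal{G}_{i_1j_1\cdots i_Nj_N}(s)$ that are proper rational functions with coefficients in $\mathcal{F}$ and all poles in the open left-half plane. Einstein product: $(\mathcal{A}*\mathcal{B})_{i_1k_1\cdots i_Nk_N}=\sum_{j_1,\dots,j_N}\mathcal{A}_{i_1j_1\cdots i_Nj_N}\mathcal{B}_{j_1k_1\cdots j_Nk_N}$; an $N$th-order tensor is regarded as a paired tensor with all column dimensions 1. $(\mathcal{A}^{\mathrm H})_{j_1i_1\cdots j_Ni_N}=\overline{\mathcal{A}_{i_1j_1\cdots i_Nj_N}}$; $\mathcal{I}$ is the identity tensor. $\|\mathcal{A}\|_2$ is the spectral norm $\sqrt{\lambda_{\max}(\mathcal{A}^{\mathrm H}*\mathcal{A})}$, $\lambda_{\max}$ being the largest $\lambda$ with $\mathcal{A}^{\mathrm H}*\mathcal{A}*\mathcal{X}=\lambda\mathcal{X}$ for some nonzero $N$th-order $\mathcal{X}$; $\|\mathcal{G}\|_\infty:=\sup_{\omega\in\mathbb{R}}\|\mathcal{G}(\iota\omega)\|_2$,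 $\iota=\sqrt{-1}$. A state-space realization $(\mathcal{A},\mathcal{B},\mathcal{C},\mathcal{D})$ (constant even-order paired tensors) of $\mathcal{G}$ satisfies $\mathcal{G}(s)=\mathcal{D}+\mathcal{C}*(s\mathcal{I}-\mathcal{A})^{-1}*\mathcal{B}$ and corresponds to the multilinear system $\dot{\mathcal{X}}=\mathcal{A}*\mathcal{X}+\mathcal{B}*\mathcal{U}$, $\mathcal{Y}=\mathcal{C}*\mathcal{X}+\mathcal{D}*\mathcal{U}$. $(\mathcal{A},\mathcal{B})$ is stabilizable if $\mathrm{Re}(\lambda)\ge0$, $\mathcal{Y}^{\mathrm H}*\mathcal{A}=\lambda\mathcal{Y}^{\mathrm H}$, $\mathcal{Y}^{\mathrm H}*\mathcal{B}=\mathcal{O}$ imply $\mathcal{Y}=\mathcal{O}$; $(\mathcal{C},\mathcal{A})$ is detectable if $\mathrm{Re}(\lambda)\ge0$, $\mathcal{A}*\mathcal{Y}=\lambda\mathcal{Y}$, $\mathcal{C}*\mathcal{Y}=\mathcal{O}$ imply $\mathcal{Y}=\mathcal{O}$. A realization contains no hidden unstable modes iff it is stabilizable and detectable. Feedback system: the plant $\mathcal{G}$ and the uncertainty $\Delta$ are given by stabilizable and detectable realizations $(\mathcal{A}_{\mathcal{G}},\mathcal{B}_{\mathcal{G}},\mathcal{C}_{\mathcal{G}},\mathcal{D}_{\mathcal{G}})$ and $(\mathcal{A}_\Delta,\mathcal{B}_\Delta,\mathcal{C}_\Delta,\mathcal{D}_\Delta)$, and are interconnected in a (positive) feedback loop with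 external signals $w_1,w_2$: $e_1=w_1+\Delta*e_2$, $e_2=w_2+\mathcal{G}*e_1$. The feedback system is internally stable if neither $\mathcal{G}$ nor $\Delta$ contains hidden unstable modes and the injection of bounded external signals at any place in the feedback system results in bounded output signals measured anywhere in the system. (In particular the loop must be well-posed, i.e. $\mathcal{I}-\mathcal{D}_{\mathcal{G}}*\mathcal{D}_\Delta$ invertible; an ill-posed loop is not internally stable.) *)

(* Defs.v *)
From HB Require Import structures.
From mathcomp Require Import all_boot all_order all_algebra generic_quotient.
From mathcomp Require Import complex.
From mathcomp Require Import all_classical all_reals all_analysis.
Set Implicit Arguments. Unset Strict Implicit. Unset Printing Implicit Defensive.
Import Order.TTheory GRing.Theory Num.Theory.
Import numFieldNormedType.Exports.
Local Open Scope classical_set_scope.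
Local Open Scope ring_scope.

(* Multi-indices (i_1, ..., i_N) with i_k < I k. *)
Definition midx (N : nat) (I : 'I_N -> nat) :=
  {dffun forall k : 'I_N, 'I_(I k)}.

(* The entry A_{i_1 j_1 ... i_N j_N} of an even-order paired tensor of size
   I_1 x J_1 x ... x I_N x J_N is A (i, j). *)
Definition tensor (T : Type) (N : nat) (I J : 'I_N -> nat) :=
  {ffun (midx I * midx J)%type -> T}.

(* An N-th order tensor of size I_1 x ... x I_N is a paired tensor all of whose
   column dimensions are 1. *)
Definition ones (N : nat) : 'I_N -> nat := fun=> 1%N.
Definition vtensor (T : Type) (N : nat) (I : 'I_N -> nat) :=
  tensor T I (@ones N).

Section TensorAlgebra.
Variables (T : pzRingType) (N : nat).
Implicit Types I J K : 'I_N -> nat.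

Definition tzero I J : tensor T I J := [ffun=> 0].

Definition tadd I J (A B : tensor T I J) : tensor T I J :=
  [ffun p => A p + B p].

Definition tsub I J (A B : tensor T I J) : tensor T I J :=
  [ffun p => A p - B p].

Definition tscale I J (a : T) (A : tensor T I J) : tensor T I J :=
  [ffun p => a * A p].

Definition tid I : tensor T I I := [ffun p => (p.1 == p.2)%:R].

Definition einstein I J K (A : tensor T I J) (B : tensor T J K) :
    tensor T I K :=
  [ffun p => \sum_(j : midx J) A (p.1, j) * B (j, p.2)].

Definition is_tinv I (A X : tensor T I I) : Prop :=
  einstein A X = tid I /\ einstein X A = tid I.

End TensorAlgebra.

Arguments tzero {T N I J}.
Arguments tid {T N I}.

Declare Scope tensor_scope.
Delimit Scope tensor_scope with T.
Infix "*" := einstein : tensor_scope.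
Infix "+" := tadd : tensor_scope.
Infix "-" := tsub : tensor_scope.
Infix "*:" := tscale : tensor_scope.

(* The two choices of the base field. All scalars live in R[i]; objects over
   the real field are those whose scalars have zero imaginary part. *)
Inductive base_field := RealField | ComplexField.

Definition scalars (R : realType) (F : base_field) : {pred R[i]} :=
  if F is RealField then [pred z | complex.Im z == 0] else predT.

Definition tensor_over (R : realType) (F : base_field) (N : nat)
    (I J : 'I_N -> nat) (A : tensor R[i] I J) : Prop :=
  forall p, A p \in @scalars R F.

Definition tconj (R : realType) (N : nat) (I J : 'I_N -> nat)
    (A : tensor R[i] I J) : tensor R[i] J I :=
  [ffun p => (A (p.2, p.1))^*%C].

Section SpectralNorm.
Variables (R : realType) (N : nat) (I J : 'I_N -> nat).

(* The eigenvalues of A^H * A are real and finite in number, so the supremum of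
   the real ones is the largest eigenvalue. *)
Definition lambda_max (H : tensor R[i] J J) : R :=
  sup [set l : R | exists X : vtensor R[i] J,
         X <> tzero /\ (H * X = l%:C%C *: X)%T].

Definition spectral_norm (A : tensor R[i] I J) : R :=
  Num.sqrt (lambda_max (tconj A * A)%T).

End SpectralNorm.

Section RationalFunctions.
Variable R : realType.
Implicit Types (r : {fraction {poly R[i]}}) (s : R[i]).

(* Numerator and denominator in lowest terms (unique up to a common nonzero
   constant factor). *)
Definition rnum r : {poly R[i]} :=
  let: (p, q) := frac (repr r) in p %/ gcdp p q.
Definition rden r : {poly R[i]} :=
  let: (p, q) := frac (repr r) in q %/ gcdp p q.

(* At a pole, this is the default value 0 of a division by 0. *)
Definition reval r s : R[i] := (rnum r).[s] / (rden r).[s].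

Definition pole r s : Prop := root (rden r) s.

Definition proper r : Prop := (size (rnum r) <= size (rden r))%N.

Definition rational_over (F : base_field) r : Prop :=
  exists p q : {poly R[i]},
    [/\ p \is a polyOver (@scalars R F), q \is a polyOver (@scalars R F),
        q != 0 & r = tofrac p / tofrac q].

Definition stable r : Prop := forall s, pole r s -> complex.Re s < 0.

End RationalFunctions.

Section TransferTensors.
Variables (R : realType) (N : nat) (I J : 'I_N -> nat).

Definition transfer_tensor := tensor {fraction {poly R[i]}} I J.

Implicit Type G : transfer_tensor.

Definition teval G (s : R[i]) : tensor R[i] I J := [ffun p => reval (G p) s].

Definition FHinf (F : base_field) G : Prop :=
  forall p, [/\ rational_over F (G p), proper (G p) & stable (G p)].

Definition Hinf_norm G : \bar R :=
  ereal_sup [set (spectral_norm (teval G (0 +i* w)%C))%:E | w in [set: R]].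

End TransferTensors.

(* Realizations of transfer tensors of size I_1 x J_1 x ... x I_N x J_N, that is
   with inputs of size J_1 x ... x J_N and outputs of size I_1 x ... x I_N; the
   state dimensions are part of the realization, and may be 0. *)
Record realization (R : realType) (N : nat) (I J : 'I_N -> nat) := Realization {
  state_dim : 'I_N -> nat;
  rA : tensor R[i] state_dim state_dim;
  rB : tensor R[i] state_dim J;
  rC : tensor R[i] I state_dim;
  rD : tensor R[i] I J }.

Section Realizations.
Variables (R : realType) (N : nat) (I J : 'I_N -> nat).
Implicit Type S : realization R I J.

Definition realization_over (F : base_field) S : Prop :=
  [/\ tensor_over F (rA S), tensor_over F (rB S), tensor_over F (rC S)
    & tensor_over F (rD S)].

(* The equation G(s) = D + C * (s I - A)^{-1} * B, at all s for which s I - A is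
   invertible. *)
Definition realizes S (G : transfer_tensor R I J) : Prop :=
  forall (s : R[i]) (X : tensor R[i] (state_dim S) (state_dim S)),
    is_tinv (s *: tid - rA S)%T X ->
    teval G s = (rD S + (rC S * X) * rB S)%T.

Definition stabilizable S : Prop :=
  forall (l : R[i]) (Y : vtensor R[i] (state_dim S)),
    0 <= complex.Re l ->
    (tconj Y * rA S = l *: tconj Y)%T ->
    (tconj Y * rB S)%T = tzero ->
    Y = tzero.

Definition detectable S : Prop :=
  forall (l : R[i]) (Y : vtensor R[i] (state_dim S)),
    0 <= complex.Re l ->
    (rA S * Y = l *: Y)%T ->
    (rC S * Y)%T = tzero ->
    Y = tzero.

Definition no_hidden_unstable_modes S : Prop := stabilizable S /\ detectable S.

End Realizations.

(* Time signals; only their values at times t >= 0 matter. *)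
Definition signal (R : realType) (N : nat) (I : 'I_N -> nat) :=
  R -> vtensor R[i] I.

Section Signals.
Variables (R : realType) (N : nat) (I : 'I_N -> nat).
Implicit Types u x : signal R I.

Definition signal_over (F : base_field) u : Prop :=
  forall t : R, 0 <= t -> tensor_over F (u t).

Definition bounded_signal u : Prop :=
  exists M : R, forall t : R, 0 <= t -> forall p, `|u t p| <= M%:C%C.

Definition signal_derive (x : signal R I) (t : R) (v : vtensor R[i] I) : Prop :=
  forall p,
    is_derive t (1 : R) (fun r : R => complex.Re (x r p)) (complex.Re (v p)) /\
    is_derive t (1 : R) (fun r : R => complex.Im (x r p)) (complex.Im (v p)).

Definition signal_right_continuous (x : signal R I) (t : R) : Prop :=
  forall p,
    (complex.Re (x r p) @[r --> t^'+] --> complex.Re (x t p)) /\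
    (complex.Im (x r p) @[r --> t^'+] --> complex.Im (x t p)).

End Signals.

(* x and y are the state and the output of the multilinear system S started at
   rest and driven by the input u. *)
Definition trajectory (R : realType) (N : nat) (I J : 'I_N -> nat)
    (S : realization R I J) (u : signal R J) (x : signal R (state_dim S))
    (y : signal R I) : Prop :=
  [/\ x 0 = tzero,
      signal_right_continuous x 0,
      forall t : R, 0 < t ->
        signal_derive x t (rA S * x t + rB S * u t)%T
    & forall t : R, 0 <= t -> y t = (rC S * x t + rD S * u t)%T].

Section Feedback.
Variables (R : realType) (F : base_field) (N : nat) (L K : 'I_N -> nat).
Variables (SG : realization R L K) (SD : realization R K L).

(* e1 = w1 + Delta * e2 and e2 = w2 + G * e1, where y1 and y2 are the outputs of
   G and Delta. *)
Definition feedback_loop (w1 : signal R K) (w2 : signal R L)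
    (e1 : signal R K) (e2 : signal R L) (y1 : signal R L) (y2 : signal R K)
    (x1 : signal R (state_dim SG)) (x2 : signal R (state_dim SD)) : Prop :=
  [/\ trajectory e1 x1 y1,
      trajectory e2 x2 y2,
      forall t : R, 0 <= t -> e1 t = (w1 t + y2 t)%T
    & forall t : R, 0 <= t -> e2 t = (w2 t + y1 t)%T].

Definition well_posed : Prop := exists X, is_tinv (tid - rD SG * rD SD)%T X.

(* The external signals range over all bounded signals, without any regularity
   assumption, for which the loop has a classical solution; for continuous ones
   well-posedness gives a unique solution. The trajectories start at rest. *)
Definition internally_stable : Prop :=
  [/\ no_hidden_unstable_modes SG, no_hidden_unstable_modes SD, well_posed
    & forall w1 w2 e1 e2 y1 y2 x1 x2,
        feedback_loop w1 w2 e1 e2 y1 y2 x1 x2 ->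
        signal_over F w1 -> signal_over F w2 ->
        signal_over F x1 -> signal_over F x2 ->
        bounded_signal w1 -> bounded_signal w2 ->
        [/\ bounded_signal e1, bounded_signal e2,
            bounded_signal y1 & bounded_signal y2]].

End Feedback.

(* Main.v *)
From mathcomp Require Import all_boot all_order all_algebra.
From mathcomp Require Import generic_quotient perm complex.
From mathcomp Require Import all_classical all_reals all_analysis.
From mathcomp Require Import zify ring lra.
Require Import Defs.
Set Implicit Arguments. Unset Strict Implicit. Unset Printing Implicit Defensive.
Import Order.TTheory GRing.Theory Num.Theory.
Import numFieldNormedType.Exports.
Import ComplexField.
Local Open Scope classical_set_scope.
Local Open Scope ring_scope.
Local Notation nc := Normc.normc.
Local Notation Re := complex.Re.
Local Notation Im := complex.Im.

(** Sufficiency. The state matrices of [G] and [Delta] have no eigenvalue in the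
    closed right half-plane, because both realizations pass the Hautus tests and
    have stable transfer functions ([hurwitz_of_bounded]). A bound on the gain of
    such a system along the imaginary axis then holds on the whole right half-plane
    and at infinity ([gain_half_plane], [gain_feedthrough]). If [|G| < 1] and
    [|Delta| <= 1], the products [D_G D_Delta] and [G(s) Delta(s)] with [Re s >= 0]
    are strict contractions: the loop is well posed, and a closed-loop mode at [s]
    would give a nonzero fixed point of the second contraction. The closed loop is
    therefore a linear system with stable state matrix, and those have bounded
    responses to bounded inputs ([bounded_response]). The maximum principle behind
    [gain_half_plane] is proved for quotients of polynomials only, by following
    roots along a segment of polynomials ([rouche_half_plane]).

    Necessity. If [|G| >= 1], compactness of the extended imaginary axis gives a
    vector [v] that is not contracted by some [G(i w)] or by [D_G]
    ([uniform_gain]). Let [y] be its image. The rank-one matrix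
    [v y^H / |y|^2] takes [y] back to [v] and has Frobenius norm at most 1. Each
    of its entries is the value at [i w] of a stable rational function of degree at
    most 1 whose modulus is constant along the axis ([allpass_interpolation]), so
    that these functions form a [Delta] whose Frobenius norm is at most 1 at every
    frequency. For [D_G], a constant [Delta] makes the loop ill-posed
    ([feedthrough_contracts]). For [G(i w)], the loop resonates at [w], and this is
    shown without solving the closed-loop equations: both blocks are driven
    separately by [t e^(i w t) v] and [t e^(i w t) y], each answers with the input of
    the other up to a bounded error ([resonant_response]), and these errors are
    taken as the external signals ([axis_contracts]). Over the real numbers the
    real parts of these signals are used; when [w = 0], where no oscillation hides
    the growth, [v] itself can be taken real ([expanding_real_vector]). *)

(** * Moduli of complex numbers *)

Section Modulus.
Variable R : realType.
Implicit Types z w : R[i].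

Lemma nc_norm z : `|z| = (nc z)%:C%C. Proof. by []. Qed.

Lemma nc_ge0 z : 0 <= nc z.
Proof. by case: z => a b; exact: sqrtr_ge0. Qed.

Lemma sqr_nc z : nc z ^+ 2 = Re z ^+ 2 + Im z ^+ 2.
Proof. by case: z => a b; rewrite sqr_sqrtr // addr_ge0 // sqr_ge0. Qed.

Lemma nc0 : nc (0 : R[i]) = 0. Proof. exact: Normc.normc0. Qed.
Lemma nc1 : nc (1 : R[i]) = 1. Proof. exact: Normc.normc1. Qed.
Lemma ncM z w : nc (z * w) = nc z * nc w. Proof. exact: Normc.normcM. Qed.
Lemma ncD z w : nc (z + w) <= nc z + nc w. Proof. exact: le_normcD. Qed.
Lemma ncN z : nc (- z) = nc z. Proof. exact: normcN. Qed.

Lemma nc_eq0 z : (nc z == 0) = (z == 0).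
Proof. by apply/eqP/eqP => [/Normc.eq0_normc|->] //; rewrite nc0. Qed.

Lemma nc_gt0 z : (0 < nc z) = (z != 0).
Proof. by rewrite lt_def nc_ge0 andbT nc_eq0. Qed.

Lemma ncBC z w : nc (z - w) = nc (w - z).
Proof. by rewrite -opprB ncN. Qed.

Lemma ncV z : nc z^-1 = (nc z)^-1. Proof. exact: Normc.normcV. Qed.

Lemma ncX z n : nc (z ^+ n) = nc z ^+ n.
Proof. by elim: n => [|n IH]; rewrite ?expr0 ?nc1 // !exprS ncM IH. Qed.

Lemma ncR (x : R) : nc x%:C%C = `|x|.
Proof. by rewrite /= expr0n addr0 sqrtr_sqr. Qed.

Lemma nc_conj z : nc z^*%C = nc z.
Proof. by case: z => a b /=; rewrite sqrrN. Qed.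

Lemma nc_Re z : `|Re z| <= nc z.
Proof.
rewrite -(ler_pXn2r (_ : 0 < 2)%N) // ?nnegrE ?nc_ge0 //.
by rewrite sqr_nc real_normK ?num_real // lerDl sqr_ge0.
Qed.

Lemma nc_Im z : `|Im z| <= nc z.
Proof.
rewrite -(ler_pXn2r (_ : 0 < 2)%N) // ?nnegrE ?nc_ge0 //.
by rewrite sqr_nc real_normK ?num_real // lerDr sqr_ge0.
Qed.

Lemma nc_ReIm z : nc z <= `|Re z| + `|Im z|.
Proof.
rewrite -(ler_pXn2r (_ : 0 < 2)%N) // ?nnegrE ?nc_ge0 ?addr_ge0 //.
rewrite sqr_nc sqrrD !real_normK ?num_real //.
by rewrite addrAC lerDl mulrn_wge0 // mulr_ge0.
Qed.

Lemma nc_sum (I : Type) (r : seq I) (P : pred I) (F : I -> R[i]) :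
  nc (\sum_(i <- r | P i) F i) <= \sum_(i <- r | P i) nc (F i).
Proof.
elim/big_ind2: _ => //; first by rewrite nc0.
by move=> a b c d h1 h2; apply: le_trans (ncD _ _) (lerD h1 h2).
Qed.

Lemma nc_imag (w : R) : nc (0 +i* w)%C = `|w|.
Proof. by rewrite /= expr0n add0r sqrtr_sqr. Qed.

End Modulus.

(** * A maximum principle for proper stable rational functions *)

Section HalfPlane.
Variable R : realType.
Implicit Types (p q : {poly R[i]}) (z a : R[i]).

Definition hurwitz_poly p := forall a, root p a -> Re a < 0.

Lemma poly_growth p n : (size p <= n.+1)%N ->
  exists2 C : R, 0 <= C & forall z, nc p.[z] <= C * (1 + nc z) ^+ n.
Proof.
move=> sp; exists (\sum_(i < n.+1) nc p`_i); first by rewrite sumr_ge0 // => i _; exact: nc_ge0.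
move=> z; rewrite (horner_coef_wide _ sp) mulr_suml.
apply: le_trans (nc_sum _ _ _) _; apply: ler_sum => i _.
rewrite ncM ncX ler_wpM2l ?nc_ge0 //.
have z0 := nc_ge0 z.
apply: (@le_trans _ _ ((1 + nc z) ^+ i)).
  by rewrite lerXn2r ?nnegrE ?addr_ge0 // lerDr.
by rewrite ler_weXn2l ?lerDl // -ltnS.
Qed.

Lemma poly_roots_prod p : p != 0 -> exists2 rs : seq R[i],
  p = lead_coef p *: \prod_(a <- rs) ('X - a%:P) & size rs = (size p).-1.
Proof.
move=> p0; have [rs E] := closed_field_poly_normal p; exists rs => //.
by rewrite E size_scale ?lead_coef_eq0 // size_prod_XsubC.
Qed.

Lemma root_poly_lower p z (d : R) : p != 0 -> 0 <= d ->
  (forall a, root p a -> d <= nc (z - a)) ->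
  nc (lead_coef p) * d ^+ (size p).-1 <= nc p.[z].
Proof.
move=> p0 d0 h; have [rs E <-] := poly_roots_prod p0.
have hr a : a \in rs -> d <= nc (z - a).
  by move=> ars; apply: h; rewrite E rootZ ?lead_coef_eq0 // root_prod_XsubC.
rewrite [in leRHS]E hornerZ ncM ler_wpM2l ?nc_ge0 // horner_prod.
elim: rs hr {E} => [|a rs IH] hr; first by rewrite big_nil nc1.
rewrite big_cons ncM hornerXsubC /= exprS ler_pM ?exprn_ge0 //.
  by rewrite hr ?mem_head.
by apply: IH => b brs; rewrite hr // inE brs orbT.
Qed.

(** A polynomial without roots in the closed right half-plane grows there at the
    full rate of its degree: every factor [z - a] dominates [1 + |z|]. *)
Lemma hurwitz_growth p : p != 0 -> hurwitz_poly p ->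
  exists2 k : R, 0 < k &
    forall z, 0 <= Re z -> k * (1 + nc z) ^+ (size p).-1 <= nc p.[z].
Proof.
move=> p0 hp; have [rs E <-] := poly_roots_prod p0.
have hr a : a \in rs -> Re a < 0.
  by move=> ars; apply: hp; rewrite E rootZ ?lead_coef_eq0 // root_prod_XsubC.
suff [k k0 hk] : exists2 k : R, 0 < k & forall z, 0 <= Re z ->
    k * (1 + nc z) ^+ size rs <= nc (\prod_(a <- rs) (z - a)).
  exists (nc (lead_coef p) * k); first by rewrite mulr_gt0 // nc_gt0 lead_coef_eq0.
  move=> z z0; rewrite [in leRHS]E hornerZ ncM -mulrA ler_wpM2l ?nc_ge0 //.
  rewrite horner_prod (eq_bigr (fun a => z - a)) ?hk // => a _.
  by rewrite hornerXsubC.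
elim: rs hr {E} => [|a rs IH] hr.
  by exists 1 => // z _; rewrite big_nil nc1 mul1r.
have [|k k0 hk] := IH; first by move=> b brs; apply: hr; rewrite inE brs orbT.
have ra : Re a < 0 by rewrite hr ?mem_head.
set d := - Re a; have d0 : 0 < d by rewrite oppr_gt0.
set c := 1 + (1 + nc a) / d.
have c0 : 0 < c by rewrite ltr_wpDr // divr_ge0 ?(ltW d0) // addr_ge0 ?nc_ge0.
exists (c^-1 * k); first by rewrite mulr_gt0 ?invr_gt0.
move=> z z0; rewrite big_cons ncM /= exprS mulrACA ler_pM ?mulr_ge0 ?invr_ge0 //.
- exact: ltW.
- by rewrite addr_ge0 ?nc_ge0.
- exact: ltW.
- by rewrite exprn_ge0 // addr_ge0 ?nc_ge0.
- rewrite mulrC ler_pdivrMr // /c mulrDr mulr1.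
  have h1 : nc z <= nc (z - a) + nc a.
    by rewrite -[X in nc X <= _](subrK a); exact: ncD.
  have h2 : d <= nc (z - a).
    apply: le_trans (nc_Re _); apply: le_trans (ler_norm _).
    by case: z a @d {ra c c0 hr d0 h1} z0 => [x y] [u v] /=; lra.
  have : 1 + nc a <= nc (z - a) * ((1 + nc a) / d).
    by rewrite mulrCA ler_peMr ?addr_ge0 ?nc_ge0 // ler_pdivlMr // mul1r.
  by lra.
- exact: hk.
Qed.

(** Rouche's theorem for the right half-plane. Along the segment from [q] to
    [q - p] no root can reach the imaginary axis and the degree never drops;
    as roots move continuously, they all stay on the left. Continuity is used
    at the infimum [e0] of the parameters with a root on the right, in two
    quantitative forms: such a root persists for smaller parameters, and its
    absence persists for larger ones. *)
Lemma rouche_half_plane p q :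
  (size p <= size q)%N -> hurwitz_poly q ->
  nc p`_(size q).-1 < nc (lead_coef q) ->
  (forall w : R, nc p.[(0 +i* w)%C] < nc q.[(0 +i* w)%C]) ->
  hurwitz_poly (q - p).
Proof.
move=> spq hq hl him.
have q0 : q != 0 by rewrite -lead_coef_eq0 -nc_gt0 (le_lt_trans _ hl) // nc_ge0.
set n := (size q).-1; have sq : size q = n.+1.
  by rewrite /n prednK // size_poly_gt0.
pose f (e : R) := q - e%:C%C *: p.
have lf e : 0 <= e <= 1 ->
    nc (lead_coef q) - nc p`_n <= nc (lead_coef (f e)) /\ size (f e) = n.+1.
  move=> /andP[e0 e1].
  have h1 : nc (lead_coef q) - nc p`_n <= nc (f e)`_n.
    rewrite coefB coefZ.
    have : nc (lead_coef q) <= nc (q`_n - e%:C%C * p`_n) + nc (e%:C%C * p`_n).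
      by rewrite lead_coefE -/n -[X in nc X <= _](subrK (e%:C%C * p`_n)); exact: ncD.
    have : nc (e%:C%C * p`_n) <= nc p`_n.
      by rewrite ncM ncR ger0_norm // ler_piMl ?nc_ge0.
    by lra.
  have sf : size (f e) = n.+1.
    apply/eqP; rewrite eqn_leq; apply/andP; split.
      rewrite (leq_trans (size_polyD _ _)) // geq_max sq leqnn size_polyN.
      by rewrite (leq_trans (size_scale_leq _ _)) // -sq.
    rewrite ltnNge; apply/negP => /leq_sizeP/(_ n (leqnn n)) E.
    by move: h1; rewrite E nc0; move: hl; rewrite -/n; lra.
  by split=> //; rewrite [in leRHS]lead_coefE sf.
have f0 e : 0 <= e <= 1 -> f e != 0.
  by move=> /lf[_ sf]; rewrite -size_poly_gt0 sf.
have faxis e : 0 <= e <= 1 -> forall z, root (f e) z -> Re z != 0.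
  move=> /andP[e0 e1] [x y] rz /=; apply/negP => /eqP x0; move: rz.
  rewrite x0 rootE /f hornerD hornerN hornerZ subr_eq0 => /eqP E.
  have := him y; rewrite E ncM ncR ger0_norm //.
  by have := nc_ge0 p.[(0 +i* y)%C]; nra.
pose E := [set e : R | 0 <= e <= 1 /\ exists2 z, 0 <= Re z & root (f e) z].
move=> z rz; rewrite ltNge; apply/negP => z0.
have E1 : E 1 by split; [rewrite ler01 lexx | exists z; rewrite // /f scale1r].
have iE : has_inf E by split; [exists 1 | exists 0 => e [/andP[]]].
pose e0 := inf E.
have e0le e : E e -> e0 <= e by move=> Ee; apply: ge_inf => //; case: iE.
have e00 : 0 <= e0 by apply: lb_le_inf; [exists 1 | move=> e [/andP[]]].
have e01 : e0 <= 1 by apply: e0le.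
have e0i : 0 <= e0 <= 1 by rewrite e00.
have fB e t : (f e).[t] = (f e0).[t] + (e0 - e)%:C%C * p.[t].
  by rewrite /f !hornerE (rmorphB (real_complex R)) /=; ring.
(* A root of [f e0] on the right is strictly on the right, and already present for
   slightly smaller parameters. *)
have [[t t0 rt]|hnone] := pselect (exists2 z, 0 <= Re z & root (f e0) z).
  have tpos : 0 < Re t by rewrite lt_def t0 andbT; exact: (faxis _ e0i).
  have e0pos : 0 < e0.
    rewrite lt_def e00 andbT; apply/negP => /eqP e00'.
    by move: rt; rewrite e00' /f scale0r subr0 => /hq; rewrite ltNge t0.
  pose K := (nc (lead_coef q) - nc p`_n) * Re t ^+ n.
  have K0 : 0 < K by rewrite mulr_gt0 ?subr_gt0 ?exprn_gt0.
  have hK e : 0 <= e < e0 -> K <= (e0 - e) * nc p.[t].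
    move=> /andP[he he0]; have ei : 0 <= e <= 1 by rewrite he (le_trans (ltW he0)).
    have [hle sf] := lf _ ei.
    have -> : (e0 - e) * nc p.[t] = nc (f e).[t].
      rewrite fB; move: rt; rewrite rootE => /eqP ->.
      by rewrite add0r ncM ncR gtr0_norm // subr_gt0.
    apply: le_trans (root_poly_lower (f0 _ ei) t0 _).
      by rewrite sf /= ler_wpM2r // exprn_ge0.
    move=> a ra; apply: le_trans (nc_Re _); apply: le_trans (ler_norm _).
    have : Re a < 0.
      rewrite ltNge; apply/negP => a0.
      have Ee : E e by split=> //; exists a.
      by have := e0le _ Ee; rewrite leNgt he0.
    by case: (t) (a) => [x y] [u v] /=; lra.
  pose P := nc p.[t]; have P0 : 0 <= P := nc_ge0 _.
  pose d := K / (2 * (P + 1)).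
  have d0 : 0 < d by rewrite divr_gt0 // mulr_gt0 // ltr_wpDl.
  have dP : d * P < K.
    rewrite /d mulrAC ltr_pdivrMr; last by rewrite mulr_gt0 // ltr_wpDl.
    by rewrite ltr_pM2l //; lra.
  have [ed|ed] := leP d e0.
    have : K <= (e0 - (e0 - d)) * P by apply: hK; rewrite subr_ge0 ed gtrBl.
    by rewrite opprB addrC subrK; lra.
  have : K <= (e0 - 0) * P by apply: hK; rewrite lexx.
  by rewrite subr0; nra.
(* If [f e0] has no root on the right, then neither has [f e] for [e] near [e0]. *)
have hf : hurwitz_poly (f e0).
  by move=> a ra; rewrite ltNge; apply/negP => a0; apply: hnone; exists a.
have [k k0 hk] := hurwitz_growth (f0 _ e0i) hf.
have [C C0 hC] : exists2 C : R, 0 <= C & forall z, nc p.[z] <= C * (1 + nc z) ^+ n.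
  by apply: poly_growth; rewrite -sq.
have [|e Ee ed] := inf_adherent (_ : 0 < k / (C + 1)) iE.
  by rewrite divr_gt0 // ltr_wpDl.
have e0e := e0le _ Ee; case: Ee => ei [t t0 rt].
have := hk _ t0; rewrite (lf _ e0i).2 /=.
have -> : (f e0).[t] = - ((e0 - e)%:C%C * p.[t]).
  by move: rt; rewrite rootE fB addr_eq0 => /eqP ->.
rewrite ncN ncM ncR distrC ger0_norm ?subr_ge0 //.
have := hC t; set X := (1 + nc t) ^+ n.
have X0 : 0 < X by rewrite exprn_gt0 // ltr_wpDr // nc_ge0.
have := nc_ge0 p.[t]; set Pt := nc p.[t].
move=> Pt0 PtC.
have : (e - e0) * (C + 1) < k.
  by rewrite -ltr_pdivlMr ?ltr_wpDl // ltrBlDl.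
have : (e - e0) * Pt <= (e - e0) * (C * X) by rewrite ler_wpM2l // subr_ge0.
have : 0 <= (e - e0) by rewrite subr_ge0.
by nra.
Qed.

(** Maximum principle for [p / q]. If [|p s| > g |q s|] then [q - c p], with
    [c = q s / p s], vanishes at [s], which Rouche's theorem excludes. *)
Lemma max_modulus p q (g : R) :
  (size p <= size q)%N -> q != 0 -> hurwitz_poly q -> 0 <= g ->
  nc p`_(size q).-1 <= g * nc (lead_coef q) ->
  (forall w : R, nc p.[(0 +i* w)%C] <= g * nc q.[(0 +i* w)%C]) ->
  forall s, 0 <= Re s -> nc p.[s] <= g * nc q.[s].
Proof.
move=> spq q0 hq g0 hl him s s0; rewrite leNgt; apply/negP => hs.
have ps0 : 0 < nc p.[s] by apply: le_lt_trans hs; rewrite mulr_ge0 ?nc_ge0.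
have p0 : p.[s] != 0 by rewrite -nc_gt0.
pose c := q.[s] / p.[s].
have hc x y : 0 < y -> x <= g * y -> nc c * x < y.
  move=> y0 xy; have : nc c * g < 1.
    by rewrite ncM ncV mulrAC ltr_pdivrMr // mul1r mulrC.
  by have := nc_ge0 c; nra.
have : Re s < 0; last by rewrite ltNge s0.
apply: (@rouche_half_plane (c *: p) q) => //.
- exact: leq_trans (size_scale_leq _ _) spq.
- by rewrite coefZ ncM hc // nc_gt0 lead_coef_eq0.
- move=> w; rewrite hornerZ ncM hc // nc_gt0; apply/negP => /hq /=.
  by rewrite ltxx.
- by rewrite rootE !hornerE divfK // subrr.
Qed.

End HalfPlane.

(** * Norms of matrices and vectors *)

Section LinAlg.
Variable R : realType.
Local Notation C := R[i].

Definition adjm m n (A : 'M[C]_(m, n)) : 'M[C]_(n, m) := map_mx (@conjc R) A^T.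

Lemma adjmK m n (A : 'M[C]_(m, n)) : adjm (adjm A) = A.
Proof. by apply/matrixP => i j; rewrite !mxE conjcK. Qed.

Lemma adjmM m n p (A : 'M[C]_(m, n)) (B : 'M[C]_(n, p)) :
  adjm (A *m B) = adjm B *m adjm A.
Proof. by rewrite /adjm trmx_mul map_mxM. Qed.

(** Only its submultiplicativity matters: it serves for qualitative bounds, whereas
    [l2norm] carries the gains. *)
Definition sum_norm m n (A : 'M[C]_(m, n)) : R := \sum_i \sum_j nc (A i j).

Lemma sum_norm_ge0 m n (A : 'M[C]_(m, n)) : 0 <= sum_norm A.
Proof. by rewrite sumr_ge0 // => i _; rewrite sumr_ge0 // => j _; exact: nc_ge0. Qed.

Lemma nc_le_sum_norm m n (A : 'M[C]_(m, n)) i j : nc (A i j) <= sum_norm A.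
Proof.
rewrite /sum_norm (bigD1 i) //= (bigD1 j) //= -addrA lerDl addr_ge0 //.
  by rewrite sumr_ge0 // => k _; exact: nc_ge0.
by rewrite sumr_ge0 // => k _; rewrite sumr_ge0 // => l _; exact: nc_ge0.
Qed.

Lemma sum_normD m n (A B : 'M[C]_(m, n)) : sum_norm (A + B) <= sum_norm A + sum_norm B.
Proof.
rewrite /sum_norm -big_split; apply: ler_sum => i _; rewrite -big_split /=.
by apply: ler_sum => j _; rewrite mxE ncD.
Qed.

Lemma sum_normZ m n a (A : 'M[C]_(m, n)) : sum_norm (a *: A) = nc a * sum_norm A.
Proof.
rewrite /sum_norm mulr_sumr; apply: eq_bigr => i _; rewrite mulr_sumr.
by apply: eq_bigr => j _; rewrite mxE ncM.
Qed.

Lemma sum_normN m n (A : 'M[C]_(m, n)) : sum_norm (- A) = sum_norm A.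
Proof. by rewrite -scaleN1r sum_normZ ncN nc1 mul1r. Qed.

Lemma sum_normB m n (A B : 'M[C]_(m, n)) : sum_norm (A - B) <= sum_norm A + sum_norm B.
Proof. by rewrite -(sum_normN B) sum_normD. Qed.

Lemma sum_norm_eq0 m n (A : 'M[C]_(m, n)) : sum_norm A = 0 -> A = 0.
Proof.
move=> h; apply/matrixP => i j; rewrite mxE; apply/eqP; rewrite -nc_eq0.
by rewrite eq_le nc_ge0 -h nc_le_sum_norm.
Qed.

Lemma sum_normM m n p (A : 'M[C]_(m, n)) (B : 'M[C]_(n, p)) :
  sum_norm (A *m B) <= sum_norm A * sum_norm B.
Proof.
rewrite /sum_norm mulr_suml; apply: ler_sum => i _.
apply: (@le_trans _ _ (\sum_k \sum_j nc (A i j) * nc (B j k))).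
  apply: ler_sum => k _; rewrite mxE; apply: le_trans (nc_sum _ _ _) _.
  by apply: ler_sum => j _; rewrite ncM.
rewrite exchange_big mulr_suml; apply: ler_sum => j _ /=.
rewrite -mulr_sumr ler_wpM2l ?nc_ge0 // [leRHS](bigD1 j) //= lerDl.
by rewrite sumr_ge0 // => k _; rewrite sumr_ge0 // => l _; exact: nc_ge0.
Qed.

Definition l2norm n (v : 'cV[C]_n) : R := Num.sqrt (\sum_i nc (v i 0) ^+ 2).

Lemma l2norm_ge0 n (v : 'cV[C]_n) : 0 <= l2norm v. Proof. exact: sqrtr_ge0. Qed.

Lemma sqr_l2norm n (v : 'cV[C]_n) : l2norm v ^+ 2 = \sum_i nc (v i 0) ^+ 2.
Proof. by rewrite sqr_sqrtr // sumr_ge0 // => i _; rewrite sqr_ge0. Qed.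

Lemma le_l2norm n (v : 'cV[C]_n) (x : R) : 0 <= x ->
  \sum_i nc (v i 0) ^+ 2 <= x ^+ 2 -> l2norm v <= x.
Proof.
by move=> x0 h; rewrite -(ler_pXn2r (_ : 0 < 2)%N) // ?nnegrE ?l2norm_ge0 // sqr_l2norm.
Qed.

Lemma nc_le_l2norm n (v : 'cV[C]_n) i : nc (v i 0) <= l2norm v.
Proof.
rewrite -(ler_pXn2r (_ : 0 < 2)%N) // ?nnegrE ?l2norm_ge0 ?nc_ge0 // sqr_l2norm.
by rewrite (bigD1 i) //= lerDl sumr_ge0 // => j _; rewrite sqr_ge0.
Qed.

Lemma l2norm_0 n : l2norm (0 : 'cV[C]_n) = 0.
Proof. by rewrite /l2norm big1 ?sqrtr0 // => i _; rewrite mxE nc0 expr0n. Qed.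

Lemma l2norm_eq0 n (v : 'cV[C]_n) : l2norm v = 0 -> v = 0.
Proof.
move=> h; apply/colP => i; rewrite mxE; apply/eqP; rewrite -nc_eq0.
by rewrite eq_le nc_ge0 -h nc_le_l2norm.
Qed.

Lemma l2norm_gt0 n (v : 'cV[C]_n) : v != 0 -> 0 < l2norm v.
Proof. by move=> v0; rewrite lt_def l2norm_ge0 andbT; apply: contraNneq v0 => /l2norm_eq0 ->. Qed.

Lemma l2normZ n a (v : 'cV[C]_n) : l2norm (a *: v) = nc a * l2norm v.
Proof.
rewrite /l2norm (eq_bigr (fun i => nc a ^+ 2 * nc (v i 0) ^+ 2)).
  by rewrite -mulr_sumr sqrtrM ?sqr_ge0 // sqrtr_sqr ger0_norm // nc_ge0.
by move=> i _; rewrite mxE ncM exprMn.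
Qed.

Lemma l2norm_le_sum n (v : 'cV[C]_n) : l2norm v <= \sum_i nc (v i 0).
Proof.
have h k : 0 <= \sum_(i < n | k i) nc (v i 0) by rewrite sumr_ge0 // => i _; exact: nc_ge0.
apply: le_l2norm; first exact: h.
rewrite [leRHS]expr2 mulr_suml; apply: ler_sum => i _.
rewrite expr2 ler_wpM2l ?nc_ge0 // (bigD1 i) //= lerDl; exact: h.
Qed.

Lemma l2norm_mul m n (A : 'M[C]_(m, n)) (v : 'cV[C]_n) : l2norm (A *m v) <= sum_norm A * l2norm v.
Proof.
apply: le_trans (l2norm_le_sum _) _; rewrite /sum_norm mulr_suml; apply: ler_sum => i _.
rewrite mxE mulr_suml; apply: le_trans (nc_sum _ _ _) _; apply: ler_sum => j _.
by rewrite ncM ler_wpM2l ?nc_ge0 // nc_le_l2norm.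
Qed.

Lemma cauchy_schwarz_sum n (a b : 'I_n -> R) :
  (\sum_i a i * b i) ^+ 2 <= (\sum_i a i ^+ 2) * (\sum_i b i ^+ 2).
Proof.
set D := \sum_i a i * b i; set A := \sum_i a i ^+ 2; set B := \sum_i b i ^+ 2.
have h (x y : R) : 0 <= x ^+ 2 * A - (2 * x * y) * D + y ^+ 2 * B.
  rewrite /A /D /B !mulr_sumr -sumrB -big_split /=.
  rewrite sumr_ge0 // => i _.
  suff -> : x ^+ 2 * a i ^+ 2 - 2 * x * y * (a i * b i) + y ^+ 2 * b i ^+ 2 =
    (x * a i - y * b i) ^+ 2 by rewrite sqr_ge0.
  by ring.
have A0 : 0 <= A by rewrite sumr_ge0 // => i _; rewrite sqr_ge0.
have [B0|Bn0] := eqVneq B 0.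
  by have := h D (A + 1); rewrite B0; nra.
have : 0 < B by rewrite lt_def Bn0 sumr_ge0 // => i _; rewrite sqr_ge0.
have := h B D.
rewrite (_ : _ + _ = B * (A * B - D ^+ 2)); last by ring.
by move=> + B0; rewrite pmulr_rge0 // subr_ge0.
Qed.

Lemma sum_nc_le_l2norm n (u v : 'cV[C]_n) :
  \sum_i nc (u i 0) * nc (v i 0) <= l2norm u * l2norm v.
Proof.
rewrite -(ler_pXn2r (_ : 0 < 2)%N) // ?nnegrE ?mulr_ge0 ?l2norm_ge0 //; last first.
  by rewrite sumr_ge0 // => i _; rewrite mulr_ge0 ?nc_ge0.
by rewrite exprMn !sqr_l2norm; exact: cauchy_schwarz_sum.
Qed.

Lemma l2normD n (u v : 'cV[C]_n) : l2norm (u + v) <= l2norm u + l2norm v.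
Proof.
apply: le_l2norm; first by rewrite addr_ge0 ?l2norm_ge0.
apply: (@le_trans _ _ (\sum_i (nc (u i 0) + nc (v i 0)) ^+ 2)).
  apply: ler_sum => i _; rewrite mxE lerXn2r ?nnegrE ?addr_ge0 ?nc_ge0 //.
  exact: ncD.
rewrite (eq_bigr (fun i => nc (u i 0) ^+ 2 + nc (v i 0) ^+ 2 +
   2 * (nc (u i 0) * nc (v i 0)))); last by move=> i _; ring.
rewrite !big_split /= -!sqr_l2norm -mulr_sumr.
have := sum_nc_le_l2norm u v; nra.
Qed.

Definition dotc n (u v : 'cV[C]_n) : C := (adjm u *m v) 0 0.

Lemma dotcE n (u v : 'cV[C]_n) : dotc u v = \sum_i (u i 0)^*%C * v i 0.
Proof. by rewrite /dotc mxE; apply: eq_bigr => i _; rewrite !mxE. Qed.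

Lemma dotc_le n (u v : 'cV[C]_n) : nc (dotc u v) <= l2norm u * l2norm v.
Proof.
rewrite dotcE; apply: le_trans (nc_sum _ _ _) _; apply: le_trans (sum_nc_le_l2norm u v).
by apply: ler_sum => i _; rewrite ncM nc_conj.
Qed.

Lemma mul_conjc (z : C) : z^*%C * z = (nc z ^+ 2)%:C%C.
Proof.
case: z => a b; rewrite sqr_nc /=; apply/eqP; rewrite eq_complex /=.
by apply/andP; split; apply/eqP; ring. Qed.

Lemma dotcc n (u : 'cV[C]_n) : dotc u u = (l2norm u ^+ 2)%:C%C.
Proof.
rewrite dotcE sqr_l2norm (rmorph_sum (real_complex R)); apply: eq_bigr => i _.
exact: mul_conjc.
Qed.

End LinAlg.

(** * The spectral norm *)

Section Spectral.
Variable R : realType.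
Local Notation C := R[i].

Lemma exists_argmax n (s : 'I_n -> R) : (0 < n)%N -> exists k, forall i, s i <= s k.
Proof.
move=> n0; case: (@arg_maxP _ _ _ (Ordinal n0) xpredT s) => // k _ hk.
by exists k => i; apply: hk.
Qed.

Lemma nc_delta n (i j : 'I_n) : nc ((delta_mx i 0 : 'cV[C]_n) j 0) = (j == i)%:R.
Proof. by rewrite mxE andbT; case: (j == i); rewrite ?nc1 ?nc0. Qed.

Lemma l2norm_adj n (v : 'cV[C]_n) : (l2norm v ^+ 2)%:C%C = (adjm v *m v) 0 0.
Proof. by rewrite -dotcc. Qed.

Definition eigset n (H : 'M[C]_n) : set R :=
  [set l | exists v : 'cV[C]_n, v != 0 /\ H *m v = l%:C%C *: v].

Definition specnorm m n (M : 'M[C]_(m, n)) : R :=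
  Num.sqrt (sup (eigset (adjm M *m M))).

(** The Gram matrix [M^H M] is unitarily diagonalizable; its eigenvalues are the
    squares of the gains of [M] along an orthonormal basis, so that the
    largest one is the square of the operator norm. *)
Lemma specnormP m n (M : 'M[C]_(m, n)) : (0 < n)%N ->
  (forall v, l2norm (M *m v) <= specnorm M * l2norm v) /\
  exists2 v, v != 0 & l2norm (M *m v) = specnorm M * l2norm v.
Proof.
move=> n0; set H := adjm M *m M.
have Hadj : adjm H = H by rewrite /H adjmM adjmK.
have /orthomx_spectralP : H \is normalmx.
  by apply/normalmxP; rewrite -[map_mx _ _]/(adjm H) Hadj.
set P := spectralmx H; set sp := spectral_diag H.
have Pu : P \is unitarymx by exact: spectral_unitarymx.
have PPa : P *m adjm P = 1%:M by apply/unitarymxP.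
have PaP : adjm P *m P = 1%:M by rewrite mulmx1C.
rewrite invmx_unitary // -[map_mx _ _]/(adjm P) => HE.
clearbody P sp.
have nP (v : 'cV[C]_n) : l2norm (P *m v) = l2norm v.
  apply/eqP; rewrite -(eqrXn2 (_ : 0 < 2)%N) ?l2norm_ge0 //; apply/eqP.
  by apply: (@complexI R); rewrite !l2norm_adj adjmM mulmxA -(mulmxA _ _ P) PaP mulmx1.
have quad (v : 'cV[C]_n) : (l2norm (M *m v) ^+ 2)%:C%C = (adjm v *m H *m v) 0 0.
  by rewrite l2norm_adj adjmM /H !mulmxA.
have quad2 (v : 'cV[C]_n) : (l2norm (M *m v) ^+ 2)%:C%C =
    \sum_i sp 0 i * (nc ((P *m v) i 0) ^+ 2)%:C%C.
  rewrite quad HE.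
  rewrite (_ : _ *m v = adjm (P *m v) *m (diag_mx sp *m (P *m v))); last first.
    by rewrite adjmM !mulmxA.
  rewrite mxE; apply: eq_bigr => i _.
  by rewrite mul_diag_mx [in RHS]mulrC -mul_conjc mulrAC !mxE mulrA.
pose e i := adjm P *m (delta_mx i 0 : 'cV[C]_n).
have Pe i : P *m e i = delta_mx i 0 by rewrite /e mulmxA PPa mul1mx.
have ne i : l2norm (e i) = 1.
  rewrite -nP Pe /l2norm (bigD1 i) //= big1; last first.
    by move=> j ji; rewrite nc_delta (negPf ji) expr0n.
  by rewrite nc_delta eqxx expr1n addr0 sqrtr1.
have e0 i : e i != 0 by apply: contra_eq_neq (ne i) => ->; rewrite l2norm_0 eq_sym oner_eq0.
pose s i := l2norm (M *m e i) ^+ 2.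
have spE i : sp 0 i = (s i)%:C%C.
  rewrite /s quad2 (bigD1 i) //= big1; last first.
    by move=> j ji; rewrite Pe nc_delta (negPf ji) expr0n mulr0.
  by rewrite Pe nc_delta eqxx expr1n mulr1 addr0.
have quad3 (v : 'cV[C]_n) : l2norm (M *m v) ^+ 2 = \sum_i s i * nc ((P *m v) i 0) ^+ 2.
  apply: (@complexI R); rewrite quad2 (rmorph_sum (real_complex R)).
  by apply: eq_bigr => i _; rewrite spE; exact/esym/(rmorphM (real_complex R)).
have sE i : s i = l2norm (M *m e i) ^+ 2 by [].
clearbody s; have [k kmax] := exists_argmax s n0.
have bound (v : 'cV[C]_n) : l2norm (M *m v) ^+ 2 <= s k * l2norm v ^+ 2.
  rewrite quad3 -[l2norm v]nP sqr_l2norm mulr_sumr; apply: ler_sum => i _.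
  by rewrite ler_wpM2r ?sqr_ge0.
have ks : eigset H (s k).
  exists (e k); split=> //; rewrite HE -!mulmxA Pe mul_diag_mx.
  have -> : \matrix_(i, j) (sp 0 i * (delta_mx k 0 : 'cV[C]_n) i j) =
      (s k)%:C%C *: (delta_mx k 0 : 'cV[C]_n).
    by apply/matrixP => i j; rewrite !mxE; have [->|] := eqVneq i k; rewrite ?spE //= !mulr0.
  by rewrite -scalemxAr.
have kub : ubound (eigset H) (s k).
  move=> l [v [v0 Hv]].
  have : l2norm (M *m v) ^+ 2 = l * l2norm v ^+ 2.
    apply: (@complexI R); rewrite quad -mulmxA Hv -scalemxAr mxE -l2norm_adj.
    exact/esym/(rmorphM (real_complex R)).
  have := bound v; have := l2norm_gt0 v0 => vp + E; rewrite E ler_pM2r // exprn_gt0 //.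
have supE : sup (eigset H) = s k.
  apply/eqP; rewrite eq_le; apply/andP; split; first by apply: sup_le_ub => //; exists (s k).
  by apply: ub_le_sup => //; exists (s k).
have snE : specnorm M = l2norm (M *m e k).
  by rewrite /specnorm -/H supE sE sqrtr_sqr ger0_norm // l2norm_ge0.
split=> [v|]; last by exists (e k) => //; rewrite ne mulr1.
rewrite -(ler_pXn2r (_ : 0 < 2)%N) // ?nnegrE ?mulr_ge0 ?l2norm_ge0 ?snE ?l2norm_ge0 //.
by rewrite exprMn -sE.
Qed.

Lemma specnorm_ge0 m n (M : 'M[C]_(m, n)) : 0 <= specnorm M.
Proof. exact: sqrtr_ge0. Qed.

Lemma specnorm_le m n (M : 'M[C]_(m, n)) (g : R) : (0 < n)%N ->
  (forall v, l2norm (M *m v) <= g * l2norm v) -> specnorm M <= g.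
Proof.
move=> /(specnormP M)[_ [v /l2norm_gt0 v0 E]] h.
by rewrite -(ler_pM2r v0) -E.
Qed.

End Spectral.

(** * Resolvents and transfer matrices *)

Section Resolvent.
Variable R : realType.
Local Notation C := R[i].

Definition hurwitzm n (A : 'M[C]_n) : Prop :=
  forall (l : C) (v : 'cV[C]_n), 0 <= Re l -> A *m v = l *: v -> v = 0.

Definition resolvent n (A : 'M[C]_n) (s : C) : 'M[C]_n := invmx (s%:M - A).

Definition transfer n m p (A : 'M[C]_n) (B : 'M[C]_(n, m)) (Co : 'M[C]_(p, n))
  (D : 'M[C]_(p, m)) (s : C) : 'M[C]_(p, m) := D + Co *m resolvent A s *m B.

Lemma unitmx_of_ker n (M : 'M[C]_n) :
  (forall v : 'cV[C]_n, M *m v = 0 -> v = 0) -> M \in unitmx.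
Proof.
move=> h; rewrite -unitmx_tr -row_free_unit; apply: inj_row_free => v vM.
by apply: trmx_inj; rewrite trmx0; apply: h; rewrite -[M]trmxK -trmx_mul vM trmx0.
Qed.

Lemma hurwitz_unit n (A : 'M[C]_n) s : hurwitzm A -> 0 <= Re s ->
  s%:M - A \in unitmx.
Proof.
move=> hA s0; apply: unitmx_of_ker => v; rewrite mulmxBl mul_scalar_mx => /eqP.
by rewrite subr_eq0 => /eqP E; apply: hA s0 _.
Qed.

Lemma resolvent_infty n (A : 'M[C]_n) (s : C) : s%:M - A \in unitmx ->
  2 * sum_norm A + 1 <= nc s -> nc s * sum_norm (resolvent A s) <= 2 * sum_norm (1%:M : 'M[C]_n).
Proof.
move=> u hs.
have E : s *: resolvent A s = 1%:M + A *m resolvent A s.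
  rewrite -(mulmxV u) mulmxBl mul_scalar_mx; rewrite -/(resolvent A s).
  by rewrite subrK.
have : nc s * sum_norm (resolvent A s) <= sum_norm (1%:M : 'M[C]_n) +
  sum_norm A * sum_norm (resolvent A s).
  rewrite -sum_normZ E; apply: le_trans (sum_normD _ _) _.
  by rewrite lerD2l sum_normM.
have := sum_norm_ge0 (resolvent A s); nra.
Qed.

Lemma resolvent_diff n (A : 'M[C]_n) (s t : C) :
  s%:M - A \in unitmx -> t%:M - A \in unitmx ->
  resolvent A t - resolvent A s = (s - t) *: (resolvent A s *m resolvent A t).
Proof.
move=> us ut.
transitivity (resolvent A s *m ((s%:M - A) - (t%:M - A)) *m resolvent A t).
  rewrite mulmxBr mulmxBl mulVmx // mul1mx -mulmxA (mulmxA (resolvent A s)).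
  by rewrite -[_ *m resolvent A t]mulmxA mulmxV // mulmx1.
by rewrite opprB addrA subrK -raddfB /= mul_mx_scalar -scalemxAl.
Qed.

Lemma resolvent_lipschitz n (A : 'M[C]_n) (s t : C) :
  s%:M - A \in unitmx -> t%:M - A \in unitmx ->
  nc (t - s) * sum_norm (resolvent A s) <= 1 / 2 ->
  sum_norm (resolvent A t - resolvent A s) <= nc (t - s) * (2 * sum_norm (resolvent A s) ^+ 2).
Proof.
move=> us ut h.
have E : sum_norm (resolvent A t - resolvent A s) <=
  nc (t - s) * sum_norm (resolvent A s) * sum_norm (resolvent A t).
  by rewrite resolvent_diff // sum_normZ ncBC -mulrA ler_wpM2l ?nc_ge0 // sum_normM.
have h2 : sum_norm (resolvent A t) <= sum_norm (resolvent A t - resolvent A s) +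
  sum_norm (resolvent A s).
  by rewrite -{1}[resolvent A t](subrK (resolvent A s)) sum_normD.
have := sum_norm_ge0 (resolvent A s); have := sum_norm_ge0 (resolvent A t);
  have := nc_ge0 (t - s).
move=> a b c.
have : sum_norm (resolvent A t) <= 2 * sum_norm (resolvent A s) by nra.
move=> d; apply: le_trans E _; rewrite -mulrA ler_wpM2l //.
by rewrite expr2 mulrCA ler_wpM2l.
Qed.

Lemma unit_eigenvalue n (A : 'M[C]_n) s :
  (s%:M - A \in unitmx) = ~~ root (char_poly A) s.
Proof.
rewrite -eigenvalue_root_char /eigenvalue /eigenspace negbK kermx_eq0 row_free_unit.
by rewrite -opprB -scaleN1r unitmxZ // unitrN1.
Qed.

(** The spectrum is finite. *)
Lemma regular_shift n (A : 'M[C]_n) (l : C) (d : R) : 0 < d ->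
  exists2 e : R, 0 < e <= d & (l + e%:C%C)%:M - A \in unitmx.
Proof.
move=> d0; apply: contrapT => hn.
pose x (k : nat) : C := l + (d / k.+1%:R)%:C%C.
have hroot : all (root (char_poly A)) (mkseq x n.+2).
  apply/allP => _ /mapP[k _ ->]; rewrite -[root _ _]negbK -unit_eigenvalue.
  apply/negP => u; apply: hn; exists (d / k.+1%:R) => //.
  rewrite divr_gt0 //= ?ltr0Sn // ler_pdivrMr ?ltr0Sn // ler_peMr ?(ltW d0) //.
  by rewrite ler1n.
have p0 : char_poly A != 0 by rewrite monic_neq0 // char_poly_monic.
have := max_poly_roots p0 hroot; rewrite size_mkseq size_char_poly ltnS.
suff -> : uniq (mkseq x n.+2) by move=> /(_ isT); rewrite ltnNge leqnSn.
rewrite mkseq_uniq // => j k /addrI /(@complexI R) /(mulfI (lt0r_neq0 d0)).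
by move=> /invr_inj /eqP; rewrite eqr_nat => /eqP [].
Qed.

(** Hautus test: stabilizability and detectability at [l] give one-sided inverses
    [(l - A) X + B Y = 1] and [X' (l - A) + Y' C = 1]. They bound the resolvent
    near [l] in terms of [C (s - A)^-1 B], whereas an eigenvalue at [l] makes
    the resolvent unbounded. *)
Lemma hurwitz_of_bounded n m p (A : 'M[C]_n) (B : 'M[C]_(n, m))
    (Co : 'M[C]_(p, n)) :
  (forall (l : C) (y : 'rV[C]_n), 0 <= Re l -> y *m A = l *: y -> y *m B = 0 -> y = 0) ->
  (forall (l : C) (v : 'cV[C]_n), 0 <= Re l -> A *m v = l *: v -> Co *m v = 0 -> v = 0) ->
  (forall l : C, 0 <= Re l -> exists K d : R, 0 < d /\ forall e : R, 0 < e <= d ->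
     (l + e%:C%C)%:M - A \in unitmx -> sum_norm (Co *m resolvent A (l + e%:C%C) *m B) <= K) ->
  hurwitzm A.
Proof.
move=> stab det bd l v l0 Av.
have [XY XYE] : exists Z, row_mx (l%:M - A) B *m Z = 1%:M.
  apply/row_freeP; apply: inj_row_free => y; rewrite mul_mx_row -row_mx0.
  move=> /eq_row_mx[h1 h2]; apply: stab l0 _ h2.
  by move/eqP: h1; rewrite mulmxBr mul_mx_scalar subr_eq0 => /eqP.
have [XY' XY'E] : exists Z, Z *m col_mx (l%:M - A) Co = 1%:M.
  apply/row_fullP; rewrite /row_full -mxrank_tr; apply: inj_row_free => y hy.
  apply: trmx_inj; rewrite trmx0.
  have : col_mx (l%:M - A) Co *m y^T = 0.
    by rewrite -[col_mx _ _]trmxK -trmx_mul hy trmx0.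
  rewrite mul_col_mx -col_mx0 => /eq_col_mx[h1 h2]; apply: det l0 _ h2.
  by move/eqP: h1; rewrite mulmxBl mul_scalar_mx subr_eq0 eq_sym => /eqP.
move: XYE XY'E; rewrite -[XY]vsubmxK -[XY']hsubmxK mul_row_col mul_row_col.
set X := usubmx XY; set Y := dsubmx XY; set X' := lsubmx XY'; set Y' := rsubmx XY'.
move=> XE X'E.
have [K [d [d0 hK]]] := bd l l0.
apply: contrapT => /eqP v0.
pose K' := sum_norm X' + sum_norm X' * sum_norm X +
  sum_norm (Y' *m Co *m X) + sum_norm Y' * `|K| * sum_norm Y.
have K'0 : 0 <= K' by rewrite !addr_ge0 ?mulr_ge0 ?sum_norm_ge0.
pose a := sum_norm X' + sum_norm X + sum_norm X' * sum_norm X.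
have a0 : 0 <= a by rewrite !addr_ge0 ?mulr_ge0 ?sum_norm_ge0.
(* [d1] is so small that the terms of order [e] in [E4] are absorbed, and that the
   resulting bound [2 K'] on the resolvent is less than [1 / e]. *)
pose d1 := Num.min d (Num.min 1 (1 / (2 * (a + 1 + K')))).
have d10 : 0 < d1.
  by rewrite /d1 !lt_min d0 ltr01 divr_gt0 // mulr_gt0 // -addrA ltr_wpDl // ltr_wpDr.
have [e /andP[e0 ed1] eu] := regular_shift A l d10.
move: ed1; rewrite !le_min => /and3P[ed e1].
rewrite ler_pdivlMr; last by rewrite mulr_gt0 // -addrA ltr_wpDl // ltr_wpDr.
move=> ea.
have {}hK := hK _ (introT andP (conj e0 ed)) eu.
move: eu hK; set s := l + e%:C%C; set Rs := resolvent A s => eu hK.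
pose eC : C := e%:C%C.
have nce : nc eC = e by rewrite ncR gtr0_norm.
have Ss : s%:M - A = (l%:M - A) + eC%:M by rewrite /s raddfD /= addrAC.
have RS : Rs *m (s%:M - A) = 1%:M by rewrite mulVmx.
have SR : (s%:M - A) *m Rs = 1%:M by rewrite mulmxV.
have E1 : Rs + eC *: (Rs *m X) = X + Rs *m B *m Y.
  have : (s%:M - A) *m X + B *m Y = 1%:M + eC *: X.
    by rewrite Ss mulmxDl mul_scalar_mx addrAC XE.
  move=> /(congr1 (mulmx Rs)); rewrite !mulmxDr mulmxA RS mul1mx mulmx1 -scalemxAr.
  by rewrite mulmxA => <-.
have E2 : Rs + eC *: (X' *m Rs) = X' + Y' *m Co *m Rs.
  have : X' *m (s%:M - A) + Y' *m Co = 1%:M + eC *: X'.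
    by rewrite Ss mulmxDr mul_mx_scalar addrAC X'E.
  move=> /(congr1 (mulmx^~ Rs)) /=; rewrite !mulmxDl -mulmxA SR mul1mx mulmx1 -scalemxAl.
  by move=> <-.
(* [(1 + e X') (s - A)^-1 (1 + e X)], which [bW] bounds *)
have E3 : Rs + eC *: (Rs *m X) + eC *: (X' *m (Rs + eC *: (Rs *m X))) =
    X' + eC *: (X' *m X) + Y' *m Co *m X + Y' *m (Co *m Rs *m B) *m Y.
  transitivity ((Rs + eC *: (X' *m Rs)) *m (1%:M + eC *: X)).
    rewrite mulmxDr mulmx1 -scalemxAr mulmxDl -scalemxAl -mulmxA mulmxDr -scalemxAr.
    move: (Rs *m X) (X' *m Rs) (X' *m (Rs *m X)) => P1 P2 P3.
    by apply/matrixP => i j; rewrite !mxE; ring.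
  rewrite E2 mulmxDr mulmx1 -scalemxAr mulmxDl.
  have : Y' *m Co *m X + Y' *m (Co *m Rs *m B) *m Y =
      Y' *m Co *m Rs + eC *: (Y' *m Co *m Rs *m X).
    transitivity (Y' *m Co *m (X + Rs *m B *m Y)); first by rewrite mulmxDr !mulmxA.
    by rewrite -E1 mulmxDr -scalemxAr !mulmxA.
  move: (X' *m X) (Y' *m Co *m Rs) (Y' *m Co *m Rs *m X) => P1 P2 P3.
  move: (Y' *m Co *m X) (Y' *m _ *m Y) => Q1 Q2 E4; rewrite -!addrA E4.
  by apply/matrixP => i j; rewrite !mxE; ring.
set r := sum_norm Rs; have r0 : 0 <= r by exact: sum_norm_ge0.
have bW : sum_norm (X' + eC *: (X' *m X) + Y' *m Co *m X + Y' *m (Co *m Rs *m B) *m Y) <= K'.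
  rewrite /K'; apply: le_trans (sum_normD _ _) (lerD _ _);
    [apply: le_trans (sum_normD _ _) (lerD _ _); [apply: le_trans (sum_normD _ _) (lerD _ _)|]|].
  - by [].
  - rewrite sum_normZ nce; apply: le_trans (ler_wpM2l (ltW e0) (sum_normM _ _)) _.
    by rewrite ler_piMl // mulr_ge0 ?sum_norm_ge0.
  - by [].
  - apply: le_trans (sum_normM _ _) _; rewrite ler_wpM2r ?sum_norm_ge0 //.
    apply: le_trans (sum_normM _ _) _; rewrite ler_wpM2l ?sum_norm_ge0 //.
    exact: le_trans hK (ler_norm _).
have rK : r <= 2 * K'.
  have E4 : Rs = (Rs + eC *: (Rs *m X) + eC *: (X' *m (Rs + eC *: (Rs *m X)))) -
      eC *: (Rs *m X + X' *m Rs + eC *: (X' *m (Rs *m X))).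
    rewrite mulmxDr -scalemxAr.
    move: (Rs *m X) (X' *m Rs) (X' *m (Rs *m X)) => P1 P2 P3.
    by apply/matrixP => i j; rewrite !mxE; ring.
  have : r <= K' + e * (r * sum_norm X + sum_norm X' * r + sum_norm X' * (r * sum_norm X)).
    rewrite /r {1}E4; apply: le_trans (sum_normB _ _) _; apply: lerD; first by rewrite E3.
    rewrite sum_normZ nce ler_wpM2l ?(ltW e0) //; apply: le_trans (sum_normD _ _) (lerD _ _);
      [apply: le_trans (sum_normD _ _) (lerD _ _)|]; rewrite ?sum_normM //.
    rewrite sum_normZ nce; apply: (@le_trans _ _ (1 * sum_norm (X' *m (Rs *m X)))).
      by rewrite ler_wpM2r ?sum_norm_ge0.
    rewrite mul1r; apply: le_trans (sum_normM _ _) _; rewrite ler_wpM2l ?sum_norm_ge0 //;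
      exact: sum_normM.
  have -> : r * sum_norm X + sum_norm X' * r + sum_norm X' * (r * sum_norm X) =
    a * r by rewrite /a; ring.
  have ea0 : 0 <= e * a by rewrite mulr_ge0 // ltW.
  have eK0 : 0 <= e * K' by rewrite mulr_ge0 // ltW.
  have ea2 : e * a <= 1 / 2 by lra.
  by have := ler_wpM2r r0 ea2; rewrite mulrA; lra.
have : sum_norm v <= e * r * sum_norm v.
  rewrite [leLHS](_ : _ = sum_norm (eC *: (Rs *m v))); last first.
    congr sum_norm; have Sv : (s%:M - A) *m v = eC *: v.
      by rewrite Ss mulmxDl !mul_scalar_mx mulmxBl mul_scalar_mx Av subrr add0r.
    by rewrite scalemxAr -Sv mulmxA RS mul1mx.
  by rewrite sum_normZ nce -mulrA ler_wpM2l ?(ltW e0) // sum_normM.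
have : 0 < sum_norm v.
  by rewrite lt_def sum_norm_ge0 andbT; apply: contraNneq v0 => /sum_norm_eq0 ->.
move=> nv0; rewrite ler_pMl // leNgt => /negP; apply.
have ea0 : 0 <= e * a by rewrite mulr_ge0 // ltW.
by have := ler_wpM2l (ltW e0) rK; lra.
Qed.

(** * Transfer matrices as rational functions *)

Lemma char_poly_eval n (A : 'M[C]_n) s : (char_poly A).[s] = \det (s%:M - A).
Proof.
rewrite /char_poly -[_.[s]]/(horner_eval s _) -det_map_mx; congr (\det _).
by apply/matrixP => i j; rewrite !mxE /= /horner_eval hornerD hornerN hornerC hornerMn hornerX.
Qed.

Lemma adj_char_poly_eval n (A : 'M[C]_n) s i j : s%:M - A \in unitmx ->
  (\adj (char_poly_mx A) i j).[s] = (char_poly A).[s] * resolvent A s i j.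
Proof.
move=> u; rewrite char_poly_eval /resolvent /invmx u [in RHS]mxE mulrA divff ?mul1r; last first.
  by rewrite -unitfE -unitmxE.
rewrite -[_.[s]]/(horner_eval s _).
have -> : s%:M - A = map_mx (horner_eval s) (char_poly_mx A).
  by apply/matrixP => a b; rewrite !mxE /= /horner_eval hornerD hornerN hornerC hornerMn hornerX.
by rewrite -map_mx_adj [in RHS]mxE.
Qed.

Lemma size_det_le n (M : 'M[{poly C}]_n) :
  (forall i j, (size (M i j) <= 2)%N) -> (size (\det M) <= n.+1)%N.
Proof.
move=> hM; rewrite /determinant; apply: (leq_trans (size_sum _ _ _)).
apply/bigmax_leqP => s _; rewrite -signr_odd.
rewrite (leq_trans (_ : _ <= size (\prod_i M i (s i))%R)%N) //.
  by case: (odd _); rewrite ?expr0 ?expr1 ?mul1r // mulN1r size_polyN.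
rewrite (leq_trans (size_prod_leq _ _)) // card_ord leq_subLR addnS ltnS addnn.
rewrite -muln2 -[in leqRHS](card_ord n) -sum_nat_const; exact: leq_sum.
Qed.

Lemma size_adj_char_poly n (A : 'M[C]_n) i j :
  (size (\adj (char_poly_mx A) i j) <= n)%N.
Proof.
case: n A i j => [|n] A i j; first by case: i.
rewrite mxE /cofactor -signr_odd.
rewrite (leq_trans (_ : _ <= size (\det (row' j (col' i (char_poly_mx A))))%R)%N) //.
  by case: (odd _); rewrite ?expr0 ?expr1 ?mul1r // mulN1r size_polyN.
apply: size_det_le => a b; rewrite !mxE (leq_trans (size_polyD _ _)) //.
rewrite geq_max size_polyN (leq_trans (size_polyC_leq1 _)) // andbT.
by case: (_ == _); rewrite ?mulr1n ?size_polyX // mulr0n size_poly0.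
Qed.

Lemma transfer_poly n m p (A : 'M[C]_n) (B : 'M[C]_(n, m)) (Co : 'M[C]_(p, n))
    (D : 'M[C]_(p, m)) (u : 'cV[C]_p) (v : 'cV[C]_m) :
  exists P : {poly C}, [/\ (size P <= n.+1)%N, P`_n = dotc u (D *m v) &
    forall s, s%:M - A \in unitmx ->
      P.[s] = (char_poly A).[s] * dotc u (transfer A B Co D s *m v)].
Proof.
pose a : 'rV_n := adjm u *m Co; pose b : 'cV_n := B *m v.
pose Q := \sum_i \sum_j (a 0 i * b j 0) *: \adj (char_poly_mx A) i j.
have sQ : (size Q <= n)%N.
  apply: (leq_trans (size_sum _ _ _)); apply/bigmax_leqP => i _.
  apply: (leq_trans (size_sum _ _ _)); apply/bigmax_leqP => j _.
  exact: leq_trans (size_scale_leq _ _) (size_adj_char_poly _ _ _).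
exists (dotc u (D *m v) *: char_poly A + Q); split.
- rewrite (leq_trans (size_polyD _ _)) // geq_max (leq_trans sQ) // andbT.
  by rewrite (leq_trans (size_scale_leq _ _)) // size_char_poly.
- rewrite coefD coefZ [Q`_n]nth_default // addr0.
  have := char_poly_monic A; rewrite monicE lead_coefE size_char_poly /= => /eqP ->.
  by rewrite mulr1.
- move=> s us; rewrite hornerD hornerZ mulrC.
  have -> : dotc u (transfer A B Co D s *m v) = dotc u (D *m v) + (a *m resolvent A s *m b) 0 0.
    by rewrite /dotc /transfer mulmxDl mulmxDr [LHS]mxE /a /b !mulmxA.
  rewrite mulrDr; congr (_ + _).
  rewrite horner_sum mxE; under eq_bigr do rewrite horner_sum.
  rewrite exchange_big mulr_sumr; apply: eq_bigr => j _ /=.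
  rewrite [in RHS]mxE mulr_suml mulr_sumr; apply: eq_bigr => i _.
  by rewrite hornerZ adj_char_poly_eval //; ring.
Qed.

Lemma transfer_infty n m p (A : 'M[C]_n) (B : 'M[C]_(n, m)) (Co : 'M[C]_(p, n))
    (D : 'M[C]_(p, m)) : exists K W : R, [/\ 0 <= K, 0 < W & forall s,
   s%:M - A \in unitmx -> W <= nc s -> nc s * sum_norm (transfer A B Co D s - D) <= K].
Proof.
exists (sum_norm Co * (2 * sum_norm (1%:M : 'M[C]_n)) * sum_norm B), (2 * sum_norm A + 1); split.
- by rewrite !mulr_ge0 ?sum_norm_ge0.
- by rewrite ltr_wpDl // mulr_ge0 ?sum_norm_ge0.
move=> s u hs; rewrite /transfer addrC addKr.
have := resolvent_infty u hs.
have : sum_norm (Co *m resolvent A s *m B) <= sum_norm Co * sum_norm (resolvent A s) * sum_norm B.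
  by apply: le_trans (sum_normM _ _) _; rewrite ler_wpM2r ?sum_norm_ge0 // sum_normM.
move=> h1 h2; apply: le_trans (ler_wpM2l (nc_ge0 _) h1) _.
have -> (x y z t : R) : x * (y * z * t) = y * (x * z) * t by ring.
by rewrite ler_wpM2r ?sum_norm_ge0 // ler_wpM2l ?sum_norm_ge0.
Qed.

Lemma gain_feedthrough n m p (A : 'M[C]_n) (B : 'M[C]_(n, m)) (Co : 'M[C]_(p, n))
    (D : 'M[C]_(p, m)) (g : R) : hurwitzm A ->
  (forall (w : R) v, l2norm (transfer A B Co D (0 +i* w)%C *m v) <= g * l2norm v) ->
  forall v, l2norm (D *m v) <= g * l2norm v.
Proof.
move=> hA hg v; have [K [W [K0 W0 hK]]] := transfer_infty A B Co D.
apply/ler_addgt0Pr => e e0.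
pose w := W + K * l2norm v / e.
have wW : W <= w by rewrite lerDl divr_ge0 ?(ltW e0) // mulr_ge0 ?l2norm_ge0.
have w0 : 0 < w by exact: lt_le_trans wW.
have ncw : nc (0 +i* w)%C = w by rewrite nc_imag gtr0_norm.
have u : (0 +i* w)%C%:M - A \in unitmx by apply: hurwitz_unit => //=.
have := hK _ u; rewrite ncw => /(_ wW).
set T := transfer _ _ _ _ _ => hT.
have -> : D *m v = T *m v + - ((T - D) *m v) by rewrite mulmxBl opprB addrC subrK.
apply: le_trans (l2normD _ _) _; apply: lerD; first exact: hg.
rewrite -scaleN1r l2normZ ncN nc1 mul1r; apply: le_trans (l2norm_mul _ _) _.
rewrite -(ler_pM2l w0) mulrA; apply: (@le_trans _ _ (K * l2norm v)).
  by rewrite ler_wpM2r ?l2norm_ge0.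
by rewrite /w mulrDl divfK ?gt_eqF // lerDr mulr_ge0 ?ltW.
Qed.

(** The maximum principle applies to each scalar function [u^H G(s) v], and
    [u = G(s) v] turns a bound on it into one on [|G(s) v|]. *)
Lemma gain_half_plane n m p (A : 'M[C]_n) (B : 'M[C]_(n, m)) (Co : 'M[C]_(p, n))
    (D : 'M[C]_(p, m)) (g : R) : hurwitzm A -> 0 <= g ->
  (forall (w : R) v, l2norm (transfer A B Co D (0 +i* w)%C *m v) <= g * l2norm v) ->
  forall s v, 0 <= Re s -> l2norm (transfer A B Co D s *m v) <= g * l2norm v.
Proof.
move=> hA g0 hg s v s0; set u := transfer A B Co D s *m v.
have [->|un0] := eqVneq u 0; first by rewrite l2norm_0 mulr_ge0 ?l2norm_ge0.
have [P [sP Pn Ps]] := transfer_poly A B Co D u v.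
have chi0 : char_poly A != 0 by rewrite monic_neq0 // char_poly_monic.
have G0 : 0 <= l2norm u * (g * l2norm v) by rewrite !mulr_ge0 ?l2norm_ge0.
have hchi : hurwitz_poly (char_poly A).
  move=> a ra; rewrite ltNge; apply/negP => a0.
  by have := hurwitz_unit hA a0; rewrite unit_eigenvalue ra.
have := @max_modulus _ P (char_poly A) (l2norm u * (g * l2norm v)).
rewrite size_char_poly => /(_ sP chi0 hchi G0) /=.
have -> : lead_coef (char_poly A) = 1 by apply/eqP; rewrite -monicE char_poly_monic.
rewrite nc1 mulr1 Pn => H.
have : nc P.[s] <= l2norm u * (g * l2norm v) * nc (char_poly A).[s].
  apply: H => //.
    apply: le_trans (dotc_le _ _) _; rewrite ler_wpM2l ?l2norm_ge0 //.
    exact: gain_feedthrough hA hg v.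
  move=> w; rewrite Ps; last by apply: hurwitz_unit.
  rewrite ncM mulrC ler_wpM2r ?nc_ge0 //; apply: le_trans (dotc_le _ _) _.
  by rewrite ler_wpM2l ?l2norm_ge0.
rewrite Ps ?hurwitz_unit // -/u dotcc ncM ncR ger0_norm ?sqr_ge0 //.
rewrite [leRHS]mulrC ler_pM2l; last first.
  rewrite nc_gt0; have := hurwitz_unit hA s0.
  by rewrite unit_eigenvalue rootE.
by rewrite expr2 ler_pM2l // l2norm_gt0.
Qed.

End Resolvent.

(** * Calculus of complex-valued signals *)

Section ComplexDerivative.
Variable R : realType.
Local Notation C := R[i].
Implicit Types (f g z : R -> C) (t : R).

Definition cderive f t (d : C) : Prop :=
  is_derive t (1 : R) (fun r => Re (f r)) (Re d) /\
  is_derive t (1 : R) (fun r => Im (f r)) (Im d).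

Definition right_cont f t : Prop :=
  (Re (f r) @[r --> t^'+] --> Re (f t)) /\ (Im (f r) @[r --> t^'+] --> Im (f t)).

Lemma ReM (a b : C) : Re (a * b) = Re a * Re b - Im a * Im b.
Proof. by case: a b => [a1 a2] [b1 b2]. Qed.

Lemma ImM (a b : C) : Im (a * b) = Re a * Im b + Im a * Re b.
Proof. by case: a b => [a1 a2] [b1 b2]. Qed.

Lemma ReD (a b : C) : Re (a + b) = Re a + Re b.
Proof. by case: a b => [a1 a2] [b1 b2]. Qed.

Lemma ImD (a b : C) : Im (a + b) = Im a + Im b.
Proof. by case: a b => [a1 a2] [b1 b2]. Qed.

Lemma cderive_ext f g t d : f =1 g -> cderive f t d -> cderive g t d.
Proof. by move=> /funext ->. Qed.

Lemma cderive_cst (c : C) t : cderive (fun=> c) t 0.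
Proof. by split; apply: is_derive_cst. Qed.

Lemma cderiveD f g t df dg : cderive f t df -> cderive g t dg ->
  cderive (fun r => f r + g r) t (df + dg).
Proof.
move=> [f1 f2] [g1 g2]; split; rewrite ?ReD ?ImD.
  rewrite (_ : (fun _ => _) = (fun r => Re (f r)) + (fun r => Re (g r))).
    exact: is_deriveD.
  by apply/funext => r; rewrite ReD.
rewrite (_ : (fun _ => _) = (fun r => Im (f r)) + (fun r => Im (g r))).
  exact: is_deriveD.
by apply/funext => r; rewrite ImD.
Qed.

Lemma is_derive_congr (h : R -> R) t d d' : is_derive t (1 : R) h d -> d = d' ->
  is_derive t (1 : R) h d'.
Proof. by move=> hd <-. Qed.

Lemma cderiveM f g t df dg : cderive f t df -> cderive g t dg ->
  cderive (fun r => f r * g r) t (df * g t + f t * dg).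
Proof.
move=> [f1 f2] [g1 g2]; split.
  rewrite (_ : (fun _ => _) = (fun r => Re (f r)) * (fun r => Re (g r)) -
     (fun r => Im (f r)) * (fun r => Im (g r))); last first.
    by apply/funext => r; rewrite ReM.
  apply: is_derive_congr (is_deriveB (is_deriveM f1 g1) (is_deriveM f2 g2)) _.
  by rewrite ReD !ReM /GRing.scale /=; ring.
rewrite (_ : (fun _ => _) = (fun r => Re (f r)) * (fun r => Im (g r)) +
   (fun r => Im (f r)) * (fun r => Re (g r))); last first.
  by apply/funext => r; rewrite ImM.
apply: is_derive_congr (is_deriveD (is_deriveM f1 g2) (is_deriveM f2 g1)) _.
by rewrite ImD !ImM /GRing.scale /=; ring.
Qed.

Lemma cderiveZ (c : C) f t df : cderive f t df -> cderive (fun r => c * f r) t (c * df).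
Proof.
move=> hf; have := cderiveM (cderive_cst c t) hf.
by rewrite mul0r add0r.
Qed.

Lemma cderive_sum n (f : 'I_n -> R -> C) (d : 'I_n -> C) t :
  (forall i, cderive (f i) t (d i)) -> cderive (fun r => \sum_i f i r) t (\sum_i d i).
Proof.
elim: n f d => [|n IH] f d h.
  rewrite big_ord0; apply: cderive_ext (cderive_cst 0 t) => r.
  by rewrite big_ord0.
rewrite big_ord_recl.
apply: (@cderive_ext (fun r => f ord0 r + \sum_(i < n) f (lift ord0 i) r)).
  by move=> r; rewrite big_ord_recl.
by apply: cderiveD => //; apply: IH.
Qed.

Lemma cderive_real t : cderive (fun r : R => r%:C%C) t 1.
Proof. by split; [apply: is_derive_id | apply: is_derive_cst]. Qed.

Lemma is_derive_rcvg (h : R -> R) (dh : R) t : is_derive t (1 : R) h dh ->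
  h r @[r --> t^'+] --> h t.
Proof.
move=> [hd _]; apply: cvg_at_right_filter.
by apply: differentiable_continuous; apply/derivable1_diffP.
Qed.

Lemma cderive_right_cont f t d : cderive f t d -> right_cont f t.
Proof. by move=> [/is_derive_rcvg h1 /is_derive_rcvg h2]; split. Qed.

Definition cis (w t : R) : C := (cos (w * t) +i* sin (w * t))%C.

Lemma cderive_cis w t : cderive (cis w) t ((0 +i* w)%C * cis w t).
Proof.
have dw : is_derive t (1 : R) (fun r : R => w * r) w.
  have := @is_deriveZ _ _ _ (@id R) w t 1 1 (is_derive_id _ _).
  by rewrite scaler1; apply.
split.
  have := @is_derive1_comp _ (@cos R) (fun r : R => w * r) t _ _ (is_derive_cos _) dw.
  by rewrite /cis /= mul0r sub0r => h; apply: is_derive_eq; rewrite mulNr mulrC.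
have := @is_derive1_comp _ (@sin R) (fun r : R => w * r) t _ _ (is_derive_sin _) dw.
by rewrite /cis /= mul0r add0r => h; apply: is_derive_eq; rewrite mulrC.
Qed.

Lemma nc_cis w t : nc (cis w t) = 1.
Proof. by rewrite /cis /= cos2Dsin2 sqrtr1. Qed.

Lemma right_contD f g t : right_cont f t -> right_cont g t -> right_cont (fun r => f r + g r) t.
Proof.
move=> [f1 f2] [g1 g2]; split.
  rewrite (_ : (fun _ => _) = fun r => Re (f r) + Re (g r)); last first.
    by apply/funext => r; rewrite ReD.
  by rewrite ReD; apply: cvgD.
rewrite (_ : (fun _ => _) = fun r => Im (f r) + Im (g r)); last first.
  by apply/funext => r; rewrite ImD.
by rewrite ImD; apply: cvgD.
Qed.

Lemma right_contZ (c : C) f t : right_cont f t -> right_cont (fun r => c * f r) t.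
Proof.
move=> [f1 f2]; split.
  rewrite (_ : (fun _ => _) = fun r => Re c * Re (f r) - Im c * Im (f r)); last first.
    by apply/funext => r; rewrite ReM.
  by rewrite ReM; apply: cvgB; apply: cvgM => //; apply: cvg_cst.
rewrite (_ : (fun _ => _) = fun r => Re c * Im (f r) + Im c * Re (f r)); last first.
  by apply/funext => r; rewrite ImM.
by rewrite ImM; apply: cvgD; apply: cvgM => //; apply: cvg_cst.
Qed.

Lemma right_cont_sum n (f : 'I_n -> R -> C) t :
  (forall i, right_cont (f i) t) -> right_cont (fun r => \sum_i f i r) t.
Proof.
elim: n f => [|n IH] f h.
  rewrite (_ : (fun _ => _) = fun=> 0); first by split; apply: cvg_cst.
  by apply/funext => r; rewrite big_ord0.
rewrite (_ : (fun _ => _) = fun r => f ord0 r + \sum_(i < n) f (lift ord0 i) r).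
  by apply: right_contD => //; apply: IH.
by apply/funext => r; rewrite big_ord_recl.
Qed.

(** * Bounded inputs drive stable linear systems to bounded states *)

(** Energy estimate: with [r = |z|^2] and [a = - Re l] one has
    [r' <= - a r + M^2 / a], so [e^(a t) (r - (M / a)^2)] decreases. *)
Lemma scalar_bounded z f (l : C) (M : R) :
  Re l < 0 -> right_cont z 0 -> (forall t, 0 < t -> cderive z t (l * z t + f t)) ->
  (forall t, 0 < t -> nc (f t) <= M) ->
  exists K : R, forall t, 0 <= t -> nc (z t) <= K.
Proof.
move=> l0 [c1 c2] hz hf; set a := - Re l; have a0 : 0 < a by rewrite oppr_gt0.
pose x t := Re (z t); pose y t := Im (z t).
(* the decreasing quantity [e^(a t) (r - (M / a)^2)] *)
pose k := (fun t => expR (a * t)) * (x * x + y * y - cst ((M / a) ^+ 2)).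
pose dk t := a * expR (a * t) * (x t * x t + y t * y t - (M / a) ^+ 2) +
  expR (a * t) * (2 * x t * Re (l * z t + f t) + 2 * y t * Im (l * z t + f t)).
have dke t : is_derive t 1 (fun t => expR (a * t)) (a * expR (a * t)).
  have dw : is_derive t (1 : R) (fun r : R => a * r) a.
    have := @is_deriveZ _ _ _ (@id R) a t 1 1 (is_derive_id _ _).
    by rewrite scaler1; apply.
  have := @is_derive1_comp _ (@expR R) (fun r : R => a * r) t _ _ (is_derive_expR _) dw.
  by rewrite mulrC.
have hk t : 0 < t -> is_derive t 1 k (dk t).
  move=> /hz[d1 d2]; have dx : is_derive t 1 x _ := d1; have dy : is_derive t 1 y _ := d2.
  have de := dke t.
  apply: is_derive_congr (is_deriveM de (is_deriveB
    (is_deriveD (is_deriveM dx dx) (is_deriveM dy dy)) (is_derive_cst _ _ _))) _.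
  rewrite /dk !fctE /GRing.scale /= -/(x t) -/(y t).
  by ring.
have dk0 t : 0 < t -> dk t <= 0.
  move=> t0; rewrite /dk.
  have -> (u v w p : R) : u * v * w + v * p = v * (u * w + p) by ring.
  rewrite pmulr_rle0 ?expR_gt0 //.
  have fM : Re (f t) ^+ 2 + Im (f t) ^+ 2 <= M ^+ 2.
    rewrite -sqr_nc lerXn2r ?nnegrE ?nc_ge0 ?hf //.
    exact: le_trans (nc_ge0 _) (hf _ t0).
  rewrite ReD ImD ReM ImM -/(x t) -/(y t).
  have -> : Re l = - a by rewrite opprK.
  rewrite exprMn exprVn mulrBr.
  have -> : a * (M ^+ 2 / a ^+ 2) = M ^+ 2 / a by field; rewrite gt_eqF.
  move: fM; set p := Re (f t); set q := Im (f t); move: (x t) (y t) => X Y fM.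
  rewrite -(ler_pM2l a0) mulr0.
  have -> : a * (a * (X * X + Y * Y) - M ^+ 2 / a +
     (2 * X * (- a * X - Im l * Y + p) + 2 * Y * (- a * Y + Im l * X + q))) =
     p ^+ 2 + q ^+ 2 - M ^+ 2 - ((a * X - p) ^+ 2 + (a * Y - q) ^+ 2).
    by field; rewrite gt_eqF.
  by have := sqr_ge0 (a * X - p); have := sqr_ge0 (a * Y - q); lra.
have kle t : 0 < t -> k t <= k 0.
  move=> t0; have [||c] := @MVT _ k dk 0 t t0.
  - by move=> s; rewrite in_itv /= => /andP[s0 _]; exact: hk.
  - have ck s : 0 < s -> {for s, continuous k}.
      move=> /hk[hd _]; apply: differentiable_continuous; exact/derivable1_diffP.
    apply/continuous_within_itvP => //; split.
    + by move=> s; rewrite in_itv /= => /andP[s0 _]; exact: ck.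
    + apply: cvgM.
        exact: is_derive_rcvg (dke 0).
      by apply: cvgB; [apply: cvgD; apply: cvgM | apply: cvg_cst].
    + by apply: cvg_at_left_filter; apply: ck.
  rewrite in_itv /= => /andP[s0 _] E; have := dk0 _ s0.
  by rewrite subr0 in E; nra.
pose K := (M / a) ^+ 2 + `|k 0| + nc (z 0).
have K0 : 0 <= K by rewrite !addr_ge0 ?sqr_ge0 ?nc_ge0.
exists (K + 1) => t; rewrite le_eqVlt => /predU1P[<-|t0].
  by rewrite /K; have := sqr_ge0 (M / a); have := normr_ge0 (k 0); lra.
have h : nc (z t) ^+ 2 <= K.
  have := kle t t0; rewrite {1}/k /= => h.
  have h2 : expR (a * t) * (nc (z t) ^+ 2 - (M / a) ^+ 2) <= `|k 0|.
    apply: le_trans (ler_norm _); apply: le_trans h.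
    by rewrite sqr_nc !expr2.
  have e1 : 1 <= expR (a * t) by rewrite -expR0 ler_expR mulr_ge0 // ltW.
  have := nc_ge0 (z 0); have := normr_ge0 (k 0).
  rewrite /K; set u := nc (z t) ^+ 2 - (M / a) ^+ 2 in h2.
  have -> : nc (z t) ^+ 2 = u + (M / a) ^+ 2 by rewrite subrK.
  by move=> p q; have [u0|u0] := leP u 0; nra.
by have := nc_ge0 (z t); nra.
Qed.

Definition vderive n (x : R -> 'cV[C]_n) t (d : 'cV[C]_n) : Prop :=
  forall i, cderive (fun r => x r i 0) t (d i 0).

Definition vright_cont n (x : R -> 'cV[C]_n) t : Prop :=
  forall i, right_cont (fun r => x r i 0) t.

Lemma vderive_mul n m (P : 'M[C]_(m, n)) (x : R -> 'cV[C]_n) t d :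
  vderive x t d -> vderive (fun r => P *m x r) t (P *m d).
Proof.
move=> h i; rewrite mxE; apply: (@cderive_ext (fun r => \sum_j P i j * x r j 0)).
  by move=> r; rewrite mxE.
by apply: cderive_sum => j; apply: cderiveZ.
Qed.

Lemma vright_cont_mul n m (P : 'M[C]_(m, n)) (x : R -> 'cV[C]_n) t :
  vright_cont x t -> vright_cont (fun r => P *m x r) t.
Proof.
move=> h i; rewrite (_ : (fun _ => _) = (fun r => \sum_j P i j * x r j 0)).
  by apply: right_cont_sum => j; apply: right_contZ.
by apply/funext => r; rewrite mxE.
Qed.

Lemma triangular_bounded n (T : 'M[C]_n) (y f : R -> 'cV[C]_n) (M : R) :
  is_trig_mx T -> (forall i, Re (T i i) < 0) -> vright_cont y 0 ->
  (forall t, 0 < t -> vderive y t (T *m y t + f t)) ->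
  (forall t, 0 < t -> forall i, nc (f t i 0) <= M) ->
  forall i, exists K : R, forall t, 0 <= t -> nc (y t i 0) <= K.
Proof.
move=> /is_trig_mxP tT dT cy hy hf i.
have [m] := ubnP (i : nat); elim: m i => // m IH i im.
have {}IH (j : 'I_n) : (j < i)%N -> exists K : R, forall t, 0 <= t -> nc (y t j 0) <= K.
  by move=> ji; apply: IH; exact: leq_trans ji _.
have /choice[K hK] : forall j : 'I_n, exists K : R, (j < i)%N ->
    forall t, 0 <= t -> nc (y t j 0) <= K.
  move=> j; case: (ltnP j i) => [ji|_]; last by exists 0.
  by have [K hK] := IH j ji; exists K.
apply: (@scalar_bounded _ (fun t => \sum_(j < n | (j < i)%N) T i j * y t j 0 + f t i 0)
  (T i i) (\sum_(j < n | (j < i)%N) nc (T i j) * K j + M)) => //.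
  move=> t t0; have := hy t t0 i; rewrite !mxE (bigD1 i) //= -addrA.
  rewrite [X in _ + (X + _)](bigID (fun j : 'I_n => (j < i)%N)) /=.
  rewrite [X in _ + (_ + X + _)]big1 ?addr0; last first.
    by move=> j /andP[ji]; rewrite -leqNgt => ij; rewrite tT ?mul0r // ltn_neqAle eq_sym ji.
  rewrite (eq_bigl (fun j : 'I_n => (j < i)%N)) // => j.
  by rewrite -val_eqE /= neq_ltn; case: ltngtP.
move=> t t0; apply: le_trans (ncD _ _) _; apply: lerD; last exact: hf.
apply: le_trans (nc_sum _ _ _) _; apply: ler_sum => j ji.
by rewrite ncM ler_wpM2l ?nc_ge0 // hK // ltW.
Qed.

Lemma scalar_sub_entry n (c : C) (T : 'M[C]_n) i j :
  (c%:M - T) i j = c *+ (i == j) - T i j.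
Proof. by rewrite !mxE. Qed.

(** In Schur coordinates the equations are triangular and are bounded one after
    the other. *)
Lemma bounded_response n (A : 'M[C]_n) (x f : R -> 'cV[C]_n) (M : R) :
  hurwitzm A -> vright_cont x 0 -> (forall t, 0 < t -> vderive x t (A *m x t + f t)) ->
  (forall t, 0 < t -> sum_norm (f t) <= M) ->
  exists K : R, forall t, 0 <= t -> sum_norm (x t) <= K.
Proof.
case: n A x f => [|n] A x f hA cx hx hf.
  by exists 0 => t _; rewrite /sum_norm big_ord0.
have [//|P Pu] := @Schur _ _ A.
have Pun := unitarymx_unit Pu.
rewrite /similar_to conjumx // => /= tT; set T := P *m A *m invmx P in tT.
have dT i : Re (T i i) < 0.
  rewrite ltNge; apply/negP => h.
  have : (T i i)%:M - T \in unitmx.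
    have -> : (T i i)%:M - T = P *m ((T i i)%:M - A) *m invmx P.
      by rewrite mulmxBr mulmxBl mul_mx_scalar -scalemxAl mulmxV // scalemx1.
    by rewrite !unitmx_mul Pun (hurwitz_unit hA h) unitmx_inv Pun.
  rewrite unitmxE det_trig; last first.
    apply/is_trig_mxP => a b ab; rewrite scalar_sub_entry.
    have -> : (a == b) = false by apply/negP => /eqP E; rewrite E ltnn in ab.
    by have /is_trig_mxP T0 := tT; rewrite (T0 a b ab) subr0 mulr0n.
  by rewrite (bigD1 i) //= scalar_sub_entry eqxx mulr1n subrr mul0r unitr0.
have /choice[K hK] : forall i, exists K : R, forall t, 0 <= t -> nc ((P *m x t) i 0) <= K.
  move=> i.
  apply: (@triangular_bounded _ T (fun t => P *m x t) (fun t => P *m f t) (sum_norm P * M)) => //.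
  - exact: vright_cont_mul.
  - move=> t t0; have -> : T *m (P *m x t) + P *m f t = P *m (A *m x t + f t).
      by rewrite /T -mulmxA mulKmx // mulmxDr mulmxA.
    by apply: vderive_mul; apply: hx.
  - move=> t t0 j; apply: le_trans (nc_le_sum_norm _ _ _) _; apply: le_trans (sum_normM _ _) _.
    by rewrite ler_wpM2l ?sum_norm_ge0 // hf.
exists (sum_norm (invmx P) * \sum_i K i) => t t0.
rewrite -[x t](mulKmx Pun); apply: le_trans (sum_normM _ _) _.
rewrite ler_wpM2l ?sum_norm_ge0 //; apply: ler_sum => i _.
by rewrite big_ord1 hK.
Qed.

(** * The matrix exponential *)

(** Exponential generating function of [b]: its derivative is that of the shifted
    sequence, so that the powers [A^k v] give the matrix exponential. *)
Definition egf (b : nat -> R) (t : R) : R := limn (pseries (fun k => b k / k`!%:R) t).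

Definition exp_bounded (b : nat -> R) : Prop :=
  exists B M : R, [/\ 0 <= B, 0 <= M & forall k, `|b k| <= B * M ^+ k].

Lemma exp_bounded_cvg b t : exp_bounded b -> cvgn (pseries (fun k => b k / k`!%:R) t).
Proof.
move=> [B [M [B0 M0 hb]]]; apply: normed_cvg.
apply: (@series_le_cvg _ _ (B *: exp_coeff (M * `|t|))).
- by move=> k; rewrite normr_ge0.
- by move=> k; rewrite fctE /GRing.scale /= mulr_ge0 // exp_coeff_ge0 // mulr_ge0.
- move=> k; rewrite fctE /GRing.scale /= normrM normrM normfV.
  rewrite [X in _ <= _ * X](_ : _ = (M * `|t|) ^+ k / k`!%:R) //.
  rewrite normrX exprMn [`|k`!%:R|]ger0_norm //.
  rewrite [leLHS](_ : _ = `|b k| * (`|t| ^+ k / k`!%:R)); last by ring.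
  rewrite [leRHS](_ : _ = B * M ^+ k * (`|t| ^+ k / k`!%:R)); last by ring.
  by rewrite ler_wpM2r // divr_ge0 // exprn_ge0.
- by apply: is_cvg_seriesZ; exact: is_cvg_series_exp_coeff.
Qed.

Lemma exp_bounded_shift b : exp_bounded b -> exp_bounded (fun k => b k.+1).
Proof.
move=> [B [M [B0 M0 hb]]]; exists (B * M), M; split=> //; first by rewrite mulr_ge0.
by move=> k; rewrite -mulrA -exprS.
Qed.

Lemma egf_diffs (b : nat -> R) : pseries_diffs (fun k => b k / k`!%:R) =
  (fun k => b k.+1 / k`!%:R).
Proof.
apply/funext => k; rewrite /pseries_diffs factS natrM invfM mulrCA mulVKf //.
Qed.

Lemma egf_derive b t : exp_bounded b -> is_derive t (1 : R) (egf b) (egf (fun k => b k.+1) t).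
Proof.
move=> hb; have hb1 := exp_bounded_shift hb; have hb2 := exp_bounded_shift hb1.
have := @pseries_snd_diffs _ (fun k => b k / k`!%:R) (`|t| + 1) t.
rewrite !egf_diffs; apply; try exact: exp_bounded_cvg.
by rewrite [ltRHS]ger0_norm ?ltrDl // addr_ge0.
Qed.

Lemma egf0 b : exp_bounded b -> egf b 0 = b 0%N.
Proof.
move=> hb; rewrite /egf; apply: lim_near_cst => //.
near=> m; rewrite -[m]prednK; last by near: m; exists 1%N.
rewrite /pseries /series /= big_nat_recl // big1 ?addr0 ?expr0 ?mulr1 ?divr1 //.
by move=> i _; rewrite expr0n mulr0.
Unshelve. all: by end_near. Qed.

Lemma egf_lin2 b c (p q : R) : exp_bounded b -> exp_bounded c -> forall t,
  egf (fun k => p * b k + q * c k) t = p * egf b t + q * egf c t.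
Proof.
move=> hb hc t; rewrite /egf.
have h1 := @exp_bounded_cvg b t hb; have h2 := @exp_bounded_cvg c t hc.
rewrite -[p * _]/(p *: _) -[q * _]/(q *: _) -!lim_seriesZ // -lim_seriesD;
  try exact: is_cvg_seriesZ.
congr (limn _); congr series; apply/funext => k.
by rewrite !fctE /GRing.scale /=; ring.
Qed.

Lemma exp_bounded_lin2 b c (p q : R) : exp_bounded b -> exp_bounded c ->
  exp_bounded (fun k => p * b k + q * c k).
Proof.
move=> [B [M [B0 M0 hb]]] [B' [M' [B0' M0' hc]]].
exists (`|p| * B + `|q| * B'), (M + M'); split; rewrite ?addr_ge0 ?mulr_ge0 //.
move=> k; apply: le_trans (ler_normD _ _) _; rewrite mulrDl; apply: lerD.
  rewrite normrM -mulrA ler_wpM2l //; apply: le_trans (hb _) _; rewrite ler_wpM2l //.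
  by rewrite lerXn2r ?nnegrE ?addr_ge0 // lerDl.
rewrite normrM -mulrA ler_wpM2l //; apply: le_trans (hc _) _; rewrite ler_wpM2l //.
by rewrite lerXn2r ?nnegrE ?addr_ge0 // lerDr.
Qed.

Lemma egf_sum n (b c : 'I_n -> nat -> R) (p q : 'I_n -> R) t :
  (forall j, exp_bounded (b j)) -> (forall j, exp_bounded (c j)) ->
  egf (fun k => \sum_j (p j * b j k + q j * c j k)) t =
  \sum_j (p j * egf (b j) t + q j * egf (c j) t).
Proof.
move=> hb hc.
suff [_ ->] : exp_bounded (fun k => \sum_j (p j * b j k + q j * c j k)) /\
  egf (fun k => \sum_j (p j * b j k + q j * c j k)) t =
  \sum_j (p j * egf (b j) t + q j * egf (c j) t) by [].
elim: n b c p q hb hc => [|n IH] b c p q hb hc.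
  rewrite big_ord0; rewrite (_ : (fun _ => _) = fun=> 0); last first.
    by apply/funext => k; rewrite big_ord0.
  have h0 : exp_bounded (fun=> 0) by exists 0, 0; split=> // k; rewrite normr0 mul0r.
  split=> //; rewrite /egf (_ : pseries _ _ = fun=> 0) ?lim_cst //.
  by apply/funext => k; rewrite /pseries /series /= big1 // => i _; rewrite !mul0r.
have [h1 h2] := IH (fun j => b (lift ord0 j)) (fun j => c (lift ord0 j))
  (fun j => p (lift ord0 j)) (fun j => q (lift ord0 j)) (fun j => hb _) (fun j => hc _).
have h3 := exp_bounded_lin2 (p ord0) (q ord0) (hb ord0) (hc ord0).
have E : (fun k => \sum_j (p j * b j k + q j * c j k)) = (fun k =>
   1 * (p ord0 * b ord0 k + q ord0 * c ord0 k) + 1 *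
   \sum_(j < n) (p (lift ord0 j) * b (lift ord0 j) k + q (lift ord0 j) * c (lift ord0 j) k)).
  by apply/funext => k; rewrite big_ord_recl !mul1r.
rewrite E; split; first exact: exp_bounded_lin2.
by rewrite egf_lin2 // !mul1r h2 big_ord_recl egf_lin2.
Qed.

(** [z t = exp (t A) v], through the power series of its entries. *)
Lemma linear_ode_solution n (A : 'M[C]_n) (v : 'cV[C]_n) :
  exists z : R -> 'cV[C]_n, z 0 = v /\ forall t, vderive z t (A *m z t).
Proof.
pose w k := iter k (mulmx A) v.
have hw k : sum_norm (w k) <= sum_norm v * sum_norm A ^+ k.
  elim: k => [|k IH]; first by rewrite mulr1.
  rewrite /w iterS exprS mulrCA; apply: le_trans (sum_normM _ _) _.
  by rewrite ler_wpM2l ?sum_norm_ge0.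
pose bR i k := Re (w k i 0); pose bI i k := Im (w k i 0).
have hR i : exp_bounded (bR i).
  exists (sum_norm v), (sum_norm A); split; rewrite ?sum_norm_ge0 // => k; apply: le_trans (hw k).
  exact: le_trans (nc_Re _) (nc_le_sum_norm _ _ _).
have hI i : exp_bounded (bI i).
  exists (sum_norm v), (sum_norm A); split; rewrite ?sum_norm_ge0 // => k; apply: le_trans (hw k).
  exact: le_trans (nc_Im _) (nc_le_sum_norm _ _ _).
exists (fun t => \col_i (egf (bR i) t +i* egf (bI i) t)%C); split.
  apply/colP => i; rewrite mxE !egf0 // /bR /bI /w /=; by case: (v i 0).
move=> t i; rewrite mxE.
have RS (I : finType) (F : I -> C) : Re (\sum_i F i) = \sum_i Re (F i).
  by elim/big_rec2: _ => // j a b _; rewrite ReD => ->.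
have IS (I : finType) (F : I -> C) : Im (\sum_i F i) = \sum_i Im (F i).
  by elim/big_rec2: _ => // j a b _; rewrite ImD => ->.
split.
  rewrite (_ : (fun _ => _) = egf (bR i)); last by apply/funext => r; rewrite mxE.
  apply: is_derive_congr (egf_derive t (hR i)) _.
  rewrite (_ : (fun _ => _) = (fun k => \sum_j (Re (A i j) * bR j k + (- Im (A i j)) * bI j k))).
    rewrite egf_sum // RS; apply: eq_bigr => j _.
    by rewrite ReM mxE mulNr.
  apply/funext => k; rewrite /bR /w iterS mxE RS; apply: eq_bigr => j _.
  by rewrite ReM mulNr.
rewrite (_ : (fun _ => _) = egf (bI i)); last by apply/funext => r; rewrite mxE.
apply: is_derive_congr (egf_derive t (hI i)) _.
rewrite (_ : (fun _ => _) = (fun k => \sum_j (Im (A i j) * bR j k + Re (A i j) * bI j k))).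
  rewrite egf_sum // IS; apply: eq_bigr => j _.
  by rewrite ImM mxE addrC.
apply/funext => k; rewrite /bI /w iterS mxE IS; apply: eq_bigr => j _.
by rewrite ImM addrC.
Qed.

End ComplexDerivative.

(** * The feedback loop under the small-gain condition *)

Section ClosedLoop.
Variable R : realType.
Local Notation C := R[i].

Lemma vderive_col n m (x : R -> 'cV[C]_n) (y : R -> 'cV[C]_m) t d e :
  vderive x t d -> vderive y t e -> vderive (fun r => col_mx (x r) (y r)) t (col_mx d e).
Proof.
move=> hx hy i; case: (split_ordP i) => j ->.
  rewrite col_mxEu; apply: cderive_ext (hx j) => r.
  by rewrite col_mxEu.
rewrite col_mxEd; apply: cderive_ext (hy j) => r.
by rewrite col_mxEd.
Qed.

Lemma vright_cont_col n m (x : R -> 'cV[C]_n) (y : R -> 'cV[C]_m) t :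
  vright_cont x t -> vright_cont y t -> vright_cont (fun r => col_mx (x r) (y r)) t.
Proof.
move=> hx hy i; case: (split_ordP i) => j ->.
  rewrite (_ : (fun _ => _) = fun r => x r j 0); first exact: hx.
  by apply/funext => r; rewrite col_mxEu.
rewrite (_ : (fun _ => _) = fun r => y r j 0); first exact: hy.
by apply/funext => r; rewrite col_mxEd.
Qed.

Lemma sum_norm_col n m (x : 'cV[C]_n) (y : 'cV[C]_m) : sum_norm (col_mx x y) =
  sum_norm x + sum_norm y.
Proof.
rewrite /sum_norm big_split_ord /=; congr (_ + _); apply: eq_bigr => i _; rewrite !big_ord1.
  by rewrite col_mxEu.
by rewrite col_mxEd.
Qed.

Lemma eigen_transfer n m p (A : 'M[C]_n) (B : 'M[C]_(n, m)) (Co : 'M[C]_(p, n))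
  (D : 'M[C]_(p, m)) s (x : 'cV[C]_n) (e : 'cV[C]_m) : s%:M - A \in unitmx ->
    A *m x + B *m e = s *: x ->
  x = resolvent A s *m B *m e /\ Co *m x + D *m e = transfer A B Co D s *m e.
Proof.
move=> u E; have E2 : (s%:M - A) *m x = B *m e.
  by rewrite mulmxBl mul_scalar_mx -E addrC addKr.
have xE : x = resolvent A s *m B *m e by rewrite -mulmxA -E2 mulmxA mulVmx // mul1mx.
by split=> //; rewrite /transfer mulmxDl {1}xE !mulmxA addrC.
Qed.

Lemma small_gain_loop l k (T1 : 'M[C]_(l, k)) (T2 : 'M[C]_(k, l)) (g : R)
    (e1 : 'cV[C]_k) (e2 : 'cV[C]_l) :
  g < 1 -> (forall v, l2norm (T1 *m v) <= g * l2norm v) ->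
    (forall v, l2norm (T2 *m v) <= l2norm v) ->
  e1 = T2 *m e2 -> e2 = T1 *m e1 -> e1 = 0 /\ e2 = 0.
Proof.
move=> g1 h1 h2 E1 E2.
have n1e : l2norm e1 = 0.
  have := h1 e1; rewrite -E2; have := h2 e2; rewrite -E1.
  by have := l2norm_ge0 e1; nra.
have e10 := l2norm_eq0 n1e.
by split=> //; rewrite E2 e10 mulmx0.
Qed.

Variables (n m l k : nat).
Variables (A1 : 'M[C]_n) (B1 : 'M[C]_(n, k)) (C1 : 'M[C]_(l, n)) (D1 : 'M[C]_(l, k)).
Variables (A2 : 'M[C]_m) (B2 : 'M[C]_(m, l)) (C2 : 'M[C]_(k, m)) (D2 : 'M[C]_(k, l)).

Lemma loop_feedthrough_unit : 1%:M - D1 *m D2 \in unitmx ->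
  1%:M - block_mx 0 D2 D1 0 \in unitmx.
Proof.
move=> u; apply: unitmx_of_ker => v; rewrite -[v]vsubmxK.
move: (usubmx v) (dsubmx v) => e1 e2.
rewrite mulmxBl mul1mx mul_block_col !mul0mx add0r addr0 opp_col_mx add_col_mx -col_mx0.
move=> /eq_col_mx[/eqP + /eqP]; rewrite !subr_eq0 => /eqP E1 /eqP E2.
have : (1%:M - D1 *m D2) *m e2 = 0 by rewrite mulmxBl mul1mx -mulmxA -E1 -E2 subrr.
move=> /(congr1 (mulmx (invmx (1%:M - D1 *m D2)))); rewrite mulKmx // mulmx0 => e20.
by rewrite E1 e20 mulmx0.
Qed.

Variable g : R.
Hypotheses (g0 : 0 <= g) (g1 : g < 1) (hA1 : hurwitzm A1) (hA2 : hurwitzm A2).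
Hypothesis gain1 : forall (w : R) v, l2norm (transfer A1 B1 C1 D1 (0 +i* w)%C *m v) <=
  g * l2norm v.
Hypothesis gain2 : forall (w : R) v, l2norm (transfer A2 B2 C2 D2 (0 +i* w)%C *m v) <=
  1 * l2norm v.

Lemma small_gain_well_posed : 1%:M - D1 *m D2 \in unitmx.
Proof.
apply: unitmx_of_ker => v; rewrite mulmxBl mul1mx => /eqP; rewrite subr_eq0 => /eqP E.
have [] // := @small_gain_loop _ _ D1 D2 g (D2 *m v) v g1.
- exact: gain_feedthrough hA1 gain1.
- by move=> u; have := gain_feedthrough hA2 gain2 u; rewrite mul1r.
- by rewrite mulmxA.
Qed.

(** By the maximum principle the loop gain is less than 1 throughout the closed
    right half-plane, so a closed-loop mode there must vanish: closing the loop
    keeps stability, and bounded inputs have bounded effects. *)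
Lemma small_gain_bounded (w1 e1 : R -> 'cV[C]_k) (w2 e2 : R -> 'cV[C]_l) x1 x2 (M : R) :
  vright_cont x1 0 -> vright_cont x2 0 ->
  (forall t, 0 < t -> vderive x1 t (A1 *m x1 t + B1 *m e1 t)) ->
  (forall t, 0 < t -> vderive x2 t (A2 *m x2 t + B2 *m e2 t)) ->
  (forall t, 0 <= t -> e1 t = w1 t + (C2 *m x2 t + D2 *m e2 t)) ->
  (forall t, 0 <= t -> e2 t = w2 t + (C1 *m x1 t + D1 *m e1 t)) ->
  (forall t, 0 <= t -> sum_norm (w1 t) <= M) -> (forall t, 0 <= t -> sum_norm (w2 t) <= M) ->
  exists K : R, forall t, 0 <= t ->
    [/\ sum_norm (x1 t) <= K, sum_norm (x2 t) <= K, sum_norm (e1 t) <= K & sum_norm (e2 t) <= K].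
Proof.
move=> c1 c2 d1 d2 E1 E2 b1 b2.
pose A := block_mx A1 0 0 A2; pose B := block_mx B1 0 0 B2.
pose Cs := block_mx 0 C2 C1 0; pose Ds := block_mx 0 D2 D1 0.
have uD : 1%:M - Ds \in unitmx by apply: loop_feedthrough_unit; exact: small_gain_well_posed.
pose E := invmx (1%:M - Ds).
pose x t := col_mx (x1 t) (x2 t); pose e t := col_mx (e1 t) (e2 t).
pose w t := col_mx (w1 t) (w2 t).
have solE u y : u = y + Ds *m u -> u = E *m y.
  move=> h; have : (1%:M - Ds) *m u = y by rewrite mulmxBl mul1mx {1}h addrK.
  by move=> <-; rewrite mulKmx.
have eE t : 0 <= t -> e t = E *m (w t + Cs *m x t).
  move=> t0; apply: solE.
  rewrite /e /w /x !mul_block_col !mul0mx !add0r !addr0 !add_col_mx.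
  by congr col_mx; rewrite -?addrA; [exact: E1|exact: E2].
pose Acl := A + B *m E *m Cs.
have hAcl : hurwitzm Acl.
  move=> s v s0 Ev; pose f := E *m Cs *m v.
  have fE : f = Cs *m v + Ds *m f.
    have : (1%:M - Ds) *m f = Cs *m v by rewrite /f -mulmxA mulKVmx.
    by rewrite mulmxBl mul1mx => <-; rewrite subrK.
  have vE : A *m v + B *m f = s *: v by rewrite -Ev /Acl mulmxDl /f !mulmxA.
  move: fE vE; rewrite -[v]vsubmxK -[f]vsubmxK.
  move: (usubmx v) (dsubmx v) (usubmx f) (dsubmx f) => v1 v2 f1 f2.
  rewrite !mul_block_col !mul0mx !add0r !addr0 !add_col_mx scale_col_mx.
  move=> /eq_col_mx[F1 F2] /eq_col_mx[V1 V2].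
  have [X1 Y1] := eigen_transfer C1 D1 (hurwitz_unit hA1 s0) V1.
  have [X2 Y2] := eigen_transfer C2 D2 (hurwitz_unit hA2 s0) V2.
  have [||||f10 f20] := @small_gain_loop _ _ (transfer A1 B1 C1 D1 s)
     (transfer A2 B2 C2 D2 s) g f1 f2 g1.
  - by move=> u; apply: gain_half_plane.
  - by move=> u; have := @gain_half_plane _ _ _ _ A2 B2 C2 D2 1 hA2 ler01 gain2 s u s0;
      rewrite mul1r.
  - by rewrite -Y2.
  - by rewrite -Y1.
  by rewrite X1 X2 f10 f20 !mulmx0 col_mx0.
have [K hK] : exists K : R, forall t, 0 <= t -> sum_norm (x t) <= K.
  apply: (@bounded_response _ _ Acl x (fun t => B *m E *m w t)
    (sum_norm (B *m E) * (M + M))) => //.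
  - exact: vright_cont_col.
  - move=> t t0; have -> : Acl *m x t + B *m E *m w t =
        col_mx (A1 *m x1 t + B1 *m e1 t) (A2 *m x2 t + B2 *m e2 t).
      transitivity (A *m x t + B *m e t).
        rewrite eE ?ltW // /Acl mulmxDl -addrA [X in _ + X]addrC.
        by rewrite !mulmxDr !mulmxA.
      by rewrite !mul_block_col !mul0mx !add0r !addr0 add_col_mx.
    by apply: vderive_col; [exact: d1|exact: d2].
  - move=> t t0; apply: le_trans (sum_normM _ _) _; rewrite ler_wpM2l ?sum_norm_ge0 //.
    by rewrite /w sum_norm_col lerD ?b1 ?b2 ?ltW.
exists (K + sum_norm E * (M + M + sum_norm Cs * K)) => t t0.
have K0 : 0 <= K := le_trans (sum_norm_ge0 _) (hK _ t0).
have M0 : 0 <= M := le_trans (sum_norm_ge0 _) (b1 _ t0).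
have be : sum_norm (e t) <= sum_norm E * (M + M + sum_norm Cs * K).
  rewrite eE //; apply: le_trans (sum_normM _ _) _; rewrite ler_wpM2l ?sum_norm_ge0 //.
  apply: le_trans (sum_normD _ _) _; apply: lerD; first by rewrite /w sum_norm_col lerD ?b1 ?b2.
  by apply: le_trans (sum_normM _ _) _; rewrite ler_wpM2l ?sum_norm_ge0 // hK.
have := hK _ t0; rewrite /x sum_norm_col => bx; rewrite /e sum_norm_col in be.
have := sum_norm_ge0 (x1 t); have := sum_norm_ge0 (x2 t); have := sum_norm_ge0 (e1 t);
  have := sum_norm_ge0 (e2 t).
by split; lra.
Qed.

End ClosedLoop.

(** * The gain over all frequencies *)

Section Worst.
Variable R : realType.
Local Notation C := R[i].

Lemma specnorm_gain_lt m n (M : 'M[C]_(m, n)) (g : R) : (0 < n)%N ->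
  (forall v, v != 0 -> l2norm (M *m v) < g * l2norm v) -> specnorm M < g.
Proof.
move=> /(specnormP M)[_ [v v0 E]] h; have := h v v0.
by rewrite E ltr_pM2r // l2norm_gt0.
Qed.

Lemma specnorm_perturb m n (M N : 'M[C]_(m, n)) : (0 < n)%N ->
  specnorm M <= specnorm N + sum_norm (M - N).
Proof.
move=> n0; apply: specnorm_le => // v; rewrite -{1}(subrK N M) mulmxDl addrC.
apply: le_trans (l2normD _ _) _; rewrite mulrDl; apply: lerD; last exact: l2norm_mul.
by have [h _] := specnormP N n0.
Qed.

(** On the extended imaginary axis the gain is continuous, so that its least upper
    bound is less than 1 as soon as all its values, including the one at
    infinity, are. *)
Lemma uniform_gain n m p (A : 'M[C]_n) (B : 'M[C]_(n, m)) (Co : 'M[C]_(p, n))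
    (D : 'M[C]_(p, m)) : (0 < m)%N -> hurwitzm A ->
  (forall (w : R) v, v != 0 -> l2norm (transfer A B Co D (0 +i* w)%C *m v) < l2norm v) ->
  (forall v, v != 0 -> l2norm (D *m v) < l2norm v) ->
  exists2 g : R, 0 <= g < 1 &
    forall w : R, specnorm (transfer A B Co D (0 +i* w)%C) <= g.
Proof.
move=> m0 hA hT hD; pose T (w : R) := transfer A B Co D (0 +i* w)%C.
pose f (w : R) := specnorm (T w).
have u (w : R) : (0 +i* w)%C%:M - A \in unitmx by apply: hurwitz_unit => //=.
have f1 w : f w < 1 by apply: specnorm_gain_lt => // v v0; rewrite mul1r; exact: hT.
have d1 : specnorm D < 1 by apply: specnorm_gain_lt => // v v0; rewrite mul1r; exact: hD.
have fc : continuous f.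
  move=> w; apply/cvgrPdist_le => e e0.
  pose r := sum_norm (resolvent A (0 +i* w)%C); have r0 : 0 <= r := sum_norm_ge0 _.
  pose K := sum_norm Co * (2 * r ^+ 2) * sum_norm B.
  have K0 : 0 <= K by rewrite !mulr_ge0 ?sum_norm_ge0 ?sqr_ge0.
  have hK t : `|w - t| * r <= 1 / 2 -> sum_norm (T t - T w) <= `|w - t| * K.
    move=> wt; rewrite /T /transfer opprD addrACA subrr add0r.
    rewrite -mulmxBl -mulmxBr.
    have := @resolvent_lipschitz _ _ A (0 +i* w)%C (0 +i* t)%C (u w) (u t).
    have -> : nc ((0 +i* t)%C - (0 +i* w)%C) = `|w - t|.
      by rewrite distrC -nc_imag; congr nc; apply/eqP; rewrite eq_complex /= subr0 !eqxx.
    move=> /(_ wt) h; apply: le_trans (sum_normM _ _) _.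
    have -> : `|w - t| * K = sum_norm Co * (`|w - t| * (2 * r ^+ 2)) * sum_norm B.
      by rewrite /K; ring.
    apply: (@le_trans _ _ (sum_norm Co *
      sum_norm (resolvent A (0 +i* t)%C - resolvent A (0 +i* w)%C) * sum_norm B)).
      by rewrite ler_wpM2r ?sum_norm_ge0 // sum_normM.
    by rewrite ler_wpM2r ?sum_norm_ge0 // ler_wpM2l ?sum_norm_ge0.
  have hf t : `|w - t| * r <= 1 / 2 -> `|f w - f t| <= `|w - t| * K.
    move=> /hK h; rewrite ler_norml; apply/andP; split.
      rewrite lerNl opprB lerBlDl.
      exact: le_trans (specnorm_perturb _ (T w) m0) (lerD (lexx _) h).
    rewrite lerBlDl; apply: le_trans (specnorm_perturb _ (T t) m0) (lerD (lexx _) _).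
    by rewrite -sum_normN opprB.
  pose d := Num.min (1 / (2 * (r + 1))) (e / (K + 1)).
  have d0 : 0 < d.
    by rewrite lt_min !divr_gt0 // ?mulr_gt0 // ltr_wpDl.
  near=> t.
  have : `|w - t| < d by near: t; apply: cvgr_dist_lt => //; exact: cvg_id.
  rewrite lt_min => /andP[]; rewrite !ltr_pdivlMr ?mulr_gt0 ?ltr_wpDl // => h1 h2.
  have a0 := normr_ge0 (w - t).
  apply: le_trans (hf t _) _; first by nra.
  by nra.
have [K [W [K0 W0 hK]]] := transfer_infty A B Co D.
pose g0 := (1 + specnorm D) / 2.
have g0d : specnorm D < g0 by rewrite /g0; lra.
have g01 : g0 < 1 by rewrite /g0; lra.
(* Beyond [W1] the gain exceeds that of [D] by at most half the distance of the
   latter to 1. *)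
pose W1 := W + K / (g0 - specnorm D).
have W10 : 0 < W1 by rewrite ltr_wpDr // divr_ge0 // subr_ge0 ltW.
have far w : W1 <= `|w| -> f w <= g0.
  move=> hw; apply: le_trans (specnorm_perturb _ D m0) _; rewrite -lerBrDl.
  have := hK (0 +i* w)%C (u w); rewrite nc_imag.
  have WW : W <= `|w| by apply: le_trans hw; rewrite lerDl divr_ge0 // subr_ge0 ltW.
  move=> /(_ WW) h; have w0 : 0 < `|w| by exact: lt_le_trans hw.
  rewrite -(ler_pM2l w0); apply: le_trans h _.
  rewrite -ler_pdivrMr ?subr_gt0 //; apply: le_trans hw.
  by rewrite lerDr ltW.
have [||c _ hc] := @EVT_max _ f (- W1) W1.
- by rewrite ge0_cp // ltW.
- exact: continuous_subspaceT.
exists (Num.max g0 (f c)).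
  by rewrite le_max gt_max f1 g01 !andbT; apply/orP; right; exact: specnorm_ge0.
move=> w; rewrite le_max; have [h|h] := leP W1 `|w|; first by rewrite far.
apply/orP; right; apply: hc; rewrite in_itv /=.
by move: h; rewrite ltr_norml => /andP[h1 h2]; rewrite !ltW.
Unshelve. all: by end_near. Qed.

(** * A resonant open-loop experiment *)

(** The input [t e^(i w t) v] is answered, from rest and up to a bounded error, by
    [t e^(i w t) G(i w) v]: the remainder of the state solves a stable equation
    with bounded input. *)
Lemma resonant_response n m p (A : 'M[C]_n) (B : 'M[C]_(n, m)) (Co : 'M[C]_(p, n))
    (D : 'M[C]_(p, m)) (w : R) (v : 'cV[C]_m) : hurwitzm A ->
  let e t := (t%:C%C * cis w t) *: v in
  exists x : R -> 'cV[C]_n, [/\ x 0 = 0, forall t, vderive x t (A *m x t + B *m e t) &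
    exists K : R, forall t, 0 <= t ->
      sum_norm (Co *m x t + D *m e t -
          (t%:C%C * cis w t) *: (transfer A B Co D (0 +i* w)%C *m v)) <= K].
Proof.
move=> hA e; set s := (0 +i* w)%C.
have u : s%:M - A \in unitmx by apply: hurwitz_unit => //=.
(* [x0] is the state amplitude at frequency [w]; [z0] makes [e^(i w t) z0] a solution
   of the equation of the remainder, and [E] corrects its initial value. *)
pose x0 := resolvent A s *m B *m v; pose z0 := - (resolvent A s *m x0).
have Ax0 : A *m x0 + B *m v = s *: x0.
  have : (s%:M - A) *m x0 = B *m v by rewrite /x0 -mulmxA mulmxA mulmxV // mul1mx.
  by move=> <-; rewrite mulmxBl mul_scalar_mx addrC subrK.
have Az0 : A *m z0 = s *: z0 + x0.
  have : (s%:M - A) *m z0 = - x0 by rewrite /z0 mulmxN mulmxA mulmxV // mul1mx.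
  rewrite mulmxBl mul_scalar_mx => /eqP; rewrite subr_eq => /eqP ->.
  by rewrite addrAC addNr add0r.
have [E [E0 dE]] := linear_ode_solution A z0.
pose z t := cis w t *: z0 + (-1) *: E t.
pose x t := (t%:C%C * cis w t) *: x0 + z t.
have vZ n' (h : R -> C) t d (y : 'cV[C]_n') : cderive h t d ->
  vderive (fun r => h r *: y) t (d *: y).
  move=> hd i; rewrite mxE; apply: (@cderive_ext _ (fun r => y i 0 * h r)).
    by move=> r; rewrite mxE mulrC.
  by rewrite mulrC; apply: cderiveZ.
have vD n' (h k : R -> 'cV[C]_n') t d d' : vderive h t d -> vderive k t d' ->
    vderive (fun r => h r + k r) t (d + d').
  move=> hd kd i; rewrite mxE; apply: (@cderive_ext _ (fun r => h r i 0 + k r i 0)).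
    by move=> r; rewrite mxE.
  by apply: cderiveD.
have dz t : vderive z t (A *m z t + (- cis w t) *: x0).
  have -> : A *m z t + (- cis w t) *: x0 = (s * cis w t) *: z0 + (-1) *: (A *m E t).
    rewrite mulmxDr -!scalemxAr Az0; move: (A *m E t) => F.
    by apply/matrixP => i j; rewrite !mxE; ring.
  apply: vD; first by apply: vZ; exact: cderive_cis.
  by move=> i; rewrite mxE; apply: (@cderive_ext _ (fun r => -1 * E r i 0)) => [r|];
    [rewrite mxE|apply: cderiveZ; exact: dE].
have dx t : vderive x t (A *m x t + B *m e t).
  have -> : A *m x t + B *m e t =
     (1 * cis w t + t%:C%C * (s * cis w t)) *: x0 + (A *m z t + (- cis w t) *: x0).
    rewrite /x /e mulmxDr -!scalemxAr addrAC -scalerDr Ax0.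
    move: (A *m z t) => F.
    by apply/matrixP => i j; rewrite !mxE; ring.
  apply: vD => //; apply: vZ; apply: cderiveM; first exact: cderive_real.
  exact: cderive_cis.
have [K hK] : exists K : R, forall t, 0 <= t -> sum_norm (z t) <= K.
  apply: (@bounded_response _ _ A z (fun t => (- cis w t) *: x0) (sum_norm x0)) => //.
    by move=> i; exact: cderive_right_cont (dz 0 i).
  by move=> t _; rewrite sum_normZ ncN nc_cis mul1r.
exists x; split=> //.
  rewrite /x /z E0 /cis !mulr0 cos0 sin0 mul0r scale0r add0r scaleN1r.
  by rewrite scale1r subrr.
exists (sum_norm Co * K) => t t0.
have -> : Co *m x t + D *m e t - (t%:C%C * cis w t) *: (transfer A B Co D s *m v) = Co *m z t.
  rewrite /x /e /transfer mulmxDr mulmxDl -!scalemxAr scalerDr !mulmxA.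
  move: (D *m v) (Co *m z t) (Co *m resolvent A s *m B *m v) => P1 P2 P3.
  by apply/matrixP => i j; rewrite !mxE; ring.
by apply: le_trans (sum_normM _ _) _; rewrite ler_wpM2l ?sum_norm_ge0 // hK.
Qed.

End Worst.

(** * Restriction to the base field *)

Section Interpolation.
Variable R : realType.
Local Notation C := R[i].

(** The solutions of equations with coefficients in the base field are mapped to
    solutions over that field by this additive projection, which commutes with
    multiplication by elements of the field. *)
Definition base_part (F : base_field) (z : C) : C := if F is RealField then (Re z)%:C%C else z.

Lemma base_part_over F z : base_part F z \in @scalars R F.
Proof. by case: F => //=; rewrite inE. Qed.

Lemma base_part0 F : base_part F 0 = 0. Proof. by case: F. Qed.

Lemma base_partD F x y : base_part F (x + y) = base_part F x + base_part F y.
Proof. by case: F => //=; rewrite ReD (rmorphD (real_complex R)). Qed.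

Lemma base_partM F a x : a \in @scalars R F -> base_part F (a * x) = a * base_part F x.
Proof.
case: F => //=; case: a x => [a b] [c d]; rewrite inE /= => /eqP ->.
by apply/eqP; rewrite eq_complex /= !mul0r mulr0 subr0 addr0 !eqxx.
Qed.

Lemma nc_base_part F x : nc (base_part F x) <= nc x.
Proof. by case: F => //; rewrite /base_part ncR nc_Re. Qed.

Lemma cderive_base_part F (f : R -> C) t d : cderive f t d ->
  cderive (fun r => base_part F (f r)) t (base_part F d).
Proof. by case: F => //= -[f1 f2]; split => //=; exact: is_derive_cst. Qed.

Lemma base_part_sum F (I : finType) (f : I -> C) :
  base_part F (\sum_i f i) = \sum_i base_part F (f i).
Proof. by elim/big_rec2: _ => [|i a b _ <-]; rewrite ?base_part0 ?base_partD. Qed.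

Definition base_part_mx F m n (M : 'M[C]_(m, n)) := map_mx (base_part F) M.

Lemma base_part_mxD F m n (M N : 'M[C]_(m, n)) : base_part_mx F (M + N) =
  base_part_mx F M + base_part_mx F N.
Proof. by apply/matrixP => i j; rewrite !mxE base_partD. Qed.

Definition mx_over F m n (M : 'M[C]_(m, n)) := forall i j, M i j \in @scalars R F.

Lemma base_part_mx_mul F m n p (A : 'M[C]_(m, n)) (B : 'M[C]_(n, p)) : mx_over F A ->
  base_part_mx F (A *m B) = A *m base_part_mx F B.
Proof.
move=> hA; apply/matrixP => i j; rewrite !mxE base_part_sum; apply: eq_bigr => k _.
by rewrite base_partM // mxE.
Qed.

Lemma sum_norm_base_part_mx F m n (M : 'M[C]_(m, n)) : sum_norm (base_part_mx F M) <= sum_norm M.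
Proof. by apply: ler_sum => i _; apply: ler_sum => j _; rewrite mxE nc_base_part. Qed.

(** The phase [w t] cannot keep the real part of [e^(i w t) c] small: a quarter
    of a period later it has become, up to sign, the imaginary part. *)
Lemma oscillation_unbounded F (w : R) (c : C) (M : R) : c != 0 ->
  (F = RealField -> w = 0 -> Im c = 0) ->
  ~ (forall t, 0 <= t -> nc (base_part F (t%:C%C * cis w t * c)) <= M).
Proof.
rewrite -nc_gt0 => c0 hF h.
have M0 : 0 <= M by apply: le_trans (h 0 (lexx _)); exact: nc_ge0.
pose t := (2 * M + 1) / nc c.
have t0 : 0 < t by rewrite divr_gt0 // ltr_wpDl // mulr_ge0.
have tc : t * nc c = 2 * M + 1 by rewrite divfK // gt_eqF.
have E s : 0 <= s -> nc (s%:C%C * cis w s * c) = s * nc c.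
  by move=> s0; rewrite !ncM nc_cis ncR ger0_norm // mulr1.
case: F hF h => [hF h|_ h]; last first.
  by have := h t (ltW t0); rewrite /= E ?(ltW t0) // tc; lra.
pose zt s := cis w s * c.
have hRe s : 0 <= s -> s * `|Re (zt s)| <= M.
  move=> s0; have := h s s0; rewrite /base_part ncR -mulrA -/(zt s) ReM /= mul0r subr0.
  by rewrite normrM ger0_norm.
have [w0|w0] := eqVneq w 0.
  have := hRe t (ltW t0); rewrite /zt w0 /cis mul0r cos0 sin0 ReM /= mul1r mul0r subr0.
  have -> : `|Re c| = nc c.
    have := nc_ReIm c; rewrite (hF erefl w0) normr0 addr0 => h1.
    by apply/eqP; rewrite eq_le h1 nc_Re.
  by rewrite tc; lra.
have aw0 : 0 < `|w| by rewrite normr_gt0.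
pose t' := t + pi / (2 * `|w|).
have tt' : t <= t' by rewrite lerDl divr_ge0 ?pi_ge0 // mulr_ge0.
have Im1 : `|Re (zt t')| = `|Im (zt t)|.
  have [wp|wn] := ltP 0 w.
    have wt' : w * t' = w * t + pi / 2.
      by rewrite /t' gtr0_norm // mulrDr; congr (_ + _); field; rewrite gt_eqF.
    rewrite /zt /cis ReM ImM /= wt' cosDpihalf sinDpihalf.
    by rewrite -normrN; congr `| _ |; ring.
  have wt' : w * t' = w * t - pi / 2.
    rewrite /t' ler0_norm // mulrDr; congr (_ + _); by field.
  rewrite /zt /cis ReM ImM /= wt' cosBpihalf sinBpihalf.
  by congr `| _ |; ring.
have h1 := hRe t (ltW t0); have h2 := hRe t' (le_trans (ltW t0) tt').
have : t * `|Im (zt t)| <= M.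
  by rewrite -Im1; apply: le_trans h2; rewrite ler_wpM2r.
have : t * nc (zt t) <= t * (`|Re (zt t)| + `|Im (zt t)|).
  by rewrite ler_wpM2l ?(ltW t0) // nc_ReIm.
rewrite /zt ncM nc_cis mul1r tc -/(zt t); lra.
Qed.

(** A real matrix acts separately on real and imaginary parts, one of which is
    not contracted. *)
Lemma expanding_real_vector m n (M : 'M[C]_(m, n)) (v : 'cV[C]_n) :
  mx_over RealField M -> v != 0 -> l2norm v <= l2norm (M *m v) ->
  exists v', [/\ mx_over RealField v', v' != 0 & l2norm v' <= l2norm (M *m v')].
Proof.
move=> hM v0 hv.
pose a := base_part_mx RealField v; pose b := base_part_mx RealField (- 'i%C *: v).
have ha : mx_over RealField a by move=> i j; rewrite mxE; exact: base_part_over.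
have hb : mx_over RealField b by move=> i j; rewrite mxE; exact: base_part_over.
have sq k (u : 'cV[C]_k) : l2norm u ^+ 2 =
    l2norm (base_part_mx RealField u) ^+ 2 + l2norm (base_part_mx RealField (- 'i%C *: u)) ^+ 2.
  rewrite !sqr_l2norm -big_split /=; apply: eq_bigr => i _.
  rewrite !mxE !ncR !real_normK ?num_real // sqr_nc; case: (u i 0) => x y /=.
  by congr (_ + _); ring.
have E := sq _ v; have E' := sq _ (M *m v).
rewrite scalemxAr !base_part_mx_mul // in E'; rewrite -/a -/b in E E'.
have hv2 : l2norm v ^+ 2 <= l2norm (M *m v) ^+ 2 by rewrite lerXn2r ?nnegrE ?l2norm_ge0.
rewrite E E' in hv2.
have sqle k l (u : 'cV[C]_k) (u' : 'cV[C]_l) : (l2norm u ^+ 2 <=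
  l2norm u' ^+ 2) = (l2norm u <= l2norm u').
  by rewrite ler_pXn2r ?nnegrE ?l2norm_ge0.
have [a0|a0] := eqVneq a 0.
  exists b; split=> //.
    apply: contraNneq v0 => b0; apply/eqP; apply: l2norm_eq0; apply/eqP.
    by rewrite -[_ == 0](@expf_eq0 _ _ 2) E a0 b0 !l2norm_0 expr0n addr0.
  by move: hv2; rewrite a0 mulmx0 !l2norm_0 expr0n !add0r sqle.
have [h|h] := leP (l2norm a) (l2norm (M *m a)); first by exists a.
have hlt : l2norm (M *m a) ^+ 2 < l2norm a ^+ 2 by rewrite ltrXn2r ?nnegrE ?l2norm_ge0.
have hb2 : l2norm b ^+ 2 < l2norm (M *m b) ^+ 2 by lra.
exists b; split=> //.
  by apply: contraTneq hb2 => ->; rewrite mulmx0 !l2norm_0 ltxx.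
by rewrite -sqle ltW.
Qed.

(** * Interpolation by all-pass functions *)

(** The modulus of [r (s - a) / (s + a) = r - 2 r a / (s + a)] is constant on the
    imaginary axis, and for [w != 0] its argument at [i w] takes any value but
    those of the real numbers, for which a constant will do. *)
Lemma allpass_interpolation F (w : R) (z : C) :
  (F = RealField -> w = 0 -> Im z = 0) ->
  exists r c (a : R), [/\ r \in @scalars R F, c \in @scalars R F, 0 < a,
    r + c / ((0 +i* w)%C + a%:C%C) = z &
    forall t : R, nc (r + c / ((0 +i* t)%C + a%:C%C)) = nc z].
Proof.
move=> hF.
have triv : z \in @scalars R F -> exists r c (a : R), [/\ r \in @scalars R F,
  c \in @scalars R F, 0 < a,
    r + c / ((0 +i* w)%C + a%:C%C) = z &
    forall t : R, nc (r + c / ((0 +i* t)%C + a%:C%C)) = nc z].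
  move=> hz; exists z, 0, 1; split=> //.
  - by case: (F) => //=; rewrite inE.
  - by rewrite mul0r addr0.
  - by move=> t; rewrite mul0r addr0.
have [/triv //|zF] := boolP (z \in @scalars R F).
case: F hF zF {triv} => // hF; rewrite inE /= => y0.
have w0 : w != 0 by apply: contraNneq y0 => w0; rewrite hF.
case: z y0 hF => [x y] /= y0 hF.
pose N := nc (x +i* y)%C.
have N2 : N ^+ 2 = x ^+ 2 + y ^+ 2 by rewrite sqr_nc.
have N0 : 0 <= N by exact: nc_ge0.
have y2 : 0 < y ^+ 2 by rewrite exprn_even_gt0.
have [r [a [rN a0 E1 E2]]] : exists r a : R,
   [/\ `|r| = N, 0 < a, - r * a = x * a - y * w & r * w = x * w + y * a].
  have aux r : r ^+ 2 = N ^+ 2 -> 0 < (y * w) / (r + x) -> r + x != 0 ->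
     exists r a : R, [/\ `|r| = N, 0 < a, - r * a = x * a - y * w & r * w = x * w + y * a].
    move=> r2 a0 rx; exists r, (y * w / (r + x)); split=> //.
    - apply/eqP; rewrite -(eqrXn2 (_ : 0 < 2)%N) //; apply/eqP.
      by rewrite real_normK ?num_real.
    - by field.
    - have : r ^+ 2 - x ^+ 2 = y ^+ 2 by rewrite r2 N2 addrC addKr.
      move=> H; apply: (mulIf rx); rewrite mulrDl [_ * _ * (r + x)](_ : _ =
        w * y ^+ 2 + x * w * (r + x)).
        by rewrite addrC; congr (_ + _); field.
      by rewrite -H; ring.
  have xN : `|x| < N.
    rewrite -(ltr_pXn2r (_ : 0 < 2)%N) ?nnegrE // real_normK ?num_real // N2.
    by rewrite ltrDl.
  move: xN; rewrite ltr_norml => /andP[xN1 xN2].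
  have [yw|yw] := ltP 0 (y * w).
    by apply: (aux N) => //; [apply: divr_gt0 => //; lra|rewrite gt_eqF //; lra].
  have yw' : y * w < 0 by rewrite lt_neqAle yw andbT mulf_neq0.
  apply: (aux (- N)); first by rewrite sqrrN.
    by rewrite -(mulrNN (y * w)) -invrN divr_gt0 ?oppr_gt0 //; lra.
  by rewrite lt_eqF //; lra.
have na t : (0 +i* t)%C + a%:C%C != 0 :> C.
  by rewrite eq_complex /= add0r negb_and gt_eqF.
have fE t : r%:C%C + (- (2 * r * a))%:C%C / ((0 +i* t)%C + a%:C%C) =
   (r%:C%C * ((0 +i* t)%C - a%:C%C)) / ((0 +i* t)%C + a%:C%C) :> C.
  apply: (mulIf (na t)); rewrite divfK // mulrDl divfK //.
  by apply/eqP; rewrite eq_complex /=; apply/andP; split; apply/eqP; ring.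
exists r%:C%C, (- (2 * r * a))%:C%C, a; split=> //; try by rewrite inE /= eqxx.
- rewrite fE; apply: (mulIf (na w)); rewrite divfK //.
  apply/eqP; rewrite eq_complex /=; apply/andP; split; apply/eqP; lra.
- move=> t; rewrite fE ncM ncV ncM ncR rN -/N.
  have -> : nc ((0 +i* t)%C - a%:C%C : C) = nc ((0 +i* t)%C + a%:C%C : C).
    by rewrite /= !add0r sqrrN subr0 addr0.
  by rewrite mulfK // gt_eqF // nc_gt0 na.
Qed.

Lemma frobenius_gain m n (M : 'M[C]_(m, n)) (v : 'cV[C]_n) :
  \sum_i \sum_j nc (M i j) ^+ 2 <= 1 -> l2norm (M *m v) <= l2norm v.
Proof.
move=> h; apply: le_l2norm; first exact: l2norm_ge0.
apply: (@le_trans _ _ (\sum_i (\sum_j nc (M i j) ^+ 2) * l2norm v ^+ 2)); last first.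
  by rewrite -mulr_suml ler_piMl // sqr_ge0.
apply: ler_sum => i _; rewrite mxE sqr_l2norm.
apply: le_trans (cauchy_schwarz_sum _ _).
rewrite lerXn2r ?nnegrE ?nc_ge0 //.
  by rewrite sumr_ge0 // => j _; rewrite mulr_ge0 ?nc_ge0.
apply: le_trans (nc_sum _ _ _) _; apply: ler_sum => j _.
by rewrite ncM.
Qed.

End Interpolation.

(** * Rational functions in lowest terms *)

Section Rational.
Variable R : realType.
Local Notation C := R[i].
Implicit Types (r : {fraction {poly C}}) (p q : {poly C}).

Lemma frac_repr r : r * FracField.tofrac (frac (repr r)).2 = FracField.tofrac (frac (repr r)).1.
Proof.
unlock FracField.tofrac; rewrite -{1}[r]reprK -[LHS]FracField.pi_mul; apply/eqmodP => /=.
rewrite FracField.equivfE /FracField.mulf !numden_Ratio ?mulf_neq0 ?oner_neq0 ?denom_ratioP //.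
by rewrite !mulr1 mulrC.
Qed.

Lemma rnum_rden_frac p q r : q != 0 ->
  r = FracField.tofrac p / FracField.tofrac q ->
  [/\ rnum r * q = rden r * p, coprimep (rnum r) (rden r) & rden r != 0].
Proof.
move=> q0 rE; have := frac_repr r; rewrite /rnum /rden.
have d0 := denom_ratioP (repr r).
case: (frac (repr r)) d0 => n d /= d0.
have g0 : gcdp n d != 0 by rewrite gcdp_eq0 negb_and d0 orbT.
have nE : n %/ gcdp n d * gcdp n d = n by rewrite divpK // dvdp_gcdl.
have dE : d %/ gcdp n d * gcdp n d = d by rewrite divpK // dvdp_gcdr.
move=> E; split.
- apply: (mulIf g0); rewrite mulrAC nE [in RHS]mulrAC dE.
  apply/eqP; rewrite -tofrac_eq !tofracM; apply/eqP; rewrite -E rE.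
  by rewrite mulrAC divfK ?tofrac_eq0 // mulrC.
- by apply: coprimep_div_gcd; rewrite d0 orbT.
- by apply: contraNneq d0 => h; rewrite -dE h mul0r.
Qed.

Lemma rden_frac_dvdp p q r : q != 0 ->
  r = FracField.tofrac p / FracField.tofrac q -> rden r %| q.
Proof.
move=> q0 rE; have [E cop _] := rnum_rden_frac q0 rE.
by rewrite -(Gauss_dvdpr _ (_ : coprimep (rden r) (rnum r))) 1?coprimep_sym // E dvdp_mulr.
Qed.

Lemma reval_frac p q r s : q.[s] != 0 ->
  r = FracField.tofrac p / FracField.tofrac q -> reval r s = p.[s] / q.[s].
Proof.
move=> qs rE; have q0 : q != 0 by apply: contraNneq qs => ->; rewrite horner0.
have [E _ _] := rnum_rden_frac q0 rE.
have ds : (rden r).[s] != 0.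
  by apply: contraNneq qs => h; have /dvdpP[t ->] := rden_frac_dvdp q0 rE;
    rewrite hornerM h mulr0.
rewrite /reval; apply/eqP; rewrite eqr_div //.
by rewrite -!hornerM E mulrC.
Qed.

Lemma pole_frac p q r s : q != 0 ->
  r = FracField.tofrac p / FracField.tofrac q -> pole r s -> root q s.
Proof.
move=> q0 rE; have /dvdpP[t ->] := rden_frac_dvdp q0 rE.
by rewrite rootM /pole => ->; rewrite orbT.
Qed.

Lemma proper_frac p q r : q != 0 -> (size p <= size q)%N ->
  r = FracField.tofrac p / FracField.tofrac q -> proper r.
Proof.
move=> q0 pq rE; have [E _ d0] := rnum_rden_frac q0 rE; rewrite /proper.
have [->|n0] := eqVneq (rnum r) 0; first by rewrite size_poly0.
have p0 : p != 0.
  by apply: contraNneq (mulf_neq0 n0 q0) => p0; rewrite E p0 mulr0.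
have := congr1 (fun u : {poly C} => size u) E; rewrite /= !size_mul //.
have := size_poly_gt0 q; have := size_poly_gt0 p; rewrite q0 p0.
move: pq; move: (size (rnum r)) (size (rden r)) (size p) (size q) => a b c d.
by lia.
Qed.

Lemma poly_right_lipschitz p (l : C) : exists2 K : R, 0 <= K &
  forall e : R, 0 <= e <= 1 -> nc (p.[l + e%:C%C] - p.[l]) <= K * e.
Proof.
have [q qE] : exists q, p \Po ('X + l%:P) - p.[l]%:P = q * 'X.
  have /factor_theorem[q qE] : root (p \Po ('X + l%:P) - p.[l]%:P) 0.
    by rewrite rootE !hornerE horner_comp !hornerE subrr.
  by exists q; rewrite qE subr0.
have [K K0 hK] := poly_growth (leqnSn (size q)).
exists (K * 2 ^+ size q); first by rewrite mulr_ge0 // exprn_ge0.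
move=> e /andP[e0 e1].
have -> : p.[l + e%:C%C] - p.[l] = q.[e%:C%C] * e%:C%C.
  have := congr1 (horner^~ e%:C%C) qE; rewrite !hornerE horner_comp !hornerE addrC.
  by move=> <-; rewrite [RHS]addrC [l + _]addrC.
rewrite ncM ncR ger0_norm // ler_wpM2r //; apply: le_trans (hK _) _.
rewrite ler_wpM2l // lerXn2r ?nnegrE ?addr_ge0 ?nc_ge0 // ncR ger0_norm //; lra.
Qed.

Lemma reval_bounded_right r (l : C) : stable r -> 0 <= Re l ->
  exists K d : R, 0 < d /\ forall e : R, 0 < e <= d -> nc (reval r (l + e%:C%C)) <= K.
Proof.
move=> hr l0.
have dl : (rden r).[l] != 0.
  apply/negP => h; have /hr : pole r l by rewrite /pole rootE.
  by rewrite ltNge l0.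
have [K K0 hK] := poly_right_lipschitz (rnum r) l.
have [K' K'0 hK'] := poly_right_lipschitz (rden r) l.
pose D := nc (rden r).[l]; have D0 : 0 < D by rewrite nc_gt0.
exists ((nc (rnum r).[l] + K) * (D / 2)^-1), (Num.min 1 (D / (2 * (K' + 1)))).
split; first by rewrite lt_min ltr01 divr_gt0 // mulr_gt0 // ltr_wpDl.
move=> e /andP[e0]; rewrite le_min => /andP[e1].
rewrite ler_pdivlMr; last by rewrite mulr_gt0 // ltr_wpDl.
move=> e2; have ei : 0 <= e <= 1 by rewrite ltW.
have {}hK := hK e ei; have {}hK' := hK' e ei.
rewrite /reval ncM ncV.
have h1 : nc (rnum r).[l + e%:C%C] <= nc (rnum r).[l] + K.
  rewrite -[X in nc X <= _](subrK (rnum r).[l]) addrC; apply: le_trans (ncD _ _) _.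
  by rewrite lerD2l; apply: le_trans hK _; rewrite ler_piMr.
have h2 : D / 2 <= nc (rden r).[l + e%:C%C].
  have : D <= nc (rden r).[l + e%:C%C] + nc ((rden r).[l + e%:C%C] - (rden r).[l]).
    by rewrite ncBC /D -[X in nc X <= _](subrK (rden r).[l + e%:C%C]) addrC ncD.
  by nra.
rewrite ler_pM ?nc_ge0 ?invr_ge0 ?nc_ge0 // lef_pV2 // posrE; last by rewrite divr_gt0.
by apply: lt_le_trans h2; rewrite divr_gt0.
Qed.

End Rational.

(** * Tensors as matrices *)

Section Flatten.
Variables (T : pzRingType) (N : nat).
Implicit Types I J K : 'I_N -> nat.

Definition unfold_mx I J (A : tensor T I J) : 'M[T]_(#|midx I|, #|midx J|) :=
  \matrix_(i, j) A (enum_val i, enum_val j).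

Definition fold_mx I J (M : 'M[T]_(#|midx I|, #|midx J|)) : tensor T I J :=
  [ffun p => M (enum_rank p.1) (enum_rank p.2)].

Definition one_idx : midx (@ones N) := [ffun=> ord0].

Lemma one_idxE (j : midx (@ones N)) : j = one_idx.
Proof. by apply/ffunP => k; rewrite ffunE; apply/val_inj; case: (j k) => [[]]. Qed.

Definition unfold_cv I (x : vtensor T I) : 'cV[T]_(#|midx I|) :=
  \col_i x (enum_val i, one_idx).

Definition fold_cv I (v : 'cV[T]_(#|midx I|)) : vtensor T I :=
  [ffun p => v (enum_rank p.1) 0].

Lemma sum_midx I (V : nmodType) (f : midx I -> V) :
  \sum_(i : midx I) f i = \sum_(i < #|midx I|) f (enum_val i).
Proof. by rewrite (reindex _ (onW_bij _ (@enum_val_bij (midx I)))). Qed.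

Lemma unfold_mxM I J K (A : tensor T I J) (B : tensor T J K) :
  unfold_mx (A * B)%T = unfold_mx A *m unfold_mx B.
Proof.
apply/matrixP => i j; rewrite !mxE ffunE sum_midx; apply: eq_bigr => k _.
by rewrite !mxE.
Qed.

Lemma unfold_mxD I J (A B : tensor T I J) : unfold_mx (A + B)%T = unfold_mx A + unfold_mx B.
Proof. by apply/matrixP => i j; rewrite !mxE ffunE. Qed.

Lemma unfold_mxB I J (A B : tensor T I J) : unfold_mx (A - B)%T = unfold_mx A - unfold_mx B.
Proof. by apply/matrixP => i j; rewrite !mxE ffunE. Qed.

Lemma unfold_mxZ I J a (A : tensor T I J) : unfold_mx (a *: A)%T = a *: unfold_mx A.
Proof. by apply/matrixP => i j; rewrite !mxE ffunE. Qed.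

Lemma unfold_mx1 I : unfold_mx (tid : tensor T I I) = 1%:M.
Proof. by apply/matrixP => i j; rewrite !mxE ffunE /= (inj_eq enum_val_inj). Qed.

Lemma unfold_mxK I J : cancel (@unfold_mx I J) (@fold_mx I J).
Proof. by move=> A; apply/ffunP => -[i j]; rewrite ffunE mxE !enum_rankK. Qed.

Lemma fold_mxK I J : cancel (@fold_mx I J) (@unfold_mx I J).
Proof. by move=> A; apply/matrixP => i j; rewrite mxE ffunE !enum_valK. Qed.

Lemma unfold_mx_inj I J : injective (@unfold_mx I J).
Proof. exact: can_inj (@unfold_mxK I J). Qed.

Lemma unfold_cvK I : cancel (@unfold_cv I) (@fold_cv I).
Proof. by move=> x; apply/ffunP => -[i j]; rewrite ffunE mxE enum_rankK -(one_idxE j). Qed.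

Lemma fold_cvK I : cancel (@fold_cv I) (@unfold_cv I).
Proof. by move=> v; apply/colP => i; rewrite mxE ffunE enum_valK. Qed.

Lemma unfold_cv_inj I : injective (@unfold_cv I).
Proof. exact: can_inj (@unfold_cvK I). Qed.

Lemma unfold_cvM I J (A : tensor T I J) (x : vtensor T J) :
  unfold_cv (A * x)%T = unfold_mx A *m unfold_cv x.
Proof.
apply/colP => i; rewrite !mxE ffunE sum_midx; apply: eq_bigr => k _.
by rewrite !mxE.
Qed.

Lemma unfold_cvD I (x y : vtensor T I) : unfold_cv (x + y)%T = unfold_cv x + unfold_cv y.
Proof. by apply/colP => i; rewrite !mxE ffunE. Qed.

Lemma unfold_cvZ I a (x : vtensor T I) : unfold_cv (a *: x)%T = a *: unfold_cv x.
Proof. by apply/colP => i; rewrite !mxE ffunE. Qed.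

Lemma unfold_cv0 I : unfold_cv (tzero : vtensor T I) = 0.
Proof. by apply/colP => i; rewrite !mxE ffunE. Qed.

Lemma is_tinv_unfold I (A X : tensor T I I) :
  is_tinv A X <-> unfold_mx A *m unfold_mx X = 1%:M /\ unfold_mx X *m unfold_mx A = 1%:M.
Proof.
rewrite -!unfold_mxM -unfold_mx1; split => [[-> ->] //|[h1 h2]].
by split; apply: unfold_mx_inj.
Qed.

Lemma card_midx_gt0 I : (forall k, 0 < I k)%N -> (0 < #|midx I|)%N.
Proof.
by move=> h; apply/card_gt0P; exists [ffun k => Ordinal (h k)].
Qed.

Lemma card_midxM I J : #|midx (fun k => I k * J k)%N| = #|{: midx I * midx J}|.
Proof.
have cm (H : 'I_N -> nat) : #|midx H| = (\prod_k H k)%N.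
  by rewrite card_dep_ffun foldrE big_map big_enum /=; apply: eq_bigr => k _; rewrite card_ord.
by rewrite card_prod !cm big_split.
Qed.

(** The state multi-indices of the perturbation built below stand for the entries of
    a tensor of size [I_1 x J_1 x ... x I_N x J_N]. *)
Definition pair_idx I J (m : midx (fun k => I k * J k)%N) : midx I * midx J :=
  enum_val (cast_ord (card_midxM I J) (enum_rank m)).

Lemma pair_idx_bij I J : bijective (@pair_idx I J).
Proof.
exists (fun p => enum_val (cast_ord (esym (card_midxM I J)) (enum_rank p))) => x.
  by rewrite /pair_idx enum_valK cast_ordK enum_rankK.
by rewrite /pair_idx enum_valK cast_ordKV enum_rankK.
Qed.

End Flatten.

Section Translation.
Variables (R : realType) (N : nat).
Implicit Types I J K : 'I_N -> nat.
Local Notation C := R[i].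

Lemma unfold_tconj I J (A : tensor C I J) : unfold_mx (tconj A) = adjm (unfold_mx A).
Proof. by apply/matrixP => i j; rewrite !mxE ffunE. Qed.

Lemma spectral_norm_unfold I J (A : tensor C I J) : spectral_norm A = specnorm (unfold_mx A).
Proof.
rewrite /spectral_norm /specnorm /lambda_max; congr (Num.sqrt (sup _)).
rewrite -unfold_tconj -unfold_mxM; apply/seteqP; split=> l /= [x [x0 xE]].
  exists (unfold_cv x); split; last by rewrite -unfold_cvM xE unfold_cvZ.
  by apply/eqP => h; apply: x0; apply: unfold_cv_inj; rewrite h unfold_cv0.
exists (fold_cv x); split.
  by move=> h; move/eqP: x0; apply; rewrite -[x]fold_cvK h unfold_cv0.
by apply: unfold_cv_inj; rewrite unfold_cvM unfold_cvZ !fold_cvK.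
Qed.

Lemma tensor_over_unfold F I J (A : tensor C I J) : tensor_over F A -> mx_over F (unfold_mx A).
Proof. by move=> h i j; rewrite mxE. Qed.

(** * Realizations *)

Section Realization.
Variables (I J : 'I_N -> nat) (S : realization R I J).

Definition sA := unfold_mx (rA S).
Definition sB := unfold_mx (rB S).
Definition sC := unfold_mx (rC S).
Definition sD := unfold_mx (rD S).
Definition stransfer := transfer sA sB sC sD.

Lemma realizes_transfer (G : transfer_tensor R I J) s : realizes S G ->
  s%:M - sA \in unitmx -> unfold_mx (teval G s) = stransfer s.
Proof.
move=> hS u; have := hS s (fold_mx (resolvent sA s)) => -> //.
  by rewrite unfold_mxD !unfold_mxM fold_mxK.
apply/is_tinv_unfold; rewrite fold_mxK unfold_mxB unfold_mxZ unfold_mx1 scalemx1.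
by rewrite mulmxV // mulVmx.
Qed.

Lemma stabilizable_unfold : stabilizable S ->
  forall (l : C) (y : 'rV[C]_(#|midx (state_dim S)|)), 0 <= Re l ->
  y *m sA = l *: y -> y *m sB = 0 -> y = 0.
Proof.
move=> hS l y l0 yA yB; pose Y : vtensor C (state_dim S) := fold_cv (adjm y).
have YE : unfold_mx (tconj Y) = const_mx 1 *m y.
  apply/matrixP => i j; rewrite !mxE big_ord1 !mxE mul1r !ffunE /= enum_valK.
  by rewrite !mxE conjcK.
have Y0 : Y = tzero.
  apply: (hS l) => //; apply: unfold_mx_inj; rewrite unfold_mxM YE -mulmxA.
    by rewrite yA -scalemxAr unfold_mxZ YE.
  by rewrite yB mulmx0; apply/matrixP => i j; rewrite !mxE ffunE.
have : adjm y = 0 by rewrite -[adjm y]fold_cvK -/Y Y0 unfold_cv0.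
by move=> /(congr1 (@adjm R _ _)); rewrite adjmK /adjm trmx0 map_mx0.
Qed.

Lemma detectable_unfold : detectable S ->
  forall (l : C) (v : 'cV[C]_(#|midx (state_dim S)|)), 0 <= Re l ->
  sA *m v = l *: v -> sC *m v = 0 -> v = 0.
Proof.
move=> hS l v l0 vA vC; rewrite -[v]fold_cvK.
rewrite (hS l (fold_cv v)) ?unfold_cv0 //; apply: unfold_cv_inj.
  by rewrite unfold_cvM unfold_cvZ fold_cvK.
by rewrite unfold_cvM unfold_cv0 fold_cvK.
Qed.

(** Finitely many entries share a neighbourhood: the inverse of a sum of inverses is
    a common lower bound for their radii. *)
Lemma teval_bounded_right (G : transfer_tensor R I J) (l : C) :
  (forall p, stable (G p)) -> 0 <= Re l -> exists K d : R, 0 < d /\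
    forall e : R, 0 < e <= d -> sum_norm (unfold_mx (teval G (l + e%:C%C))) <= K.
Proof.
move=> hG l0.
have /choice[K hK] : forall p, exists K : R, exists d : R, 0 < d /\
    forall e : R, 0 < e <= d -> nc (reval (G p) (l + e%:C%C)) <= K.
  by move=> p; exact: reval_bounded_right.
have /choice[d hd] : forall p, exists d : R, 0 < d /\
    forall e : R, 0 < e <= d -> nc (reval (G p) (l + e%:C%C)) <= K p.
  by move=> p; exact: hK.
exists (\sum_(i < #|midx I|) \sum_(j < #|midx J|) K (enum_val i, enum_val j)),
  (1 + \sum_p (d p)^-1)^-1.
have s0 : 0 <= \sum_p (d p)^-1.
  by rewrite sumr_ge0 // => p _; rewrite invr_ge0 ltW //; case: (hd p).
split; first by rewrite invr_gt0 ltr_wpDr.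
move=> e /andP[e0 e1]; apply: ler_sum => i _; apply: ler_sum => j _.
rewrite mxE ffunE; have [d0 h] := hd (enum_val i, enum_val j); apply: h.
rewrite e0 (le_trans e1) // -[leRHS]invrK lef_pV2 ?posrE ?invr_gt0 ?ltr_wpDr //.
rewrite (bigD1 (enum_val i, enum_val j)) //= addrCA lerDl addr_ge0 // sumr_ge0 // => p _.
by rewrite invr_ge0 ltW //; case: (hd p).
Qed.

Lemma realization_hurwitz (G : transfer_tensor R I J) : (forall p, stable (G p)) ->
  realizes S G -> stabilizable S -> detectable S -> hurwitzm sA.
Proof.
move=> hG rS sS dS; apply: (@hurwitz_of_bounded _ _ _ _ sA sB sC).
- exact: stabilizable_unfold.
- exact: detectable_unfold.
- move=> l l0; have [K [d [d0 hK]]] := teval_bounded_right hG l0.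
  exists (K + sum_norm sD), d; split=> // e he u.
  have := hK e he; rewrite (realizes_transfer rS u) => h.
  have -> : sC *m resolvent sA (l + e%:C%C) *m sB = stransfer (l + e%:C%C) - sD.
    by rewrite /stransfer /transfer [RHS]addrC addKr.
  by apply: le_trans (sum_normB _ _) _; rewrite lerD2r.
Qed.

End Realization.

(** * Signals *)

Section SignalUnfold.
Variable I : 'I_N -> nat.
Implicit Types x : signal R I.

Lemma signal_derive_unfold x t v : signal_derive x t v ->
  vderive (fun r => unfold_cv (x r)) t (unfold_cv v).
Proof.
move=> h i; have [h1 h2] := h (enum_val i, one_idx N); split.
  rewrite (_ : (fun _ => _) = fun r => Re (x r (enum_val i, one_idx N))) ?mxE //.
  by apply/funext => r; rewrite mxE.
rewrite (_ : (fun _ => _) = fun r => Im (x r (enum_val i, one_idx N))) ?mxE //.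
by apply/funext => r; rewrite mxE.
Qed.

Lemma signal_right_cont_unfold x t : signal_right_continuous x t ->
  vright_cont (fun r => unfold_cv (x r)) t.
Proof.
move=> h i; have [h1 h2] := h (enum_val i, one_idx N); split.
  rewrite (_ : (fun _ => _) = fun r => Re (x r (enum_val i, one_idx N))) ?mxE //.
  by apply/funext => r; rewrite mxE.
rewrite (_ : (fun _ => _) = fun r => Im (x r (enum_val i, one_idx N))) ?mxE //.
by apply/funext => r; rewrite mxE.
Qed.

Lemma signal_derive_fold (x : R -> 'cV[C]_(#|midx I|)) t v : vderive x t v ->
  signal_derive (fun r => fold_cv (x r)) t (fold_cv v).
Proof.
move=> h -[i j]; have [h1 h2] := h (enum_rank i); split.
  rewrite (_ : (fun _ => _) = fun r => Re (x r (enum_rank i) 0)) ?ffunE //.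
  by apply/funext => r; rewrite ffunE.
rewrite (_ : (fun _ => _) = fun r => Im (x r (enum_rank i) 0)) ?ffunE //.
by apply/funext => r; rewrite ffunE.
Qed.

Lemma signal_right_cont_fold (x : R -> 'cV[C]_(#|midx I|)) t : vright_cont x t ->
  signal_right_continuous (fun r => fold_cv (x r)) t.
Proof.
move=> h -[i j]; have [h1 h2] := h (enum_rank i); split.
  rewrite (_ : (fun _ => _) = fun r => Re (x r (enum_rank i) 0)) ?ffunE //.
  by apply/funext => r; rewrite ffunE.
rewrite (_ : (fun _ => _) = fun r => Im (x r (enum_rank i) 0)) ?ffunE //.
by apply/funext => r; rewrite ffunE.
Qed.

Lemma bounded_signalP x : bounded_signal x <->
  exists M : R, forall t, 0 <= t -> sum_norm (unfold_cv (x t)) <= M.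
Proof.
split=> -[M hM].
  exists (\sum_(i < #|midx I|) M) => t t0; apply: ler_sum => i _.
  by rewrite big_ord1 mxE -lecR; exact: hM.
exists M => t t0 -[i j]; rewrite [`| _ |]nc_norm lecR; apply: le_trans (hM t t0).
have := nc_le_sum_norm (unfold_cv (x t)) (enum_rank i) 0.
by rewrite mxE enum_rankK -(one_idxE j).
Qed.

End SignalUnfold.
End Translation.

(** * The H-infinity norm *)

Section HinfNorm.
Variables (R : realType) (N : nat) (I J : 'I_N -> nat).
Implicit Type G : transfer_tensor R I J.

Lemma Hinf_norm_le G (g : R) :
  (Hinf_norm G <= g%:E)%E <-> forall w : R, spectral_norm (teval G (0 +i* w)%C) <= g.
Proof.
split=> [h w|h].
  by rewrite -lee_fin; apply: le_trans h; apply: ereal_sup_ubound; exists w.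
by apply: ge_ereal_sup => _ [w _ <-]; rewrite lee_fin.
Qed.

Lemma Hinf_norm_lt1 G : (Hinf_norm G < 1%:E)%E <->
  exists2 g : R, 0 <= g < 1 & forall w : R, spectral_norm (teval G (0 +i* w)%C) <= g.
Proof.
split=> [h|[g /andP[g0 g1] h]]; last first.
  by apply: (@le_lt_trans _ _ g%:E); [exact/Hinf_norm_le|rewrite lte_fin].
have h0 : (0%:E <= Hinf_norm G)%E.
  apply: (@le_trans _ _ (spectral_norm (teval G (0 +i* 0)%C))%:E).
    by rewrite lee_fin sqrtr_ge0.
  by apply: ereal_sup_ubound; exists 0.
have E : Hinf_norm G = (fine (Hinf_norm G))%:E.
  by rewrite fineK // ge0_fin_numE // (lt_trans h) // ltry.
exists (fine (Hinf_norm G)); last by apply/Hinf_norm_le; rewrite -E.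
by move: h h0; rewrite E lte_fin lee_fin => -> ->.
Qed.

Lemma gain_of_norm G (S : realization R I J) (g : R) : (forall k, 0 < J k)%N ->
  hurwitzm (sA S) -> realizes S G ->
  (forall w : R, spectral_norm (teval G (0 +i* w)%C) <= g) ->
  forall (w : R) v, l2norm (stransfer S (0 +i* w)%C *m v) <= g * l2norm v.
Proof.
move=> J0 hA hS h w v.
have u : (0 +i* w)%C%:M - sA S \in unitmx by apply: hurwitz_unit => //=.
rewrite -(realizes_transfer hS u).
have [h1 _] := specnormP (unfold_mx (teval G (0 +i* w)%C)) (card_midx_gt0 J0).
apply: le_trans (h1 v) _; rewrite ler_wpM2r ?l2norm_ge0 //.
by rewrite -spectral_norm_unfold.
Qed.

End HinfNorm.

Section Trajectories.
Variables (R : realType) (N : nat) (I J : 'I_N -> nat) (S : realization R I J).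
Local Notation C := R[i].

Lemma trajectory_unfold u x y : trajectory u x y ->
  [/\ vright_cont (fun t => unfold_cv (x t)) 0,
    forall t, 0 < t -> vderive (fun t => unfold_cv (x t)) t
      (sA S *m unfold_cv (x t) + sB S *m unfold_cv (u t)) &
    forall t, 0 <= t -> unfold_cv (y t) = sC S *m unfold_cv (x t) + sD S *m unfold_cv (u t)].
Proof.
move=> [x0 cx dx yE]; split.
- exact: signal_right_cont_unfold.
- move=> t t0; have := signal_derive_unfold (dx t t0).
  by rewrite unfold_cvD !unfold_cvM.
- by move=> t t0; rewrite yE // unfold_cvD !unfold_cvM.
Qed.

Definition signal_of F (I' : 'I_N -> nat) (X : R -> 'cV[C]_(#|midx I'|)) : signal R I' :=
  fun t => fold_cv (base_part_mx F (X t)).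

Lemma trajectory_fold F (U : R -> 'cV[C]_(#|midx J|)) X :
  realization_over F S -> X 0 = 0 ->
  (forall t, vderive X t (sA S *m X t + sB S *m U t)) ->
  trajectory (S := S) (signal_of F U) (signal_of F X)
    (signal_of F (fun t => sC S *m X t + sD S *m U t)).
Proof.
move=> [oA oB oC oD] X0 dX.
have dX' t : vderive (fun r => base_part_mx F (X r)) t
    (base_part_mx F (sA S *m X t + sB S *m U t)).
  move=> i; rewrite mxE; apply: (@cderive_ext _ (fun r => base_part F (X r i 0))).
    by move=> r; rewrite mxE.
  exact/cderive_base_part/dX.
split.
- by apply: unfold_cv_inj; rewrite fold_cvK unfold_cv0 X0; apply/matrixP => i j;
    rewrite !mxE base_part0.
- by apply: signal_right_cont_fold => i; exact: cderive_right_cont (dX' 0 i).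
- move=> t t0; rewrite [X in signal_derive _ _ X](_ : _ =
     fold_cv (base_part_mx F (sA S *m X t + sB S *m U t))); first exact: signal_derive_fold.
  apply: unfold_cv_inj; rewrite unfold_cvD !unfold_cvM !fold_cvK base_part_mxD.
  by rewrite !base_part_mx_mul //; exact: tensor_over_unfold.
- move=> t t0; apply: unfold_cv_inj; rewrite unfold_cvD !unfold_cvM !fold_cvK base_part_mxD.
  by rewrite !base_part_mx_mul //; exact: tensor_over_unfold.
Qed.

Lemma signal_of_over F (I' : 'I_N -> nat) (X : R -> 'cV[C]_(#|midx I'|)) :
  signal_over F (signal_of F X).
Proof. by move=> t _ p; rewrite ffunE mxE base_part_over. Qed.

Lemma signal_of_bounded F (I' : 'I_N -> nat) (X : R -> 'cV[C]_(#|midx I'|)) (M : R) :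
  (forall t, 0 <= t -> sum_norm (X t) <= M) -> bounded_signal (signal_of F X).
Proof.
move=> h; apply/bounded_signalP; exists M => t t0; rewrite fold_cvK.
exact: le_trans (sum_norm_base_part_mx _ _) (h t t0).
Qed.

End Trajectories.

(** * Sufficiency *)

Section Sufficiency.
Variables (R : realType) (F : base_field) (N : nat) (L K : 'I_N -> nat).
Hypotheses (L_gt0 : forall k, (0 < L k)%N) (K_gt0 : forall k, (0 < K k)%N).
Variables (G : transfer_tensor R L K) (SG : realization R L K).
Variables (Delta : transfer_tensor R K L) (SD : realization R K L).

Lemma small_gain_internally_stable :
  FHinf F G -> realizes SG G -> stabilizable SG -> detectable SG ->
  FHinf F Delta -> realizes SD Delta -> stabilizable SD -> detectable SD ->
  (Hinf_norm G < 1%:E)%E -> (Hinf_norm Delta <= 1%:E)%E ->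
  internally_stable F SG SD.
Proof.
move=> fG rG sG dG fD rDel sDel dDel /Hinf_norm_lt1[g /andP[g0 g1] hg] /Hinf_norm_le hD.
have hA1 : hurwitzm (sA SG).
  by apply: realization_hurwitz rG sG dG => p; case: (fG p).
have hA2 : hurwitzm (sA SD).
  by apply: realization_hurwitz rDel sDel dDel => p; case: (fD p).
have gn1 := gain_of_norm K_gt0 hA1 rG hg.
have gn2 := gain_of_norm L_gt0 hA2 rDel hD.
have wp := small_gain_well_posed g1 hA1 hA2 gn1 gn2.
split=> //.
  exists (fold_mx (invmx (1%:M - sD SG *m sD SD))).
  apply/is_tinv_unfold; rewrite fold_mxK unfold_mxB unfold_mx1 unfold_mxM.
  by rewrite mulmxV // mulVmx.
move=> w1 w2 e1 e2 y1 y2 x1 x2 [t1 t2 E1 E2] _ _ _ _ /bounded_signalP[M1 b1]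
  /bounded_signalP[M2 b2].
have [c1 d1 Y1] := trajectory_unfold t1; have [c2 d2 Y2] := trajectory_unfold t2.
have [B hB] : exists B : R, forall t, 0 <= t ->
    [/\ sum_norm (unfold_cv (x1 t)) <= B, sum_norm (unfold_cv (x2 t)) <= B,
        sum_norm (unfold_cv (e1 t)) <= B & sum_norm (unfold_cv (e2 t)) <= B].
  apply: (small_gain_bounded g0 g1 hA1 hA2 gn1 gn2
    (w1 := fun t => unfold_cv (w1 t)) (w2 := fun t => unfold_cv (w2 t))
    (M := Num.max M1 M2) c1 c2 d1 d2).
  - by move=> t t0; rewrite E1 // unfold_cvD Y2.
  - by move=> t t0; rewrite E2 // unfold_cvD Y1.
  - by move=> t t0; rewrite le_max b1.
  - by move=> t t0; rewrite le_max b2 ?orbT.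
have out m n p (Co : 'M[R[i]]_(p, n)) (D : 'M[R[i]]_(p, m)) x e :
    sum_norm x <= B -> sum_norm e <= B ->
    sum_norm (Co *m x + D *m e) <= sum_norm Co * B + sum_norm D * B.
  move=> hx he; apply: le_trans (sum_normD _ _) (lerD _ _).
    by apply: le_trans (sum_normM _ _) _; rewrite ler_wpM2l ?sum_norm_ge0.
  by apply: le_trans (sum_normM _ _) _; rewrite ler_wpM2l ?sum_norm_ge0.
split; apply/bounded_signalP.
- by exists B => t /hB[].
- by exists B => t /hB[].
- exists (sum_norm (sC SG) * B + sum_norm (sD SG) * B) => t t0; have [] := hB t t0.
  by rewrite Y1 // => *; exact: out.
- exists (sum_norm (sC SD) * B + sum_norm (sD SD) * B) => t t0; have [] := hB t t0.
  by rewrite Y2 // => *; exact: out.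
Qed.

End Sufficiency.

(** * Stable rational perturbations with first-order entries *)

Section FirstOrder.
Variables (R : realType) (F : base_field) (N : nat) (L K : 'I_N -> nat).
Local Notation C := R[i].
Variables (r c : midx K * midx L -> C) (a : midx K * midx L -> R).
Hypotheses (r_over : forall p, r p \in @scalars R F) (c_over : forall p, c p \in @scalars R F).
Hypothesis a_gt0 : forall p, 0 < a p.

Definition fo_den p : {poly C} := 'X + (a p)%:C%C%:P.
Definition fo_num p : {poly C} := r p *: fo_den p + (c p)%:P.

Definition fo_transfer : transfer_tensor R K L :=
  [ffun p => FracField.tofrac (fo_num p) / FracField.tofrac (fo_den p)].

(** One state per entry: the state standing for [(k, l)] filters the input of index
    [l] through [1 / (s + a)] and contributes to the output of index [k]. *)
Definition fo_realization : realization R K L :=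
  @Realization R N K L (fun k => K k * L k)%N
    [ffun p => (p.1 == p.2)%:R * - (a (pair_idx p.1))%:C%C]
    [ffun p => ((pair_idx p.1).2 == p.2)%:R]
    [ffun p => ((pair_idx p.2).1 == p.1)%:R * c (pair_idx p.2)]
    [ffun p => r p].

Lemma fo_den_neq0 p : fo_den p != 0.
Proof. by rewrite -size_poly_gt0 size_XaddC. Qed.

Lemma fo_den_eval p s : (fo_den p).[s] = s + (a p)%:C%C.
Proof. by rewrite !hornerE. Qed.

Lemma right_shift_neq0 p s : 0 <= Re s -> s + (a p)%:C%C != 0.
Proof.
move=> s0; apply: contraTneq (a_gt0 p) => /(congr1 (fun z => Re z)).
by rewrite ReD /= -leNgt => h; lra.
Qed.

Lemma fo_reval p s : s + (a p)%:C%C != 0 ->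
  reval (fo_transfer p) s = r p + c p / (s + (a p)%:C%C).
Proof.
move=> h; rewrite (@reval_frac _ (fo_num p) (fo_den p)) ?fo_den_eval ?ffunE //.
by rewrite /fo_num hornerD hornerZ fo_den_eval hornerC mulrDl mulfK.
Qed.

Lemma scalars0 : 0 \in @scalars R F. Proof. by case: F => //=; rewrite inE. Qed.
Lemma scalars1 : 1 \in @scalars R F. Proof. by case: F => //=; rewrite inE. Qed.
Lemma scalars_real (x : R) : x%:C%C \in @scalars R F.
Proof. by case: F => //=; rewrite inE. Qed.

Lemma scalarsD (x y : C) : x \in @scalars R F -> y \in @scalars R F -> x + y \in @scalars R F.
Proof. by case: F => //=; rewrite !inE ImD => /eqP -> /eqP ->; rewrite addr0. Qed.

Lemma scalarsM (x y : C) : x \in @scalars R F -> y \in @scalars R F -> x * y \in @scalars R F.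
Proof. by case: F => //=; rewrite !inE ImM => /eqP -> /eqP ->; rewrite mulr0 mul0r addr0. Qed.

Lemma scalars_bool (b : bool) : b%:R \in @scalars R F.
Proof. by case: b; rewrite ?scalars0 ?scalars1. Qed.

Lemma fo_den_over p i : (fo_den p)`_i \in @scalars R F.
Proof.
rewrite coefD coefX coefC; apply: scalarsD; first exact: scalars_bool.
by case: (i == 0)%N; rewrite ?scalars0 ?scalars_real.
Qed.

Lemma fo_FHinf : FHinf F fo_transfer.
Proof.
move=> p; have E : fo_transfer p = FracField.tofrac (fo_num p) / FracField.tofrac (fo_den p).
  by rewrite ffunE.
split.
- exists (fo_num p), (fo_den p); split=> //; last exact: fo_den_neq0.
    apply/(all_nthP 0) => i _; rewrite coefD coefZ coefC.
    apply: scalarsD; first exact/scalarsM/fo_den_over.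
    by case: (i == 0)%N; rewrite ?scalars0.
  by apply/(all_nthP 0) => i _; exact: fo_den_over.
- apply: proper_frac (fo_den_neq0 p) _ E.
  rewrite (leq_trans (size_polyD _ _)) // geq_max size_scale_leq /= size_XaddC.
  exact: leq_trans (size_polyC_leq1 _) _.
- move=> s /(pole_frac (fo_den_neq0 p) E); rewrite rootE fo_den_eval => h.
  rewrite ltNge; apply/negP => s0; move: h; apply/negP; exact: right_shift_neq0.
Qed.

Lemma fo_realization_over : realization_over F fo_realization.
Proof.
split=> p; rewrite ffunE //.
- rewrite mulrN -mulNr; apply: scalarsM; last exact: scalars_real.
  have -> : - ((p.1 == p.2)%:R : C) = (- ((p.1 == p.2)%:R : R))%:C%C.
    by rewrite (rmorphN (real_complex R)) (rmorph_nat (real_complex R)).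
  exact: scalars_real.
- exact: scalars_bool.
- by apply: scalarsM => //; exact: scalars_bool.
Qed.

Lemma sum_delta (T : finType) (i : T) (f : T -> C) :
  \sum_j (i == j)%:R * f j = f i.
Proof.
rewrite (bigD1 i) //= eqxx mul1r big1 ?addr0 // => j ji.
by rewrite eq_sym (negPf ji) mul0r.
Qed.

Lemma sum_delta_r (T : finType) (i : T) (f : T -> C) :
  \sum_j f j * (j == i)%:R = f i.
Proof.
rewrite -[RHS](sum_delta i f); apply: eq_bigr => j _.
by rewrite mulrC eq_sym.
Qed.

Lemma fo_realizes : realizes fo_realization fo_transfer.
Proof.
move=> s X [XE _].
have hX m m' : (s + (a (pair_idx m))%:C%C) * X (m, m') = (m == m')%:R.
  have := congr1 (fun T : tensor C _ _ => T (m, m')) XE; rewrite !ffunE /= => <-.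
  rewrite -[LHS](sum_delta m (fun j => (s + (a (pair_idx m))%:C%C) * X (j, m'))).
  apply: eq_bigr => j _; rewrite !ffunE /=; ring.
have na m : s + (a (pair_idx m))%:C%C != 0.
  by apply: contra_eq_neq (hX m m) => ->; rewrite mul0r eqxx eq_sym oner_neq0.
have {}hX m m' : X (m, m') = (s + (a (pair_idx m))%:C%C)^-1 * (m == m')%:R.
  by rewrite -hX mulKf.
apply/ffunP => p; have [g gK Kg] := pair_idx_bij K L.
have pE := Kg p; have nap : s + (a p)%:C%C != 0 by rewrite -pE na.
rewrite ffunE fo_reval // !ffunE; congr (_ + _).
transitivity (\sum_j ((g p == j)%:R * (c (pair_idx j) / (s + (a (pair_idx j))%:C%C)))).
  by rewrite sum_delta pE.
apply: eq_bigr => j _; rewrite !ffunE /=.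
rewrite (eq_bigr (fun m => (((pair_idx m).1 == p.1)%:R * c (pair_idx m) /
    (s + (a (pair_idx m))%:C%C)) * (m == j)%:R)); last first.
  by move=> m _; rewrite !ffunE /= hX mulrA.
rewrite sum_delta_r.
have -> : (g p == j) = (((pair_idx j).1 == p.1) && ((pair_idx j).2 == p.2)).
  by rewrite -[_ && _]/(pair_idx j == p); apply/eqP/eqP => <-.
by rewrite -mulnb natrM; ring.
Qed.

Lemma fo_stabilizable : stabilizable fo_realization.
Proof.
move=> l Y l0 YA _; apply/ffunP => -[m i]; rewrite [RHS]ffunE.
have := congr1 (fun T : tensor C _ _ => T (i, m)) YA; rewrite !ffunE /=.
rewrite (eq_bigr (fun j => ((Y (j, i))^*%C * - (a (pair_idx j))%:C%C) * (j == m)%:R)); last first.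
  by move=> j _; rewrite !ffunE /=; ring.
rewrite sum_delta_r => /eqP; rewrite -subr_eq0.
rewrite (_ : _ - _ = - ((l + (a (pair_idx m))%:C%C) * (Y (m, i))^*%C)); last by ring.
rewrite oppr_eq0 mulf_eq0 (negPf (right_shift_neq0 _ l0)) /= conjc_eq0.
by move=> /eqP.
Qed.

Lemma fo_detectable : detectable fo_realization.
Proof.
move=> l Y l0 AY _; apply/ffunP => -[m i]; rewrite [RHS]ffunE.
have := congr1 (fun T : tensor C _ _ => T (m, i)) AY; rewrite !ffunE /=.
rewrite (eq_bigr (fun j => (m == j)%:R * (- (a (pair_idx m))%:C%C * Y (j, i)))); last first.
  by move=> j _; rewrite !ffunE /=; ring.
rewrite sum_delta => /eqP; rewrite -subr_eq0.
rewrite (_ : _ - _ = - ((l + (a (pair_idx m))%:C%C) * Y (m, i))); last by ring.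
rewrite oppr_eq0 mulf_eq0 (negPf (right_shift_neq0 _ l0)) /=.
by move=> /eqP.
Qed.

Lemma fo_hurwitz : hurwitzm (sA fo_realization).
Proof.
apply: realization_hurwitz fo_realizes fo_stabilizable fo_detectable => p.
by case: (fo_FHinf p).
Qed.

Lemma fo_stransfer (w : R) : stransfer fo_realization (0 +i* w)%C =
  \matrix_(i, j) (r (enum_val i, enum_val j) +
     c (enum_val i, enum_val j) / ((0 +i* w)%C + (a (enum_val i, enum_val j))%:C%C)).
Proof.
rewrite -(realizes_transfer fo_realizes); last by apply: hurwitz_unit fo_hurwitz _.
by apply/matrixP => i j; rewrite !mxE ffunE fo_reval // right_shift_neq0.
Qed.

Lemma fo_Hinf_norm : (forall k, 0 < L k)%N ->
  (forall w : R, \sum_p nc (r p + c p / ((0 +i* w)%C + (a p)%:C%C)) ^+ 2 <= 1) ->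
  (Hinf_norm fo_transfer <= 1%:E)%E.
Proof.
move=> L0 h; apply/Hinf_norm_le => w; rewrite spectral_norm_unfold.
rewrite (realizes_transfer fo_realizes); last by apply: hurwitz_unit fo_hurwitz _.
apply: specnorm_le; first exact: card_midx_gt0.
move=> v; rewrite mul1r; apply: frobenius_gain; rewrite fo_stransfer.
apply: le_trans (h w); rewrite (eq_bigr (fun p => nc (r (p.1, p.2) + c (p.1, p.2) /
  ((0 +i* w)%C + (a (p.1, p.2))%:C%C)) ^+ 2)); last by case.
rewrite -(pair_bigA _ (fun i j =>
  nc (r (i, j) + c (i, j) / ((0 +i* w)%C + (a (i, j))%:C%C)) ^+ 2)) /=.
rewrite sum_midx; apply: ler_sum => i _; rewrite sum_midx; apply: ler_sum => j _.
by rewrite mxE.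
Qed.

End FirstOrder.

(** * Necessity *)

Section Necessity.
Variables (R : realType) (F : base_field) (N : nat) (L K : 'I_N -> nat).
Hypotheses (L_gt0 : forall k, (0 < L k)%N) (K_gt0 : forall k, (0 < K k)%N).
Local Notation C := R[i].

Lemma mx_over_real m n (M : 'M[C]_(m, n)) :
  mx_over RealField M <-> map_mx (@conjc R) M = M.
Proof.
split=> [h|h i j].
  apply/matrixP => i j; rewrite mxE; have := h i j; rewrite inE /= => /eqP.
  by case: (M i j) => x y /= ->; rewrite oppr0.
rewrite inE /=; have := congr1 (fun A : 'M[C]_(m, n) => Im (A i j)) h.
rewrite mxE; case: (M i j) => x y /= h'; apply/eqP; lra.
Qed.

Lemma stransfer_real (S : realization R L K) : realization_over RealField S ->
  mx_over RealField (stransfer S 0).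
Proof.
move=> [oA oB oC oD].
have un I J (A : tensor C I J) : tensor_over RealField A ->
    map_mx (@conjc R) (unfold_mx A) = unfold_mx A.
  by move=> /tensor_over_unfold /mx_over_real.
apply/mx_over_real.
rewrite /stransfer /transfer map_mxD !map_mxM /resolvent map_invmx map_mxB.
by rewrite map_scalar_mx rmorph0 /sA /sB /sC /sD !un.
Qed.

Lemma sD_over (S : realization R L K) : realization_over F S -> mx_over F (sD S).
Proof. by move=> [_ _ _ oD]; exact: tensor_over_unfold. Qed.

(** The matrix [v y^H / |y|^2], the cheapest one that takes [y] to [v]. *)
Definition rank_one m n (v : 'cV[C]_m) (y : 'cV[C]_n) i j : C :=
  v i 0 * (y j 0)^*%C / (l2norm y ^+ 2)%:C%C.

Lemma rank_one_mul m n (v : 'cV[C]_m) (y : 'cV[C]_n) : y != 0 ->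
  (\matrix_(i, j) rank_one v y i j) *m y = v.
Proof.
move=> y0; apply/colP => i; rewrite mxE.
have n0 : (l2norm y ^+ 2)%:C%C != 0 :> C.
  by rewrite -nc_gt0 ncR normr_gt0 expf_neq0 // gt_eqF // l2norm_gt0.
rewrite (eq_bigr (fun j => (v i 0 / (l2norm y ^+ 2)%:C%C) * ((y j 0)^*%C * y j 0))).
  by rewrite -mulr_sumr -dotcE dotcc divfK.
by move=> j _; rewrite mxE /rank_one; ring.
Qed.

Lemma rank_one_frobenius m n (v : 'cV[C]_m) (y : 'cV[C]_n) : y != 0 -> l2norm v <= l2norm y ->
  \sum_i \sum_j nc (rank_one v y i j) ^+ 2 <= 1.
Proof.
move=> /l2norm_gt0 y0 vy.
have -> : \sum_i \sum_j nc (rank_one v y i j) ^+ 2 = l2norm v ^+ 2 / l2norm y ^+ 2.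
  rewrite (_ : _ / _ = l2norm v ^+ 2 * (l2norm y ^+ 2 / (l2norm y ^+ 2) ^+ 2)); last first.
    by field; rewrite gt_eqF.
  rewrite {1}(sqr_l2norm v) mulr_suml; apply: eq_bigr => i _.
  rewrite {1}(sqr_l2norm y) mulr_suml mulr_sumr; apply: eq_bigr => j _.
  rewrite /rank_one ncM ncM ncV nc_conj ncR ger0_norm ?sqr_ge0 //.
  by rewrite !exprMn exprVn mulrA.
rewrite ler_pdivrMr ?exprn_gt0 // mul1r lerXn2r ?nnegrE ?l2norm_ge0 //.
Qed.

Lemma rank_one_real m n (v : 'cV[C]_m) (y : 'cV[C]_n) i j :
  mx_over RealField v -> mx_over RealField y -> Im (rank_one v y i j) = 0.
Proof.
move=> hv hy; apply/eqP; have := hv i 0; have := hy j 0; rewrite /rank_one !inE /=.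
case: (v i 0) (y j 0) => [v1 v2] [y1 y2] /= /eqP -> /eqP ->.
by apply/eqP; rewrite !(oppr0, mul0r, mulr0, addr0, subr0).
Qed.

Variables (G : transfer_tensor R L K) (SG : realization R L K).
Hypotheses (SG_over : realization_over F SG) (SG_realizes : realizes SG G).
Hypothesis SG_hurwitz : hurwitzm (sA SG).

Definition robustly_stable : Prop := forall Delta : transfer_tensor R K L,
  FHinf F Delta -> (Hinf_norm Delta <= 1%:E)%E ->
  forall SD : realization R K L,
    realization_over F SD -> realizes SD Delta ->
    stabilizable SD -> detectable SD -> internally_stable F SG SD.

Lemma rank_one_sum (v : 'cV[C]_(#|midx K|)) (y : 'cV[C]_(#|midx L|)) :
  y != 0 -> l2norm v <= l2norm y ->
  \sum_(p : midx K * midx L) nc (rank_one v y (enum_rank p.1) (enum_rank p.2)) ^+ 2 <= 1.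
Proof.
move=> y0 vy; apply: le_trans (rank_one_frobenius y0 vy).
rewrite -(pair_bigA _ (fun i j => nc (rank_one v y (enum_rank i) (enum_rank j)) ^+ 2)) /=.
rewrite sum_midx; apply: ler_sum => i _; rewrite sum_midx; apply: ler_sum => j _.
by rewrite !enum_valK.
Qed.

Lemma mx_overM m n p (A : 'M[C]_(m, n)) (B : 'M[C]_(n, p)) :
  mx_over F A -> mx_over F B -> mx_over F (A *m B).
Proof.
move=> hA hB i j; rewrite mxE; apply: (big_ind (fun z => z \in @scalars R F)).
- exact: scalars0.
- exact: scalarsD.
- by move=> k _; apply: scalarsM.
Qed.

Lemma robust_first_order (r c : midx K * midx L -> C) (a : midx K * midx L -> R) :
  robustly_stable ->
  (forall p, r p \in @scalars R F) -> (forall p, c p \in @scalars R F) -> (forall p, 0 < a p) ->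
  (forall w : R, \sum_p nc (r p + c p / ((0 +i* w)%C + (a p)%:C%C)) ^+ 2 <= 1) ->
  internally_stable F SG (fo_realization r c a).
Proof.
move=> hrob rF cF a0 h; apply: hrob (fo_FHinf rF cF a0) _ _ _ _ _ _.
- exact: fo_Hinf_norm.
- exact: fo_realization_over.
- exact: fo_realizes.
- exact: fo_stabilizable.
- exact: fo_detectable.
Qed.

Lemma image_neq0 m n (M : 'M[C]_(m, n)) (v : 'cV[C]_n) :
  v != 0 -> l2norm v <= l2norm (M *m v) -> M *m v != 0.
Proof.
move=> /l2norm_gt0 v0 h; apply: contraTneq (lt_le_trans v0 h) => ->.
by rewrite l2norm_0 ltxx.
Qed.

(** If [D_G] does not contract some [v], the constant perturbation taking [D_G v]
    to [v] makes the loop ill-posed. *)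
Lemma feedthrough_contracts : robustly_stable ->
  forall v, v != 0 -> l2norm (sD SG *m v) < l2norm v.
Proof.
move=> hrob v0 v0n0; rewrite ltNge; apply/negP => hv0.
have [v [vF vn0 hv]] : exists v : 'cV[C]_(#|midx K|),
    [/\ mx_over F v, v != 0 & l2norm v <= l2norm (sD SG *m v)].
  case: F (sD_over SG_over) => oD; last by exists v0.
  exact: expanding_real_vector oD v0n0 hv0.
pose y := sD SG *m v; have y0 : y != 0 by exact: image_neq0.
have yF : mx_over F y by apply: mx_overM => //; exact: sD_over.
pose r (p : midx K * midx L) := rank_one v y (enum_rank p.1) (enum_rank p.2).
pose c (p : midx K * midx L) : C := 0; pose a (p : midx K * midx L) : R := 1.
have rF p : r p \in @scalars R F.
  rewrite /r; case: F vF yF => // vF' yF'; rewrite inE; apply/eqP.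
  exact: rank_one_real.
have [|||_ _ [X [_ XE]] _] := @robust_first_order r c a hrob rF.
- by move=> p; exact: scalars0.
- by move=> p; exact: ltr01.
- move=> w; rewrite (eq_bigr (fun p => nc (r p) ^+ 2)); first exact: rank_one_sum.
  by move=> p _; rewrite mul0r addr0.
have sDE : sD (fo_realization r c a) = \matrix_(i, j) rank_one v y i j.
  by apply/matrixP => i j; rewrite !mxE ffunE /r /= !enum_valK.
have := congr1 (@unfold_mx _ _ _ _) XE.
rewrite unfold_mxM unfold_mxB unfold_mx1 unfold_mxM -/(sD SG) -/(sD _) sDE.
move=> /(congr1 (mulmx^~ y)); rewrite /= mul1mx -mulmxA mulmxBl mul1mx -mulmxA rank_one_mul //.
by rewrite subrr mulmx0 => /esym/eqP; apply/negP.
Qed.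

(** If [G(i w)] does not contract some [v], a stable perturbation of norm at most 1
    takes [y = G(i w) v] back to [v] at the frequency [w]. The signals
    [t e^(i w t) v] and [t e^(i w t) y] then solve the loop equations up to bounded
    external signals, although they are unbounded. *)
Lemma axis_contracts : robustly_stable ->
  forall (w : R) v, v != 0 -> l2norm (stransfer SG (0 +i* w)%C *m v) < l2norm v.
Proof.
move=> hrob w v0 v0n0; rewrite ltNge; apply/negP => hv0.
pose T := stransfer SG (0 +i* w)%C; rewrite -/T in hv0.
have TF : F = RealField -> w = 0 -> mx_over RealField T.
  by move=> EF w0; rewrite /T w0; apply: stransfer_real; move: SG_over; rewrite EF.
have [v [vF vn0 hv]] : exists v : 'cV[C]_(#|midx K|),
    [/\ F = RealField -> w = 0 -> mx_over RealField v, v != 0 & l2norm v <= l2norm (T *m v)].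
  have [[EF w0]|h] := pselect (F = RealField /\ w = 0).
    by have [v [h1 h2 h3]] := expanding_real_vector (TF EF w0) v0n0 hv0; exists v.
  by exists v0; split=> // EF w0; case: h.
pose y := T *m v; have y0 : y != 0 by exact: image_neq0.
have rank_one_F i j : F = RealField -> w = 0 -> Im (rank_one v y i j) = 0.
  move=> EF w0; apply: rank_one_real; first exact: vF.
  by move: (mx_overM) (TF EF w0) (vF EF w0); rewrite EF => h; exact: h.
have /choice[f hf] : forall p : midx K * midx L, exists t : C * C * R,
    [/\ t.1.1 \in @scalars R F, t.1.2 \in @scalars R F, 0 < t.2,
     t.1.1 + t.1.2 / ((0 +i* w)%C + t.2%:C%C) = rank_one v y (enum_rank p.1) (enum_rank p.2) &
     forall s : R, nc (t.1.1 + t.1.2 / ((0 +i* s)%C + t.2%:C%C)) =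
       nc (rank_one v y (enum_rank p.1) (enum_rank p.2))].
  move=> p; have [r [c [a h]]] := allpass_interpolation (rank_one_F (enum_rank p.1)
    (enum_rank p.2)).
  by exists (r, c, a).
pose r p := (f p).1.1; pose c p := (f p).1.2; pose a p := (f p).2.
have a0 p : 0 < a p by case: (hf p).
pose SD := fo_realization r c a.
have oSD : realization_over F SD.
  by apply: fo_realization_over => p; case: (hf p).
have hSD : hurwitzm (sA SD) by apply: (@fo_hurwitz _ F) => // p; case: (hf p).
have TD : stransfer SD (0 +i* w)%C *m y = v.
  rewrite (@fo_stransfer _ F) //; [|by move=> p; case: (hf p)|by move=> p; case: (hf p)].
  rewrite -[RHS](rank_one_mul v y0); congr (_ *m _); apply/matrixP => i j; rewrite !mxE.
  by case: (hf (enum_val i, enum_val j)) => _ _ _ -> _; rewrite /= !enum_valK.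
have [|||_ _ _ hstab] := @robust_first_order r c a hrob _ _ a0.
- by move=> p; case: (hf p).
- by move=> p; case: (hf p).
- move=> s; rewrite (eq_bigr (fun p : midx K * midx L =>
    nc (rank_one v y (enum_rank p.1) (enum_rank p.2)) ^+ 2)); first exact: rank_one_sum.
  by move=> p _; case: (hf p) => _ _ _ _ ->.
rewrite -/SD in hstab.
have [X1 [X10 dX1 [K1 hK1]]] := @resonant_response _ _ _ _ _ (sB SG) (sC SG) (sD SG) w v
  SG_hurwitz.
have [X2 [X20 dX2 [K2 hK2]]] := @resonant_response _ _ _ _ _ (sB SD) (sC SD) (sD SD) w y hSD.
pose E1 (t : R) := (t%:C%C * cis w t) *: v; pose E2 (t : R) := (t%:C%C * cis w t) *: y.
pose Y1 t := sC SG *m X1 t + sD SG *m E1 t; pose Y2 t := sC SD *m X2 t + sD SD *m E2 t.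
have loop : feedback_loop (SG := SG) (SD := SD)
   (signal_of F (fun t => E1 t - Y2 t)) (signal_of F (fun t => E2 t - Y1 t))
   (signal_of F E1) (signal_of F E2) (signal_of F Y1) (signal_of F Y2)
   (signal_of F X1) (signal_of F X2).
  split; try exact: trajectory_fold.
  - by move=> t _; apply: unfold_cv_inj; rewrite unfold_cvD !fold_cvK -base_part_mxD subrK.
  - by move=> t _; apply: unfold_cv_inj; rewrite unfold_cvD !fold_cvK -base_part_mxD subrK.
have [||||||/bounded_signalP[M hM] _ _ _] := hstab _ _ _ _ _ _ _ _ loop.
- exact: signal_of_over.
- exact: signal_of_over.
- exact: signal_of_over.
- exact: signal_of_over.
- apply: (@signal_of_bounded _ _ _ _ _ K2) => t t0; rewrite -sum_normN opprB.
  by have := hK2 t t0; rewrite -/(stransfer SD _) TD.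
- by apply: (@signal_of_bounded _ _ _ _ _ K1) => t t0; rewrite -sum_normN opprB; exact: hK1.
have [k vk] : exists k, v k 0 != 0.
  apply: contrapT => h; move/eqP: vn0; apply; apply/colP => k; rewrite [RHS]mxE.
  by apply/eqP; apply: contrapT => /negP vk; apply: h; exists k.
apply: (@oscillation_unbounded _ F w (v k 0) M vk).
  by move=> EF w0; have := vF EF w0 k 0; rewrite inE => /eqP.
move=> t t0; apply: le_trans (hM t t0); rewrite fold_cvK.
by have := nc_le_sum_norm (base_part_mx F (E1 t)) k 0; rewrite !mxE.
Qed.

Lemma robustly_stable_norm_lt1 : robustly_stable -> (Hinf_norm G < 1%:E)%E.
Proof.
move=> hrob; have [g g01 hg] := uniform_gain (card_midx_gt0 K_gt0) SG_hurwitz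
  (axis_contracts hrob) (feedthrough_contracts hrob).
apply/Hinf_norm_lt1; exists g => // w.
rewrite spectral_norm_unfold (realizes_transfer SG_realizes); first exact: hg.
by apply: hurwitz_unit => //=.
Qed.

End Necessity.

Theorem theorem4p11 (R : realType) (F : base_field) (N : nat)
    (L K : 'I_N -> nat)
    (N_gt0 : (0 < N)%N)
    (L_gt0 : forall k : 'I_N, (0 < L k)%N)
    (K_gt0 : forall k : 'I_N, (0 < K k)%N)
    (G : transfer_tensor R L K) (G_FHinf : FHinf F G)
    (SG : realization R L K)
    (SG_over : realization_over F SG)
    (SG_realizes : realizes SG G)
    (SG_stabilizable : stabilizable SG)
    (SG_detectable : detectable SG) :
  (forall Delta : transfer_tensor R K L,
     FHinf F Delta -> (Hinf_norm Delta <= 1%:E)%E ->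
     forall SD : realization R K L,
       realization_over F SD -> realizes SD Delta ->
       stabilizable SD -> detectable SD ->
       internally_stable F SG SD)
  <-> (Hinf_norm G < 1%:E)%E.
Proof.
have SG_hurwitz : hurwitzm (sA SG).
  by apply: realization_hurwitz SG_realizes SG_stabilizable SG_detectable => p; case: (G_FHinf p).
split=> [hrob|G1 Delta fD D1 SD oD rDel sDel dDel].
  exact: robustly_stable_norm_lt1 hrob.
exact: small_gain_internally_stable fD rDel sDel dDel G1 D1.
Qed.
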